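(* Let $d\ge 1$ and $n\ge 2$ be integers. There exists a nonorientable regular embedding of the Hamming graph $H(d,n)$ if and only if one of the following holds: (1) $n=2$ and $d=2$; (2) $n=3$ or $n=4$ (and $d\ge 1$ is arbitrary); (3) $n=6$ and $d=1$ or $d=2$. Moreover, in cases (1) and (2) the nonorientable regular embedding of $H(d,n)$ is unique up to isomorphism, whereas in case (3) there are, up to isomorphism, exactly two nonorientable regular embeddings of $H(d,n)$ for each of the two graphs $H(1,6)$ and $H(2,6)$.
   Context: The Hamming graph $H(d,n)$ is the Cartesian product of $d$ complete graphs on $n$ vertices: its vertex set is $\{0,1,\dots,n-1\}^d$, and two vertices are adjacent if and only if they differ in exactly one coordinate. A map is a 2-cell embedding of a connected graph $K$, with edge set $E$, in a compact connected surface $S$ without boundary (every component of the complement of the graph is an open disc). Its flags are its mutually incident vertex-edge-face triples, understood topologically, i.e. the $4|E|$ triangles of the barycentric subdivision of the map (each edge lies in exactly 4 flags). An automorphism of a map is a permutation of its flags that preserves the three relations of differing only in the vertex, only in the edge, or only in the face (adjacency of triangles across a side of each of the three types); it is induced by a self-homeomorphism of $S$ preserving the embedded graph. The automorphism group acts semiregularly on flags, so it has order at most $4|E|$; the map is called regular if equality holds, i.e. if the automorphism group acts regularly on flags. A regular embedding of $K$ is an embedding of $K$ that gives a regular map; it is nonorientable if $S$ is nonorientable. Two embeddings of $K$ are isomorphic if there is a homeomorphism between the underlying surfaces that maps the embedded graph onto the embedded graph (inducing a graph isomorphism). *)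

(* Defs.v *)
From HB Require Import structures.
From mathcomp Require Import all_boot all_fingroup.

Set Implicit Arguments.
Unset Strict Implicit.
Unset Printing Implicit Defensive.

Record sgraph := SGraph {
  vert :> finType;
  adj : rel vert;
  adj_sym : symmetric adj;
  adj_irr : irreflexive adj
}.

Definition edges (K : sgraph) : {set {set K}} :=
  [set A | [exists u, exists v, adj u v && (A == [set u; v])]].

Definition hamming_adj d n : rel {ffun 'I_d -> 'I_n} :=
  fun u v => #|[set i | u i != v i]| == 1.

Lemma hamming_adj_sym d n : symmetric (@hamming_adj d n).
Proof.
move=> u v; rewrite /hamming_adj; congr (_ == _); apply: eq_card => i.
by rewrite !inE eq_sym.
Qed.

Lemma hamming_adj_irr d n : irreflexive (@hamming_adj d n).
Proof.
move=> u; rewrite /hamming_adj; suff -> : [set i | u i != u i] = set0.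
  by rewrite cards0.
by apply/setP=> i; rewrite !inE eqxx.
Qed.

(* H(d, n) *)
Definition hamming d n : sgraph :=
  SGraph (@hamming_adj_sym d n) (@hamming_adj_irr d n).

(* A map on a compact connected surface without boundary, given by its
   barycentric subdivision: [r0 x], [r1 x], [r2 x] are the triangles adjacent
   to the triangle x across the side opposite to its vertex-corner,
   edge-corner, face-corner, so that x and [r0 x] (resp. [r1 x], [r2 x])
   differ only in the vertex (resp. edge, face). The surface is recovered by
   gluing the triangles: finitely many of them make it compact, transitivity
   makes it connected, and the absence of fixed points leaves no boundary.
   The conditions on r0 and r2 say that the four triangles x, r0 x, r2 x,
   r0 (r2 x) around an edge are distinct and close up. Loops, multiple edges,
   and vertices or faces of degree 1 or 2 are allowed. *)
Record smap := SMap {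
  flag :> finType;
  r0 : {perm flag};
  r1 : {perm flag};
  r2 : {perm flag};
  r0K : involutive r0;
  r1K : involutive r1;
  r2K : involutive r2;
  r0_free : forall x, r0 x != x;
  r1_free : forall x, r1 x != x;
  r2_free : forall x, r2 x != x;
  r02C : forall x, r0 (r2 x) = r2 (r0 x);
  r02_free : forall x, r0 (r2 x) != x;
  flag_trans : [transitive <<[set r0; r1; r2]>>%g, on [set: flag] | 'P]
}.

(* The cells of the map, each one as the set of the flags incident with it. *)
Definition map_vertices (M : smap) : {set {set M}} :=
  [set orbit 'P <<[set r1 M; r2 M]>>%g x | x : M].

Definition map_edges (M : smap) : {set {set M}} :=
  [set orbit 'P <<[set r0 M; r2 M]>>%g x | x : M].

(* The flag triangles can be coherently oriented: with respect to the cyclic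
   order (vertex, edge, face) of their corners, two triangles sharing a side
   must get opposite signs. *)
Definition orientable (M : smap) : Prop :=
  exists c : M -> bool, forall x : M,
    [/\ c (r0 M x) = ~~ c x, c (r1 M x) = ~~ c x & c (r2 M x) = ~~ c x].

Definition nonorientable (M : smap) : Prop := ~ orientable M.

Definition map_hom (M N : smap) (f : M -> N) : Prop :=
  forall x : M, [/\ f (r0 M x) = r0 N (f x),
                    f (r1 M x) = r1 N (f x) &
                    f (r2 M x) = r2 N (f x)].

Definition map_aut (M : smap) (a : {perm M}) : Prop := @map_hom M M a.

(* The automorphism group acts regularly on flags. *)
Definition regular (M : smap) : Prop :=
  forall x y : M, exists! a : {perm M}, map_aut a /\ a x = y.

(* An embedding of K: a map together with an identification of the vertices
   and edges of K with its vertices and edges, preserving and reflecting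
   incidence. *)
Record embedding (K : sgraph) := Embedding {
  emb_map :> smap;
  emb_v : K -> {set emb_map};
  emb_e : {set K} -> {set emb_map};
  emb_v_inj : injective emb_v;
  emb_v_im : emb_v @: [set: K] = map_vertices emb_map;
  emb_e_inj : {in edges K &, injective emb_e};
  emb_e_im : emb_e @: edges K = map_edges emb_map;
  emb_inc : forall (v : K) (A : {set K}), A \in edges K ->
    (v \in A) = (emb_v v :&: emb_e A != set0)
}.

(* A flag bijection of this kind is what a homeomorphism of the surfaces taking
   the embedded graph to the embedded graph induces; the labellings [emb_v] and
   [emb_e] are not required to be preserved. *)
Definition emb_iso (K : sgraph) (M N : embedding K) : Prop :=
  exists2 f : M -> N, bijective f & map_hom f.

Definition nonor_reg_embedding (K : sgraph) (M : embedding K) : Prop :=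
  nonorientable M /\ regular M.

(* Up to isomorphism there are exactly k nonorientable regular embeddings. *)
Definition nonor_reg_count (K : sgraph) (k : nat) : Prop :=
  exists s : 'I_k -> embedding K,
    [/\ forall i, nonor_reg_embedding (s i),
        forall i j, emb_iso (s i) (s j) -> i = j &
        forall M : embedding K, nonor_reg_embedding M ->
          exists i, emb_iso M (s i)].

(* Main.v *)
(** Let v be a vertex of a regular embedding of H(d,n), of degree m = d(n-1).
    Number its neighbours by Z/m along the rotation at v, starting with the edge
    vw of a flag, and number those of w in the same way from the opposite end of
    that edge.  Translation along vw (the identity on the line of v and w, the
    opposite side of a square elsewhere) takes neighbour i of v to neighbour
    rho(i) of w, where by regularity rho is the same for all flags.  Reflections
    make rho odd, and two neighbours i, j of v are adjacent iff d | i - j.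

    Walking around a triangle with angle j in dZ/m brings x back either to itself or
    to its mirror image; with e = 1 or -1 accordingly, rho(j) = -e j and
    rho(rho(i) + e j) = e rho(i - j) - j.  If e is constant these equations force
    n <= 4 and determine rho up to sign; the sign + is realized by an orientable
    map.  If e is not constant, they give 5i = 0 on dZ/m and 2 = 0 mod d, hence
    n = 6 and d <= 2, and again rho up to sign.  For n = 2 there are only squares; a
    square can be orientation-reversing only for the angle d/2, and for d > 2 the
    functional equation of that square contradicts those of the others, so that the
    map is orientable because the cube is simply connected modulo its squares.

    Conversely an embedding of degree at least 3 is determined by rho, since a
    flag is determined by its numbered neighbours; the same argument applied to a
    single map shows that every map with a uniform rho is regular. *)

Require Import Defs.
From mathcomp Require Import all_boot all_fingroup all_algebra.
From mathcomp Require Import cyclic ring zify.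

Set Implicit Arguments.
Unset Strict Implicit.
Unset Printing Implicit Defensive.

Import GRing.Theory.

(** * Labelled maps and embeddings *)

(** In degree at least 3 the positions 1 and -1 of the rotation differ, so the numbered neighbours
    tell a flag from its mirror image. In degree 2 they do not: the two cycles H(1,3) and H(2,2) are
    treated apart, through the dihedral group generated by [spin] and [flip], and are classified by
    whether one tour of the cycle returns to the flag or to its reflection. In degree 1 there are
    only four flags. The sign of a triangle is what detects nonorientability: turns and flips
    preserve an orientation while [r2] reverses it, so in an orientable map every triangle has
    rho(j) = -j. For existence, n = 3 and n = 4 share one formula, in which the group structure Z/3
    or (Z/2)^2 on a line orders its points. No such formula is used for n = 6: the numbering of the
    neighbours of one vertex is transported over the graph by [rho], and a finite computation checks
    that the result is coherent along every edge. *)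

Lemma orbit_gen_ind (T : finType) (A : {set {perm T}}) (S : T -> Prop) :
  (forall a x, a \in A -> S x -> S (a x)) ->
  forall x y, S x -> y \in orbit 'P <<A>>%g x -> S y.
Proof.
move=> clA x y Sx /orbitP[g /gen_prodgP[n [c cA ->]] <-] {g y} /=.
rewrite /aperm; elim: n c cA => [|n IHn] c cA; first by rewrite big_ord0 perm1.
by rewrite big_ord_recr permM; apply: clA => //; apply: IHn => i.
Qed.

Lemma orbit_gen_step (T : finType) (A : {set {perm T}}) (a : {perm T}) x y :
  a \in A -> y \in orbit 'P <<A>>%g x -> a y \in orbit 'P <<A>>%g x.
Proof.
move=> aA /orbitP[g gA <-]; apply/orbitP; exists (g * a)%g; last first.
  by rewrite /= /aperm permM.
by rewrite groupM // mem_gen.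
Qed.

Lemma flag_ind (M : smap) (S : M -> Prop) :
  (forall x, S x -> [/\ S (r0 M x), S (r1 M x) & S (r2 M x)]) ->
  forall x y, S x -> S y.
Proof.
move=> clS x y Sx; have := flag_trans M.
move=> /atransP/(_ x (in_setT _)) tr.
have : y \in orbit 'P <<[set r0 M; r1 M; r2 M]>>%g x by rewrite tr inE.
by apply: (orbit_gen_ind _ Sx) => a z; rewrite !inE -orbA => /or3P[] /eqP-> /clS[].
Qed.

Lemma map_edge_orbit (M : smap) (x y : M) :
  y \in orbit 'P <<[set r0 M; r2 M]>>%g x =
  (y \in [:: x; r0 M x; r2 M x; r0 M (r2 M x)]).
Proof.
have h0 : r0 M \in [set r0 M; r2 M] by rewrite !inE eqxx.
have h2 : r2 M \in [set r0 M; r2 M] by rewrite !inE eqxx orbT.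
apply/idP/idP.
  apply: (@orbit_gen_ind _ _ (fun z => z \in [:: x; r0 M x; r2 M x; r0 M (r2 M x)]));
    last by rewrite !inE eqxx.
  move=> a z; rewrite !inE => /orP[] /eqP-> /or4P[] /eqP->;
    rewrite ?r02C ?r0K ?r2K -?r02C ?r0K ?r2K ?eqxx ?orbT //.
rewrite !inE => /or4P[] /eqP->; rewrite -?r02C;
  do ?[exact: orbit_refl | apply: orbit_gen_step => //].
Qed.

(* [vt x] is the vertex of K at the vertex-corner of the flag x. *)
Record labelled (K : sgraph) (M : smap) (vt : M -> K) : Prop := Labelled {
  vt_r1 : forall x, vt (r1 M x) = vt x;
  vt_r2 : forall x, vt (r2 M x) = vt x;
  vt_r0 : forall x, adj (vt x) (vt (r0 M x));
  vt_orbit : forall x y, vt x = vt y ->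
    y \in orbit 'P <<[set r1 M; r2 M]>>%g x;
  vt_dart : forall x y, vt x = vt y -> vt (r0 M x) = vt (r0 M y) ->
    y = x \/ y = r2 M x;
  vt_surj : forall u v, adj u v -> exists x, vt x = u /\ vt (r0 M x) = v
}.

Lemma edgesP (K : sgraph) (A : {set K}) :
  reflect (exists u v, adj u v /\ A = [set u; v]) (A \in edges K).
Proof.
rewrite inE; apply: (iffP existsP) => [[u /existsP[v /andP[uv /eqP->]]]|].
  by exists u, v.
by case=> u [v [uv ->]]; exists u; apply/existsP; exists v; rewrite uv eqxx.
Qed.

(** The vertex orbits partition the flags, so each flag lies over exactly one vertex of K. An edge
    orbit meets only the orbits of its two ends, and by the incidence condition the edge of K
    labelling it must be that pair. *)
Lemma embedding_labelled (K : sgraph) (M : embedding K) :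
  exists vt : M -> K, labelled vt.
Proof.
have ex x : exists v, x \in emb_v M v.
  have : orbit 'P <<[set r1 M; r2 M]>>%g x \in map_vertices M by apply: imset_f.
  rewrite -emb_v_im => /imsetP[v _ vE]; exists v; rewrite -vE; exact: orbit_refl.
pose vt x := xchoose (ex x).
have vtP x : x \in emb_v M (vt x) by apply: (xchooseP (ex x)).
have orbv v : exists x, emb_v M v = orbit 'P <<[set r1 M; r2 M]>>%g x.
  have : emb_v M v \in map_vertices M by rewrite -emb_v_im imset_f ?inE.
  by case/imsetP => x _ ->; exists x.
have orbV x v : x \in emb_v M v -> emb_v M v = orbit 'P <<[set r1 M; r2 M]>>%g x.
  by case: (orbv v) => z -> /orbit_eqP.
have vtE x v : (x \in emb_v M v) = (vt x == v).
  apply/idP/eqP => [xv|<- //]; apply: (@emb_v_inj _ M).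
  by rewrite (orbV _ _ xv) (orbV _ _ (vtP x)).
have edgE x : exists A, A \in edges K /\
    emb_e M A = orbit 'P <<[set r0 M; r2 M]>>%g x.
  have : orbit 'P <<[set r0 M; r2 M]>>%g x \in map_edges M by apply: imset_f.
  by rewrite -emb_e_im => /imsetP[A AE ->]; exists A.
have h1 : r1 M \in [set r1 M; r2 M] by rewrite !inE eqxx.
have h2 : r2 M \in [set r1 M; r2 M] by rewrite !inE eqxx orbT.
have v1 x : vt (r1 M x) = vt x.
  apply/eqP; rewrite -vtE (orbV _ _ (vtP x)) orbit_gen_step ?orbit_refl //.
have v2 x : vt (r2 M x) = vt x.
  apply/eqP; rewrite -vtE (orbV _ _ (vtP x)) orbit_gen_step ?orbit_refl //.
have incE x A : A \in edges K -> emb_e M A = orbit 'P <<[set r0 M; r2 M]>>%g x ->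
    forall v, (v \in A) = (v == vt x) || (v == vt (r0 M x)).
  move=> AK AE v; rewrite (@emb_inc _ M _ _ AK) AE.
  apply/set0Pn/orP => [[y]|].
    rewrite inE vtE map_edge_orbit !inE => /andP[/eqP<-] /or4P[] /eqP->;
    by rewrite ?r02C ?v2 eqxx; auto.
  case=> /eqP->; [exists x | exists (r0 M x)];
    by rewrite inE vtP map_edge_orbit !inE eqxx ?orbT.
have adjE x : adj (vt x) (vt (r0 M x)).
  have [A [AK AE]] := edgE x; have := incE _ _ AK AE.
  have [u [v [uv ->]]] := edgesP _ AK => inc.
  have nuv : u != v by apply: contraTneq uv => ->; rewrite adj_irr.
  have := inc u; have := inc v; rewrite !inE !eqxx orbT /=.
  move=> /esym/orP[] /eqP vE /esym/orP[] /eqP uE; rewrite uE vE ?eqxx // in nuv uv *.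
  by rewrite adj_sym.
have edgE2 x : [set vt x; vt (r0 M x)] \in edges K.
  by apply/edgesP; exists (vt x), (vt (r0 M x)).
have edgE3 x : emb_e M [set vt x; vt (r0 M x)] = orbit 'P <<[set r0 M; r2 M]>>%g x.
  have [A [AK AE]] := edgE x; rewrite -AE; congr (emb_e _ _).
  by apply/setP => v; rewrite (incE _ _ AK AE) !inE.
exists vt; split=> //.
- by move=> x y xy; rewrite -(orbV _ _ (vtP x)) vtE xy.
- move=> x y xy xy0.
  have : y \in emb_e M [set vt y; vt (r0 M y)] by rewrite edgE3 orbit_refl.
  have nxy : vt x != vt (r0 M x).
    by apply: contraTneq (adjE x) => <-; rewrite adj_irr.
  rewrite -xy -xy0 edgE3 map_edge_orbit !inE => /or4P[] /eqP yE.
  + by left.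
  + by rewrite xy yE eqxx in nxy.
  + by right.
  + by rewrite xy yE r02C v2 eqxx in nxy.
move=> u v uv.
have AK : [set u; v] \in edges K by apply/edgesP; exists u, v.
have : emb_e M [set u; v] \in map_edges M by rewrite -emb_e_im imset_f.
case/imsetP => x _ /(incE _ _ AK) inc.
have nuv : u != v by apply: contraTneq uv => ->; rewrite adj_irr.
have := inc u; have := inc v; rewrite !inE !eqxx orbT /=.
move=> /esym/orP[] /eqP vE /esym/orP[] /eqP uE; rewrite uE vE ?eqxx // in nuv *.
  by exists (r0 M x); rewrite r0K.
by exists x.
Qed.

Section EmbeddingOf.
Variables (K : sgraph) (M : smap) (vt : M -> K).
Hypotheses (lab : labelled vt) (vt_onto : forall v, exists x, vt x = v).

Let ev (v : K) : {set M} := [set x | vt x == v].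
Let ee (A : {set K}) : {set M} := [set x | [set vt x; vt (r0 M x)] == A].

Lemma vt_neq x : vt x != vt (r0 M x).
Proof. by apply: contraTneq (vt_r0 lab x) => <-; rewrite adj_irr. Qed.

Let evE x : ev (vt x) = orbit 'P <<[set r1 M; r2 M]>>%g x.
Proof.
apply/setP => y; rewrite inE; apply/eqP/idP => [/esym|]; first exact: vt_orbit.
apply: (orbit_gen_ind (S := fun z => vt z = vt x)) => // a z.
by rewrite !inE => /orP[] /eqP->; rewrite ?(vt_r1 lab) ?(vt_r2 lab).
Qed.

Let eeE x : ee [set vt x; vt (r0 M x)] = orbit 'P <<[set r0 M; r2 M]>>%g x.
Proof.
apply/setP => y; rewrite inE map_edge_orbit !inE; apply/eqP/idP => [E|].
  have yx : vt y \in [set vt x; vt (r0 M x)] by rewrite -E !inE eqxx.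
  have y0x : vt (r0 M y) \in [set vt x; vt (r0 M x)] by rewrite -E !inE eqxx orbT.
  have := vt_neq y; move: yx y0x; rewrite !inE.
  case/orP => /eqP E1 /orP[] /eqP E2; rewrite E1 E2 ?eqxx // => _.
    by case: (vt_dart lab (esym E1) (esym E2)) => ->; rewrite eqxx ?orbT.
  rewrite -(@r0K M x) in E2.
  by case: (vt_dart lab (esym E1) (esym E2)) => ->; rewrite ?r02C eqxx ?orbT.
by case/or4P => /eqP->; rewrite ?r0K -?r02C ?r0K ?r02C ?(vt_r2 lab) 1?setUC.
Qed.

Lemma vertex_fibres_inj : injective ev.
Proof.
move=> u v; case: (vt_onto u) => x <- /setP/(_ x).
by rewrite !inE eqxx => /esym/eqP.
Qed.

Lemma vertex_fibres_im : ev @: [set: K] = map_vertices M.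
Proof.
apply/setP => A; apply/imsetP/imsetP => [[v _ ->]|[x _ ->]].
  by case: (vt_onto v) => x <-; exists x; rewrite ?evE.
by exists (vt x); rewrite ?inE ?evE.
Qed.

Let edge_flag A : A \in edges K -> exists x, A = [set vt x; vt (r0 M x)].
Proof.
by case/edgesP => u [v [/(vt_surj lab)[x [<- <-]] ->]]; exists x.
Qed.

Lemma edge_fibres_inj : {in edges K &, injective ee}.
Proof.
move=> A B /edge_flag[x ->] _ /setP/(_ x); rewrite !inE eqxx.
by move/esym/eqP.
Qed.

Lemma edge_fibres_im : ee @: edges K = map_edges M.
Proof.
apply/setP => A; apply/imsetP/imsetP => [[B /edge_flag[x ->] ->]|[x _ ->]].
  by exists x; rewrite ?eeE.
exists [set vt x; vt (r0 M x)]; rewrite ?eeE //.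
by apply/edgesP; exists (vt x), (vt (r0 M x)); rewrite (vt_r0 lab).
Qed.

Lemma fibres_inc (v : K) (A : {set K}) : A \in edges K ->
  (v \in A) = (ev v :&: ee A != set0).
Proof.
case/edge_flag => x ->; apply/idP/set0Pn => [|[y]].
  by rewrite !inE => /orP[] /eqP->; [exists x | exists (r0 M x)];
    rewrite !inE ?r0K eqxx //= setUC.
by rewrite inE [_ \in ev _]inE => /andP[/eqP <-]; rewrite inE => /eqP <-; rewrite !inE eqxx.
Qed.

Definition embedding_of : embedding K :=
  Embedding vertex_fibres_inj vertex_fibres_im edge_fibres_inj edge_fibres_im
    fibres_inc.

(** Commuting with [r1] and [r2], an automorphism permutes the vertex orbits; commuting with [r0],
    it permutes the darts. *)
Lemma map_aut_induced (a : {perm M}) : map_aut a -> exists g : K -> K,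
  [/\ forall x, vt (a x) = g (vt x), injective g &
      forall u v, adj (g u) (g v) = adj u v].
Proof.
move=> ha; have a0 z : a (r0 M z) = r0 M (a z) by case: (ha z).
have a1 z : a (r1 M z) = r1 M (a z) by case: (ha z).
have a2 z : a (r2 M z) = r2 M (a z) by case: (ha z).
have vtE x y : vt x = vt y <-> vt (a x) = vt (a y).
  split => [/(vt_orbit lab)|/(vt_orbit lab) yx].
    apply: (orbit_gen_ind (S := fun z => vt (a x) = vt (a z))) => // b z.
    by rewrite !inE => /orP[] /eqP->; rewrite ?a1 ?a2 ?(vt_r1 lab) ?(vt_r2 lab).
  suff : vt x = vt ((a^-1)%g (a y)) by rewrite permK.
  move: yx; apply: (orbit_gen_ind (S := fun z => vt x = vt ((a^-1)%g z)));
    last by rewrite permK.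
  move=> b z bE; rewrite -{1 2}[z](permKV a).
  move: bE; rewrite !inE => /orP[] /eqP->; rewrite -?a1 -?a2 !permK;
  by rewrite ?(vt_r1 lab) ?(vt_r2 lab).
(* The default is never reached, since [vt] is onto. *)
pose g v := if [pick x | vt x == v] is Some x then vt (a x) else v.
have gE x : vt (a x) = g (vt x).
  rewrite /g; case: pickP => [y /eqP/esym/vtE // |/(_ x)]; by rewrite eqxx.
have g_inj : injective g.
  move=> u v; case: (vt_onto u) => x <-; case: (vt_onto v) => y <-.
  by rewrite -!gE => /(proj2 (vtE x y)).
exists g; split=> // u v; apply/idP/idP => uv.
  case: (vt_surj lab uv) => x []; rewrite -[x](permKV a) -a0 !gE.
  by move=> /g_inj <- /g_inj <-; rewrite (vt_r0 lab).
by case: (vt_surj lab uv) => x [<- <-]; rewrite -!gE a0 (vt_r0 lab).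
Qed.

End EmbeddingOf.

(** * Hamming graphs *)

Section Hamming.
Variables d n : nat.
Let V := {ffun 'I_d -> 'I_n}.
Implicit Types (u v w y z s : V) (a b c : 'I_d) (t : 'I_n).
Local Notation adj := (@hamming_adj d n).

Lemma hamP u v :
  reflect (exists2 a, u a != v a & forall b, b != a -> u b = v b) (adj u v).
Proof.
apply: (iffP cards1P) => [[a /setP E]|[a ha hb]]; exists a.
- by have := E a; rewrite !inE eqxx => ->.
- by move=> b ba; have := E b; rewrite !inE (negPf ba) => /negbFE/eqP.
apply/setP => b; rewrite !inE; case: (eqVneq b a) => [-> //|/hb ->].
by rewrite eqxx.
Qed.

Lemma hamC u v : adj u v = adj v u.
Proof. exact: hamming_adj_sym. Qed.

Lemma ham_neq u v : adj u v -> u != v.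
Proof. by apply: contraTneq => ->; rewrite hamming_adj_irr. Qed.

Definition upd v a t : V := [ffun c => if c == a then t else v c].

Lemma upd_same v a t : upd v a t a = t.
Proof. by rewrite ffunE eqxx. Qed.

Lemma upd_id v a : upd v a (v a) = v.
Proof. by apply/ffunP => c; rewrite ffunE; case: eqP => // ->. Qed.

Lemma upd_upd v a t t' : upd (upd v a t) a t' = upd v a t'.
Proof. by apply/ffunP => c; rewrite !ffunE; case: eqP. Qed.

Lemma upd_adj v a t : adj v (upd v a t) = (t != v a).
Proof.
apply/hamP/idP => [[b]|tv].
  by rewrite ffunE; case: (eqVneq b a) => [->|]; rewrite ?eqxx // eq_sym.
exists a; first by rewrite upd_same eq_sym.
by move=> b ba; rewrite ffunE (negPf ba).
Qed.

Variant ham_spec v : V -> Type :=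
  HamSpec a t of t != v a : ham_spec v (upd v a t).

Lemma hamW v w : adj v w -> ham_spec v w.
Proof.
move=> vw; have /sig2W[a wa wb] : exists2 a, v a != w a &
    [forall b, (b != a) ==> (v b == w b)].
  case/hamP: vw => a wa wb; exists a => //; apply/forallP => b.
  by apply/implyP => /wb ->.
have -> : w = upd v a (w a).
  apply/ffunP => b; rewrite ffunE; case: eqVneq => [-> //|ba].
  by have := forallP wb b; rewrite ba => /eqP.
by constructor; rewrite eq_sym.
Qed.

Lemma hamE v w : adj v w -> exists a t, t != v a /\ w = upd v a t.
Proof. by case/hamW => a t ta; exists a, t. Qed.

Lemma upd_inj v a b t t' : t != v a -> t' != v b ->
  (upd v a t == upd v b t') = (a == b) && (t == t').
Proof.
move=> ta tb; apply/eqP/andP => [E|[/eqP-> /eqP->]//].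
have : upd v a t a = upd v b t' a by rewrite E.
rewrite upd_same ffunE; case: (eqVneq a b) => [_ ->|_ E'] //.
by rewrite E' eqxx in ta.
Qed.

Lemma upd_adj2 v a b t t' : t != v a -> t' != v b ->
  adj (upd v a t) (upd v b t') = (a == b) && (t != t').
Proof.
move=> ta tb; case: (eqVneq a b) => [ab|ab] /=.
  by subst b; rewrite -(upd_upd v a t t') upd_adj upd_same eq_sym.
apply/hamP => [[c _ h]]; have := h a; have := h b; rewrite !ffunE !eqxx.
rewrite [b == a]eq_sym (negPf ab) => hb ha.
case: (eqVneq b c) => [bc|/hb E]; last by rewrite E eqxx in tb.
by move: ta; rewrite ha ?eqxx // -bc.
Qed.

(* The fourth corner of the square spanned by the edges vw and vy, or y itself
   if v, w, y lie on a common line. *)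
Definition compl v w y : V := [ffun c => if y c != v c then y c else w c].

Lemma compl_upd v a b t t' : t != v a -> t' != v b ->
  compl v (upd v a t) (upd v b t') =
  if a == b then upd v b t' else upd (upd v a t) b t'.
Proof.
move=> ta tb; case: (eqVneq a b) => ab; apply/ffunP => c; rewrite !ffunE.
  by subst b; case: (eqVneq c a) => [->|_]; rewrite ?tb ?eqxx.
case: (eqVneq c b) => [->|_]; first by rewrite tb.
by rewrite eqxx.
Qed.

Lemma upd_updC v a b t t' : a != b -> upd (upd v a t) b t' = upd (upd v b t') a t.
Proof.
move=> ab; apply/ffunP => c; rewrite !ffunE.
by case: (eqVneq c b) => // ->; rewrite eq_sym (negPf ab).
Qed.

Lemma compl_self v w : adj v w -> compl v w w = w.
Proof. by case/hamW => a t ta; rewrite compl_upd ?eqxx. Qed.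

Lemma compl_line v w y : adj v w -> adj v y -> adj w y -> compl v w y = y.
Proof.
case/hamW => a t ta; case/hamW => b t' tb.
by rewrite upd_adj2 // compl_upd // => /andP[->].
Qed.

Lemma compl_adj v w y : adj v w -> adj v y -> y != w -> adj w (compl v w y).
Proof.
case/hamW => a t ta; case/hamW => b t' tb; rewrite upd_inj // compl_upd //.
rewrite [b == a]eq_sym; case: (eqVneq a b) => ab /=.
  by subst b => ?; rewrite upd_adj2 // eqxx eq_sym.
by rewrite upd_adj ffunE [b == a]eq_sym (negPf ab).
Qed.

Lemma complC v w y : adj v w -> adj v y -> ~~ adj w y -> y != w ->
  compl v y w = compl v w y.
Proof.
case/hamW => a t ta; case/hamW => b t' tb; rewrite upd_inj // upd_adj2 //.
rewrite !compl_upd // [b == a]eq_sym; case: (eqVneq a b) => [-> /=|ab _ _].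
  by rewrite eq_sym => /negbNE ->.
by rewrite upd_updC // eq_sym.
Qed.

Lemma complK v w y : adj v w -> adj v y -> y != w -> compl w v (compl v w y) = y.
Proof.
case/hamW => a t ta; case/hamW => b t' tb; rewrite upd_inj // => yw.
rewrite compl_upd //; apply/ffunP => c; move: yw; rewrite [b == a]eq_sym.
case: (eqVneq a b) => [ab|ab] /=; rewrite !ffunE.
  by subst b; case: (eqVneq c a) => [_ ->|_ _]; rewrite ?eqxx.
case: (eqVneq c b) => [-> _|_ _]; first by rewrite [b == a]eq_sym (negPf ab) tb.
by rewrite eqxx.
Qed.

Definition square v w s u := [&& adj v w, adj v u, ~~ adj w u, u != w & s == compl v w u].

Lemma square_diag v w s u : square v w s u -> ~~ adj v s /\ s != v.
Proof.
case/and5P => vw vu; case/hamW: vw vu => a t ta; case/hamW => b t' tb.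
rewrite upd_inj // upd_adj2 // [b == a]eq_sym compl_upd // => wu uw /eqP->.
have ab : a != b by move: wu uw; rewrite [t' == t]eq_sym; case: (eqVneq a b) => //= _; case: eqP.
rewrite (negPf ab).
have sb : upd (upd v a t) b t' b != v b by rewrite upd_same.
have sa : upd (upd v a t) b t' a != v a by rewrite !ffunE (negPf ab) eqxx.
split; last by apply: contraNneq sb => ->.
apply/hamP => [[c _ h]]; case: (eqVneq b c) => [bc|/h E]; last by rewrite -E eqxx in sb.
by rewrite -h ?eqxx // -bc in sa.
Qed.

Lemma square_rot v w s u : square v w s u -> square w s u v.
Proof.
move=> q; have [vs sv] := square_diag q; case/and5P: q => vw vu wu uw /eqP sE.
have ws : adj w s by rewrite sE compl_adj.
have wv : adj w v by rewrite hamC.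
apply/and5P; split=> //; rewrite 1?hamC 1?eq_sym //.
by rewrite complC // sE complK // eqxx.
Qed.

Lemma squareP v w u : adj v w -> adj v u -> ~~ adj w u -> u != w ->
  square v w (compl v w u) u.
Proof. by move=> *; apply/and5P; split. Qed.

Lemma square_compl v w s u : square v w s u -> compl v w u = s.
Proof. by case/and5P => _ _ _ _ /eqP. Qed.

Lemma adj_line v w y z : adj v w -> adj v y -> adj v z ->
  adj w y -> adj y z -> w != z -> adj w z.
Proof.
case/hamW => a t ta; case/hamW => b t' tb; case/hamW => c t'' tc.
rewrite !upd_adj2 // => /andP[/eqP-> _] /andP[/eqP-> _].
by rewrite eqxx; apply: contraNneq => ->.
Qed.

(** Transport around a triangle has no holonomy: on the line of the triangle nothing moves, and off
    it only the coordinate of that line changes, which comes back to its start. *)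
Lemma compl_loop v w u y : adj v w -> adj v u -> adj v y -> adj w u ->
  y != w -> y != u -> compl u v (compl w u (compl v w y)) = y.
Proof.
case/hamW => a t ta; case/hamW => b t' tb; case/hamW => c t'' tc.
rewrite !upd_adj2 // !upd_inj // => /andP[/eqP ab tt']; subst b.
case: (eqVneq c a) => [ca|ca _ _].
  subst c => /= t''t t''t'.
  have wu : adj (upd v a t) (upd v a t') by rewrite upd_adj2 // eqxx.
  have wy : adj (upd v a t) (upd v a t'') by rewrite upd_adj2 // eqxx eq_sym.
  have uy : adj (upd v a t') (upd v a t'') by rewrite upd_adj2 // eqxx eq_sym.
  rewrite (compl_line _ _ wy) ?upd_adj // (compl_line wu wy uy) compl_line ?upd_adj //.
  by rewrite hamC upd_adj.
apply/ffunP => x; rewrite !ffunE.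
case: (eqVneq x c) => [->|xc]; first by rewrite (negPf ca) tc ?eqxx ?tc.
case: (eqVneq x a) => [->|xa]; last by rewrite !eqxx.
by do !rewrite eqxx /=.
Qed.

Lemma compl_mono v w y z : adj v w -> adj v y -> adj v z -> y != w -> z != w ->
  adj (compl v w y) (compl v w z) = adj y z.
Proof.
case/hamW => a t ta; case/hamW => b t' tb; case/hamW => c t'' tc.
have W x r : r != v x -> upd v x r != upd v a t ->
    compl v (upd v a t) (upd v x r) = upd (upd v a t) x r /\ r != upd v a t x.
  move=> rx; rewrite upd_inj // compl_upd // [x == a]eq_sym ffunE [x == a]eq_sym.
  by case: (eqVneq a x) => [ax|//]; subst x; rewrite upd_upd.
move=> /(W _ _ tb)[-> hb] /(W _ _ tc)[-> hc].
by rewrite !upd_adj2.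
Qed.

Lemma diff_compl v w y : adj v w -> adj v y -> ~~ adj w y -> y != w ->
  [set c | w c != compl v w y c] = [set c | v c != y c].
Proof.
case/hamW => a t ta; case/hamW => b t' tb.
rewrite upd_inj // upd_adj2 // [b == a]eq_sym compl_upd // => wu uw.
have ab : a != b by move: wu uw; rewrite [t' == t]eq_sym; case: (eqVneq a b) => //= _; case: eqP.
rewrite (negPf ab); apply/setP => c; rewrite !inE !ffunE.
case: (eqVneq c b) => [->|]; first by rewrite [b == a]eq_sym (negPf ab).
by rewrite !eqxx.
Qed.

Lemma card_nbrs v : #|[set w | adj v w]| = d * n.-1.
Proof.
pose S := [set x : 'I_d * 'I_n | x.2 != v x.1].
have -> : [set w | adj v w] = [set upd v x.1 x.2 | x in S].
  apply/setP => w; rewrite inE; apply/idP/imsetP => [/hamW[a t ta]|[[a t]]].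
    by exists (a, t); rewrite ?inE.
  by rewrite inE /= => ta ->; rewrite upd_adj.
rewrite card_in_imset => [|[a t] [b t']]; last first.
  by rewrite !inE /= => ta tb /eqP; rewrite upd_inj // => /andP[/eqP-> /eqP->].
rewrite cardsE -sum1_card -(pair_big_dep xpredT (fun a t => t != v a) (fun _ _ => 1)) /=.
under eq_bigr => a _ do rewrite sum1_card (eq_card (B := predC1 (v a))) // cardC1 card_ord.
by rewrite sum_nat_const card_ord.
Qed.

Lemma hamming_ind (S : V -> Prop) :
  (forall u v, adj u v -> S u -> S v) -> forall u v, S u -> S v.
Proof.
move=> clS u v; move: {2}#|_| (leqnn #|[set c | u c != v c]|) => k.
elim: k u => [|k IHk] u.
  rewrite leqn0 cards_eq0 => /eqP/setP E; suff -> : u = v by [].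
  by apply/ffunP => c; have := E c; rewrite !inE => /negbFE/eqP.
move=> le Su; case: (pickP [pred c | u c != v c]) => [c /= uc|E]; last first.
  by suff <- : u = v by []; apply/ffunP => c; have /negbFE/eqP := E c.
apply: (IHk (upd u c (v c))); last by apply: clS Su; rewrite upd_adj eq_sym.
rewrite -ltnS (leq_trans _ le) // proper_card //; apply/properP; split.
  apply/subsetP => x; rewrite !inE ffunE; case: (eqVneq x c) => [->|//].
  by rewrite eqxx.
by exists c; rewrite !inE // upd_same eqxx.
Qed.

(** This describes the fourth corner by adjacency alone, which is why graph automorphisms respect
    [compl]. *)
Lemma square_unique v w u z : adj v w -> adj v u -> ~~ adj w u -> u != w ->
  adj w z -> adj u z -> z != v -> z = compl v w u.
Proof.
move=> vw vu; case/hamW: vw vu => a t ta; case/hamW => b t' tb.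
rewrite upd_inj // upd_adj2 // [b == a]eq_sym compl_upd // => wu uw.
have ab : a != b by move: wu uw; rewrite [t' == t]eq_sym; case: (eqVneq a b) => //= _; case: eqP.
rewrite (negPf ab); case/hamW => x s sx; case: (eqVneq x a) => [xa|xa].
  subst x; rewrite upd_upd; case: (eqVneq s (v a)) => [->|sa].
    by rewrite upd_id eqxx.
  by rewrite upd_adj2 // [b == a]eq_sym (negPf ab).
move=> /hamP[y _ h] _; case: (eqVneq y a) => [ya|ya]; last first.
  have := h a; rewrite [a == y]eq_sym !ffunE eqxx (negPf ab) [a == x]eq_sym (negPf xa).
  by move=> /(_ ya) E; rewrite -E eqxx in ta.
subst y; case: (eqVneq x b) => [xb|xb]; last first.
  have := h x xa; rewrite !ffunE eqxx (negPf xb) => E.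
  by rewrite -E ffunE (negPf xa) eqxx in sx.
by subst x; have := h b xa; rewrite !ffunE !eqxx => ->.
Qed.

Lemma compl_aut (g : V -> V) : injective g -> (forall u v, adj (g u) (g v) = adj u v) ->
  forall v w u, adj v w -> adj v u -> u != w ->
  g (compl v w u) = compl (g v) (g w) (g u).
Proof.
move=> g_inj gA v w u vw vu uw; case wu: (adj w u).
  by rewrite !compl_line ?gA.
have /negbT wu' := wu.
have q := squareP vw vu wu' uw; have [_ sv] := square_diag q.
apply: square_unique; rewrite ?gA ?wu // ?(inj_eq g_inj) //.
  by rewrite compl_adj.
by rewrite -complC // compl_adj // eq_sym.
Qed.


Definition equivariant (th : V -> V) :=
  injective th /\ forall v w u, th (compl v w u) = compl (th v) (th w) (th u).

(** The neighbours of a vertex split into lines, one per coordinate, and adjacency among them says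
    which ones share a line. Matching two neighbourhoods thus matches coordinates and, within each
    coordinate, values; the extension acts coordinatewise. *)
Lemma ball_extension (I : finType) v v' (p p' : I -> V) : 1 < n ->
  injective p -> injective p' ->
  (forall w, adj v w <-> exists i, w = p i) ->
  (forall w, adj v' w <-> exists i, w = p' i) ->
  (forall i j, adj (p i) (p j) = adj (p' i) (p' j)) ->
  exists th, [/\ equivariant th, th v = v' & forall i, th (p i) = p' i].
Proof.
move=> n1 pI p'I pP p'P pp'.
have base (u : V) (q : I -> V) : (forall w, adj u w <-> exists i, w = q i) ->
    exists dr : I -> 'I_d, [/\ forall i c, (q i c == u c) = (c != dr i),
      forall i j, injective q -> (dr i == dr j) = (i == j) || adj (q i) (q j) &
      forall a t, t != u a -> exists i, q i = upd u a t].
  move=> qP; have uq i : adj u (q i) by apply/qP; exists i.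
  have /fin_all_exists[dr drP] i : exists a, exists2 t, t != u a & q i = upd u a t.
    by case: (hamW (uq i)) => a t ta; exists a, t.
  exists dr; split=> [i c|i j qI|a t ta].
  - have [t ta ->] := drP i; rewrite ffunE; case: (eqVneq c (dr i)) => [->|_].
      by rewrite (negPf ta).
    by rewrite eqxx.
  - have [t ta Ei] := drP i; have [t' ta' Ej] := drP j.
    rewrite -(inj_eq qI) Ei Ej upd_inj // upd_adj2 // -andb_orr.
    by case: (t == t'); rewrite andbT.
  - by case: (qP (upd u a t)) => + _; rewrite upd_adj => /(_ ta)[i ->]; exists i.
have [dr [drE drA drS]] := base v p pP; have [dr' [dr'E dr'A dr'S]] := base v' p' p'P.
have drdr' i j : (dr i == dr j) = (dr' i == dr' j) by rewrite drA // dr'A // pp'.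
have other (t : 'I_n) : exists t', t' != t.
  case: n n1 t => [|[|k]] // _ t; case: (eqVneq t ord0) => [->|]; first by exists ord_max.
  by rewrite eq_sym; exists ord0.
have dr_onto a : exists i, dr i = a.
  have [t ta] := other (v a); have [i iE] := drS a t ta; exists i; apply/eqP.
  by rewrite -[_ == _]negbK eq_sym -drE iE upd_same.
have dr'_onto a : exists i, dr' i = a.
  have [t ta] := other (v' a); have [i iE] := dr'S a t ta; exists i; apply/eqP.
  by rewrite -[_ == _]negbK eq_sym -dr'E iE upd_same.
have [q qE] := fin_all_exists dr'_onto.
(* The coordinate at [v] whose line is matched with the line of coordinate [b] at [v']. *)
pose al b := dr (q b).
have alE i : al (dr' i) = dr i by apply/eqP; rewrite drdr' qE.
have al_inj : injective al.
  by move=> b b' /eqP; rewrite /al drdr' !qE => /eqP.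
have [al' al'K alK] : bijective al by apply: injF_bij.
(* The default serves the value [t = v (al b)], for which the updated vertex is [v] itself and no
   neighbour; it has to go to [v' b]. *)
pose la b t := if [pick i | p i == upd v (al b) t] is Some i then p' i b else v' b.
have laI b t i : p i = upd v (al b) t -> la b t = p' i b.
  rewrite /la; case: pickP => [j /eqP Ej|/(_ i) /= /eqP //] Ei.
  by rewrite (pI j i) // Ej.
have lav b : la b (v (al b)) = v' b.
  rewrite /la; case: pickP => // j; rewrite upd_id => /eqP E.
  have : adj v (p j) by apply/pP; exists j.
  by rewrite E hamming_adj_irr.
have la_inj b : injective (la b).
  have dirb i t : t != v (al b) -> p i = upd v (al b) t -> dr' i = b.
    move=> tv iE; apply: al_inj; rewrite alE; apply/eqP.
    by rewrite eq_sym -[_ == _]negbK -drE iE upd_same.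
  have neq i t : t != v (al b) -> p i = upd v (al b) t -> p' i b != v' b.
    by move=> tv iE; rewrite dr'E (dirb i t) // eqxx.
  move=> t t'; case: (eqVneq t (v (al b))) => [->|tv];
    case: (eqVneq t' (v (al b))) => [->|tv'] //; rewrite ?lav.
  - have [i iE] := drS _ _ tv'; rewrite (laI _ _ _ iE) => E.
    by have := neq _ _ tv' iE; rewrite -E eqxx.
  - have [i iE] := drS _ _ tv; rewrite (laI _ _ _ iE) => E.
    by have := neq _ _ tv iE; rewrite E eqxx.
  have [i iE] := drS _ _ tv; have [j jE] := drS _ _ tv'.
  rewrite (laI _ _ _ iE) (laI _ _ _ jE) => E.
  have ij : p' i = p' j.
    apply/ffunP => c; case: (eqVneq c b) => [-> //|cb].
    have /eqP-> : p' i c == v' c by rewrite dr'E (dirb i t).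
    by apply/esym/eqP; rewrite dr'E (dirb j t').
  by move: jE; rewrite -(p'I _ _ ij) iE => /(congr1 (fun f : V => f (al b))); rewrite !upd_same.
pose th (z : V) : V := [ffun b => la b (z (al b))].
exists th; split.
- split=> [z z' E|x y z]; apply/ffunP => c.
    have := congr1 (fun f : V => f (al' c)) E; rewrite /th !ffunE alK => /la_inj //.
  by rewrite !ffunE (inj_eq (@la_inj c)); case: ifP.
- by apply/ffunP => c; rewrite ffunE lav.
move=> i; apply/ffunP => b; rewrite ffunE.
case: (eqVneq b (dr' i)) => [->|bi].
  apply: laI; apply/ffunP => c; rewrite ffunE alE.
  by case: (eqVneq c (dr i)) => [-> //|]; rewrite -drE => /eqP.
have /eqP-> : p i (al b) == v (al b).
  by rewrite drE; apply: contra bi => /eqP E; rewrite -(inj_eq al_inj) E alE.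
by rewrite lav; apply/esym/eqP; rewrite dr'E.
Qed.

End Hamming.

(** * Rotation at a vertex *)

Section Rotation.
Variable M : smap.

(* Rotation about the vertex of a flag, and the half-turn about its edge; they
   are locked because rewriting with permM would unfold them. *)
Definition spin : {perm M} := locked (r2 M * r1 M)%g.
Definition flip : {perm M} := locked (r2 M * r0 M)%g.

Lemma spinE x : spin x = r1 M (r2 M x). Proof. by rewrite /spin -lock permM. Qed.
Lemma flipE x : flip x = r0 M (r2 M x). Proof. by rewrite /flip -lock permM. Qed.

Lemma flipK : involutive flip.
Proof. by move=> x; rewrite !flipE -r02C r2K r0K. Qed.

Lemma flip_r2 x : flip (r2 M x) = r2 M (flip x).
Proof. by rewrite !flipE r02C. Qed.

Lemma r2_spin k x : r2 M ((spin ^+ k)%g x) = (spin ^- k)%g (r2 M x).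
Proof.
elim: k x => [|k IHk] x; first by rewrite expg0 invg1 !perm1.
rewrite {1}expgSr permM spinE expgS invMg permM -IHk.
by apply: (canRL (permK spin)); rewrite !spinE r2K r1K.
Qed.

(** As [r2] inverts rotations, a coincidence with exponent k + 2 at [x] gives one with exponent k at
    [spin x]. The cases 0 and 1 say that [r2] and [r1] have no fixed points. *)
Lemma spin_neq_r2 k x : (spin ^+ k)%g x != r2 M x.
Proof.
elim/ltn_ind: k x => -[|[|k]] IHk x.
- by rewrite expg0 perm1 eq_sym r2_free.
- by rewrite expg1 spinE r1_free.
apply: contraNneq (IHk k _ (spin x)) => [E|//].
have := r2_spin 1 x; rewrite expg1 -E expgSr permM permK => ->.
by rewrite expgS permM.
Qed.

Lemma spinV x : (spin^-1)%g x = r2 M (r1 M x).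
Proof. by apply: (canLR (permK spin)); rewrite spinE r2K r1K. Qed.

Lemma r1E x : r1 M x = spin (r2 M x).
Proof. by rewrite spinE r2K. Qed.

Lemma r0E x : r0 M x = flip (r2 M x).
Proof. by rewrite flipE r2K. Qed.

End Rotation.

Section Labelled.
Variables (d n p : nat) (M : smap) (vt : M -> hamming d n).
Hypotheses (dnp : d * n.-1 = p.+2) (lab : labelled vt).
Local Open Scope ring_scope.
Implicit Types (x y z : M) (i j k : 'I_p.+2).
Local Notation adj := (@hamming_adj d n).

Lemma vt_spin (k : nat) x : vt ((spin M ^+ k)%g x) = vt x.
Proof.
elim: k x => [|k IHk] x; first by rewrite expg0 perm1.
by rewrite expgS permM IHk spinE (vt_r1 lab) (vt_r2 lab).
Qed.

Lemma vertex_flags x y : vt x = vt y ->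
  exists k : nat, y = (spin M ^+ k)%g x \/ y = r2 M ((spin M ^+ k)%g x).
Proof.
move/(vt_orbit lab).
pose S z := exists k : nat, z = (spin M ^+ k)%g x \/ z = r2 M ((spin M ^+ k)%g x).
apply: (orbit_gen_ind (S := S)); last by exists 0%N; left; rewrite expg0 perm1.
move=> a z; rewrite !inE => /orP[] /eqP-> [k kE].
  case: kE => ->.
    exists (k + #[spin M]%g.-1)%N; right; rewrite expgnDr -invg_expg permM spinV.
    by rewrite r2K.
  by exists k.+1; left; rewrite expgSr permM spinE.
by exists k; case: kE => ->; rewrite ?r2K; auto.
Qed.

(** Each edge end at the vertex carries two flags exchanged by [r2], of which a rotation orbit
    contains just one; hence the orbit is as large as the neighbourhood. *)
Lemma card_spin x : #|porbit (spin M) x| = p.+2.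
Proof.
rewrite -dnp -(card_nbrs (vt x)) -(card_in_imset (f := fun y => vt (r0 M y))); last first.
  move=> y z yx zx E.
  have yz : y \in porbit (spin M) z.
    by move: zx; rewrite -eq_porbit_mem => /eqP ->.
  case/porbitP: yz => k yE.
  case: (vt_dart lab _ E) => [|-> //|/eqP]; first by rewrite yE vt_spin.
  move/eqP/(congr1 (r2 M)); rewrite r2K => /esym/eqP.
  by rewrite yE (negPf (spin_neq_r2 _ _)).
apply: eq_card => w; rewrite inE; apply/imsetP/idP => [[y /porbitP[k ->] ->]|vw].
  by rewrite -(vt_spin k x); exact: (vt_r0 lab).
case: (vt_surj lab vw) => y [yx <-]; case: (vertex_flags (esym yx)) => k [] ->.
  by exists ((spin M ^+ k)%g x); rewrite ?mem_porbit.
by exists ((spin M ^+ k)%g x); rewrite ?mem_porbit // r02C (vt_r2 lab).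
Qed.

(** The exponent is taken in ['I_p.+2], the ring Z/m for the degree m, so that positions in the
    rotation can be added and negated. *)
Definition turn x i := (spin M ^+ i)%g x.

Lemma spin_order : (spin M ^+ p.+2)%g = 1%g.
Proof. by apply/permP => x; rewrite permX -(card_spin x) iter_porbit perm1. Qed.

Lemma turnD x i j : turn (turn x i) j = turn x (i + j).
Proof. by rewrite /turn -permM -expgnDr -(expg_mod (i + j)%N spin_order). Qed.

Lemma turn0 x : turn x 0 = x.
Proof. by rewrite /turn expg0 perm1. Qed.

Lemma r2_turn x i : r2 M (turn x i) = turn (r2 M x) (- i).
Proof.
rewrite /turn r2_spin; congr (fun_of_perm _ _); apply: (mulgI (spin M ^+ i)%g).
rewrite mulgV -expgnDr -(expg_mod _ spin_order).
by rewrite (_ : ((i + (- i)%R) %% p.+2)%N = (i - i)%R) // subrr expg0.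
Qed.

Lemma spin_turn x : spin M x = turn x 1.
Proof. by rewrite /turn; case: p; rewrite /= ?expg1. Qed.

Definition nbr x i := vt (r0 M (turn x i)).

Lemma vt_turn x i : vt (turn x i) = vt x.
Proof. exact: vt_spin. Qed.

Lemma nbr_turn x j i : nbr (turn x j) i = nbr x (j + i).
Proof. by rewrite /nbr turnD. Qed.

Lemma nbr_r2 x i : nbr (r2 M x) i = nbr x (- i).
Proof. by rewrite /nbr -[i]opprK -r2_turn opprK r02C (vt_r2 lab). Qed.

Lemma vt_flip x : vt (flip M x) = nbr x 0.
Proof. by rewrite /nbr turn0 flipE r02C (vt_r2 lab). Qed.

Lemma nbr_flip x : nbr (flip M x) 0 = vt x.
Proof. by rewrite -vt_flip flipK. Qed.

Lemma nbr_adj x i : adj (vt x) (nbr x i).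
Proof. by rewrite -(vt_turn x i); exact: (vt_r0 lab). Qed.

Lemma nbr_inj x : injective (nbr x).
Proof.
move=> i j E; case: (vt_dart lab _ E) => [|/esym|/esym {}E].
- by rewrite !vt_turn.
- rewrite /turn !permX -!(nth_traject _ (ltn_ord _)) => /eqP.
  rewrite nth_uniq ?size_traject ?ltn_ord // => [/eqP/val_inj //|].
  by rewrite -(card_spin x) uniq_traject_porbit.
have := spin_neq_r2 (j - i)%R (turn x i).
by rewrite -/(turn _ (j - i)) turnD addrC subrK -E eqxx.
Qed.

Lemma nbrP x w : adj (vt x) w <-> exists i, w = nbr x i.
Proof.
split=> [vw|[i ->]]; last exact: nbr_adj.
have : w \in [set nbr x i | i : 'I_p.+2].
  suff -> : [set nbr x i | i : 'I_p.+2] = [set w | adj (vt x) w] by rewrite inE.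
  apply/eqP; rewrite eqEcard card_nbrs dnp card_imset ?card_ord ?leqnn ?andbT.
    by apply/subsetP => _ /imsetP[i _ ->]; rewrite inE nbr_adj.
  exact: nbr_inj.
by case/imsetP => i _ ->; exists i.
Qed.

Lemma eq_dart x y : vt x = vt y -> nbr x 0 = nbr y 0 -> y = x \/ y = r2 M x.
Proof. by rewrite /nbr !turn0; apply: vt_dart. Qed.

End Labelled.

(** * The neighbour permutation *)

Section Rule.
Variables (d n p : nat) (M : smap) (vt : M -> hamming d n).
Hypotheses (dnp : d * n.-1 = p.+2) (lab : labelled vt).
Local Open Scope ring_scope.
Implicit Types (x y z : M) (i j k : 'I_p.+2).
Local Notation adj := (@hamming_adj d n).
Local Notation nb := (nbr (p := p) vt).

(* The local shape of an embedding in which all flags look alike: the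
   neighbour number i of vt x gives, along the edge of x, the neighbour number
   rho i of the other end. *)
Definition rule (rho : 'I_p.+2 -> 'I_p.+2) : Prop :=
  rho 0 = 0 /\ forall x i, i != 0 ->
    nb (flip M x) (rho i) = compl (vt x) (nb x 0) (nb x i).

Variables (rho : 'I_p.+2 -> 'I_p.+2) (x0 : M).
Hypothesis ruleP : rule rho.

Let nbr_adj := nbr_adj (p := p) lab.
Let nbr_inj := nbr_inj dnp lab.
Let nbr_turn := nbr_turn dnp lab.
Let nbr_r2 := nbr_r2 dnp lab.
Let nbr_flip := nbr_flip p lab.
Let vt_flip := vt_flip p lab.
Let vt_turn := vt_turn (p := p) lab.
Let rhoP x i : i != 0 -> nb (flip M x) (rho i) = compl (vt x) (nb x 0) (nb x i).
Proof. by case: ruleP => _; apply. Qed.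

Let nbr0 x i : i != 0 -> nb x i != nb x 0.
Proof. by move=> i0; rewrite (inj_eq (@nbr_inj x)). Qed.

Lemma rho0 : rho 0 = 0. Proof. by case: ruleP. Qed.

Lemma rhoN i : rho (- i) = - rho i.
Proof.
case: (eqVneq i 0) => [->|i0]; first by rewrite !(oppr0, rho0).
have := rhoP (r2 M x0) i0; rewrite flip_r2 !nbr_r2 oppr0 (vt_r2 lab).
by rewrite -rhoP ?oppr_eq0 // => /nbr_inj.
Qed.

Lemma rho_eq0 i : (rho i == 0) = (i == 0).
Proof.
apply/eqP/eqP => [ri|->]; last exact: rho0.
apply/eqP/idPn => i0; have := rhoP x0 i0; rewrite ri nbr_flip => E.
have := complK (nbr_adj x0 0) (nbr_adj x0 i) (nbr0 x0 i0).
rewrite -E compl_self; last by rewrite hamC nbr_adj.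
by apply/eqP/ham_neq/nbr_adj.
Qed.

(** Transport back from the other end of the edge undoes the transport, and the rule describes both
    by the same permutation. *)
Lemma rhoK : involutive rho.
Proof.
move=> i; case: (eqVneq i 0) => [->|i0]; first by rewrite !rho0.
apply: (nbr_inj (x := x0)); rewrite -{1}[x0](flipK x0) rhoP ?rho_eq0 //.
by rewrite vt_flip nbr_flip rhoP // complK // nbr0.
Qed.

Lemma rho_inj : injective rho. Proof. exact: inv_inj rhoK. Qed.

(** Here [true] is the sign of a closed walk that ends at a mirror image. *)
Definition sg (e : bool) i := if e then - i else i.

(** From v to w, to u and back to v, each turn being the number of the next vertex. The second is -j
    because v has number -rho(j) before the second flip, and [rho] is an odd involution. *)
Definition triangle_walk j x := flip M (turn (flip M (turn (flip M x) (rho j))) (- j)).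

Lemma triangleP x j : j != 0 -> adj (nb x 0) (nb x j) ->
  exists e, [/\ triangle_walk j x = (if e then r2 M (turn x j) else turn x j),
    rho j = sg (~~ e) j &
    forall i, i != 0 -> i != j -> rho (rho i + sg e j) = sg e (rho (i - j)) - j].
Proof.
move=> j0 aj; set v := vt x; set w := nb x 0; set u := nb x j in aj *.
set k := rho j; have k0 : k != 0 by rewrite rho_eq0.
have vw : adj v w by apply: nbr_adj.
have vu : adj v u by apply: nbr_adj.
set q1 := turn (flip M x) k.
have v1 : vt q1 = w by rewrite vt_turn vt_flip.
have n1 i : nb q1 i = nb (flip M x) (k + i) by rewrite nbr_turn.
have n10 : nb q1 0 = u by rewrite n1 addr0 rhoP // compl_line.
set q2 := turn (flip M q1) (- j).
have v2 : vt q2 = u by rewrite vt_turn vt_flip.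
have n2 i : nb q2 i = nb (flip M q1) (i - j) by rewrite nbr_turn addrC.
have rk : rho (- k) = - j by rewrite rhoN rhoK.
have n1k : nb q1 (- k) = v by rewrite n1 subrr nbr_flip.
have n20 : nb q2 0 = v.
  rewrite n2 sub0r -rk rhoP ?oppr_eq0 // v1 n10 n1k compl_line //; by rewrite hamC.
have tE : triangle_walk j x = flip M q2 by [].
have v3 : vt (flip M q2) = v by rewrite vt_flip.
have n30 : nb (flip M q2) 0 = u by rewrite nbr_flip.
have n3k : nb (flip M q2) k = w.
  rewrite rhoP // v2 n20 n2 subrr nbr_flip v1 compl_line // hamC //.
have vx : vt (turn x j) = vt (flip M q2) by rewrite vt_turn v3.
have nx : nb (turn x j) 0 = nb (flip M q2) 0 by rewrite nbr_turn addr0 n30.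
have [e eE] : exists e, flip M q2 = if e then r2 M (turn x j) else turn x j.
  by case: (eq_dart lab vx nx) => ->; [exists false | exists true].
have nbE i : nb (flip M q2) i = nb x (sg e i + j).
  by rewrite eE; case: (e); rewrite ?nbr_r2 nbr_turn addrC.
(* The vertex [w] is neighbour [k] of the last flag and neighbour 0 of [x]. *)
have kE : k = sg (~~ e) j.
  move: n3k; rewrite nbE => /nbr_inj /eqP; rewrite addr_eq0 => /eqP.
  by case: (e) => /= [/oppr_inj|].
exists e; split=> // i i0 ij.
(* Follow neighbour [i] around the triangle. Excluding 0 and [j] ensures that it never gets number
   0, the end of the edge about to be crossed, where the rule says nothing. *)
have walk : nb (flip M q2) (rho (rho (rho i - k) + j)) = nb x i.
  have ri0 : rho i - k != 0 by rewrite subr_eq0 (inj_eq rho_inj).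
  have rj0 : rho (rho i - k) + j != 0.
    by rewrite addr_eq0 -rk (inj_eq rho_inj) -[X in _ != X]add0r -subr_eq opprK subrK rho_eq0.
  rewrite rhoP // v2 n20 n2 addrK rhoP // v1 n10 n1 addrC subrK rhoP //.
  rewrite compl_loop // /w /u ?(inj_eq (@nbr_inj x)) ?nbr_adj //; exact: nbr_adj.
move: walk; rewrite nbE => /nbr_inj E.
have {}E : rho (rho (rho i - k) + j) = sg e (i - j).
  by rewrite -[in RHS]E addrK; case: (e); rewrite /= ?opprK.
have := congr1 rho E; rewrite rhoK kE => {}E.
have -> : sg e (rho (i - j)) = rho (sg e (i - j)) by case: (e); rewrite /= ?rhoN.
by rewrite -E addrK; case: (e) => /=; rewrite ?opprK.
Qed.

Definition square_walk j x :=
  flip M (turn (flip M (turn (flip M (turn (flip M x) (rho j))) (- j))) (rho j)).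

Lemma squareWP x j : j != 0 -> ~~ adj (nb x 0) (nb x j) ->
  exists e, [/\ square_walk j x = (if e then r2 M (turn x j) else turn x j) &
    e -> j = - j].
Proof.
move=> j0 aj; set v := vt x; set w := nb x 0; set u := nb x j in aj *.
set k := rho j; have k0 : k != 0 by rewrite rho_eq0.
have vw : adj v w by apply: nbr_adj.
have vu : adj v u by apply: nbr_adj.
have uw : u != w by apply: nbr0.
have rk : rho (- k) = - j by rewrite rhoN rhoK.
have q := squareP vw vu aj uw; set s := compl v w u in q.
have qws := square_rot q; have qsu := square_rot qws; have quv := square_rot qsu.
set q1 := turn (flip M x) k.
have v1 : vt q1 = w by rewrite vt_turn vt_flip.
have n1 i : nb q1 i = nb (flip M x) (k + i) by rewrite nbr_turn.
have n10 : nb q1 0 = s by rewrite n1 addr0 rhoP.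
have n1k : nb q1 (- k) = v by rewrite n1 subrr nbr_flip.
set q2 := turn (flip M q1) (- j).
have v2 : vt q2 = s by rewrite vt_turn vt_flip.
have n2 i : nb q2 i = nb (flip M q1) (i - j) by rewrite nbr_turn addrC.
have n20 : nb q2 0 = u.
  by rewrite n2 sub0r -rk rhoP ?oppr_eq0 // v1 n10 n1k (square_compl qws).
have n2j : nb q2 j = w by rewrite n2 subrr nbr_flip.
set q3 := turn (flip M q2) k.
have v3 : vt q3 = u by rewrite vt_turn vt_flip.
have n3 i : nb q3 i = nb (flip M q2) (k + i) by rewrite nbr_turn.
have n30 : nb q3 0 = v by rewrite n3 addr0 rhoP // v2 n20 n2j (square_compl qsu).
have n3k : nb q3 (- k) = s by rewrite n3 subrr nbr_flip.
have v4 : vt (flip M q3) = v by rewrite vt_flip.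
have n40 : nb (flip M q3) 0 = u by rewrite nbr_flip.
have n4j : nb (flip M q3) (- j) = w.
  by rewrite -rk rhoP ?oppr_eq0 // v3 n30 n3k (square_compl quv).
have vx : vt (turn x j) = vt (flip M q3) by rewrite vt_turn v4.
have nx : nb (turn x j) 0 = nb (flip M q3) 0 by rewrite nbr_turn addr0 n40.
case: (eq_dart lab vx nx) => qE; [exists false | exists true]; split=> // _.
move: n4j; rewrite qE nbr_r2 nbr_turn opprK => /nbr_inj/eqP.
by rewrite addr_eq0 => /eqP.
Qed.

End Rule.

(** * Maps with a common neighbour permutation *)

Section Uniqueness.
Variables (d n p : nat) (M N : smap) (vM : M -> hamming d n) (vN : N -> hamming d n).
Hypotheses (dnp : d * n.-1 = p.+3) (labM : labelled vM) (labN : labelled vN).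
Variable rho : 'I_p.+3 -> 'I_p.+3.
Hypotheses (ruleM : rule vM rho) (ruleN : rule vN rho).
Variable th : hamming d n -> hamming d n.
Hypothesis thE : equivariant th.
Local Open Scope ring_scope.

(** The graph of the isomorphism to be built. It is closed under the reflections because the rule
    determines the neighbours at the far end of an edge, and [flag_ind] then makes it total on both
    sides. *)
Let same (x : M) (y : N) :=
  vN y = th (vM x) /\ forall i : 'I_p.+3, nbr vN y i = th (nbr vM x i).

Let same_r2 x y : same x y -> same (r2 M x) (r2 N y).
Proof.
case=> [vE nE]; split=> [|i]; first by rewrite (vt_r2 labN) (vt_r2 labM).
by rewrite (nbr_r2 dnp labN) (nbr_r2 dnp labM).
Qed.

Let same_spin x y : same x y -> same (spin M x) (spin N y).
Proof.
case=> [vE nE]; rewrite (spin_turn p.+1 x) (spin_turn p.+1 y).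
split=> [|i]; first by rewrite (vt_turn labN) (vt_turn labM).
by rewrite (nbr_turn dnp labN) (nbr_turn dnp labM).
Qed.

Let same_flip x y : same x y -> same (flip M x) (flip N y).
Proof.
case=> [vE nE]; split=> [|i].
  by rewrite (vt_flip p.+1 labN) (vt_flip p.+1 labM) nE.
rewrite -(rhoK dnp labM x ruleM i).
case: (eqVneq (rho i) 0) => [->|r0].
  by rewrite (rho0 ruleM) (nbr_flip p.+1 labN) (nbr_flip p.+1 labM).
by rewrite ruleM.2 // ruleN.2 // !nE vE thE.2.
Qed.

Let same_step x y : same x y ->
  [/\ same (r0 M x) (r0 N y), same (r1 M x) (r1 N y) & same (r2 M x) (r2 N y)].
Proof.
move=> xy; have xy2 := same_r2 xy; rewrite !r0E !r1E.
by split=> //; [apply: same_flip | apply: same_spin].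
Qed.

(** Degree at least 3 enters here: it separates a flag from its mirror image. *)
Let neg1 : (- 1 : 'I_p.+3) <> 1.
Proof. by move/eqP; rewrite -subr_eq0 -opprD oppr_eq0 => /eqP/(congr1 val); rewrite /= !modn_small. Qed.

Let same_funct x y y' : same x y -> same x y' -> y' = y.
Proof.
case=> [vE nE] [vE' nE'].
have yy : vN y = vN y' by rewrite vE vE'.
have nn : nbr vN y (0 : 'I_p.+3) = nbr vN y' (0 : 'I_p.+3) by rewrite nE nE'.
case: (eq_dart labN yy nn) => // yE; have := nE' 1; rewrite yE (nbr_r2 dnp labN) -nE => /(nbr_inj dnp labN) /neg1 [].
Qed.

Let same_inj x x' y : same x y -> same x' y -> x' = x.
Proof.
case=> [vE nE] [vE' nE'].
have xx : vM x = vM x' by apply: thE.1; rewrite -vE.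
have nn : nbr vM x (0 : 'I_p.+3) = nbr vM x' (0 : 'I_p.+3) by apply: thE.1; rewrite -nE.
case: (eq_dart labM xx nn) => // xE; have := nE' 1; rewrite xE (nbr_r2 dnp labM) nE => /thE.1 /(nbr_inj dnp labM) /esym/neg1 [].
Qed.

Lemma map_iso_of_rule (x0 : M) (y0 : N) :
  vN y0 = th (vM x0) -> (forall i : 'I_p.+3, nbr vN y0 i = th (nbr vM x0 i)) ->
  exists f : M -> N, [/\ bijective f, map_hom f & f x0 = y0].
Proof.
move=> v0 n0; have xy0 : same x0 y0 by [].
have /fin_all_exists[f fP] x : exists y, same x y.
  apply: (@flag_ind M (fun x => exists y, same x y) _ x0); last by exists y0.
  move=> {}x [y /same_step[]]; split; by eexists; eassumption.
have /fin_all_exists[g gP] y : exists x, same x y.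
  apply: (@flag_ind N (fun y => exists x, same x y) _ y0); last by exists x0.
  move=> {}y [x /same_step[]]; split; by eexists; eassumption.
exists f; split.
- exists g => z; first exact: same_inj (fP z) (gP (f z)).
  exact: same_funct (gP z) (fP (g z)).
- by move=> x; have [h0 h1 h2] := same_step (fP x); split; apply: same_funct (fP _).
exact: same_funct xy0 (fP x0).
Qed.

End Uniqueness.

(** * Regular embeddings *)

Section Multiples.
Variables (d m p : nat).
Hypothesis dmp : d * m = p.+2.
Local Open Scope ring_scope.
Implicit Types i j : 'I_p.+2.

Lemma dvd_val_add i j : (d %| i)%N -> (d %| (i + j)%R)%N = (d %| j)%N.
Proof.
by move=> di; rewrite -(dvdn_addr j di) /dvdn /= modn_dvdm // -dmp dvdn_mulr.
Qed.

Lemma dvd_val_opp i : (d %| (- i)%R)%N = (d %| i)%N.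
Proof.
have h j : (d %| j -> d %| (- j)%R)%N.
  by move=> dj; rewrite -(dvd_val_add (- j) dj) subrr dvdn0.
by apply/idP/idP => [/h|/h //]; rewrite opprK.
Qed.

Lemma dvd_val_addr i j : (d %| j)%N -> (d %| (i + j)%R)%N = (d %| i)%N.
Proof. by rewrite addrC; apply: dvd_val_add. Qed.

Lemma val_mul_natr k : val ((k * d)%:R : 'I_p.+2) = ((k %% m) * d)%N.
Proof. by rewrite Zp_nat /= -dmp mulnC -muln_modr mulnC. Qed.

Lemma mul_natr_eq0 k : (((k * d)%:R : 'I_p.+2) == 0) = (m %| k)%N.
Proof.
rewrite -val_eqE val_mul_natr /= muln_eq0 /dvdn; case: d dmp => //.
by move=> *; rewrite orbF.
Qed.

Lemma dvd_val_natr k : (d %| ((k * d)%:R : 'I_p.+2))%N.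
Proof. by rewrite val_mul_natr dvdn_mull. Qed.

Lemma dvd_valP i : (d %| i)%N -> exists2 k, (k < m)%N & i = (k * d)%:R.
Proof.
case/dvdnP => k kE; have km : (k < m)%N.
  have := ltn_ord i; rewrite kE -dmp mulnC ltn_mul2l.
  by case/andP.
by exists k => //; apply/val_inj; rewrite val_mul_natr modn_small.
Qed.

Lemma card_dvd_val : #|[set i : 'I_p.+2 | d %| i]%N| = m.
Proof.
have d0 : (0 < d)%N by case: d dmp.
rewrite -[RHS]card_ord -(card_imset predT (f := fun k : 'I_m => (k * d)%:R : 'I_p.+2)).
  apply: eq_card => i; rewrite inE; apply/idP/imsetP => [/dvd_valP[k km ->]|[k _ ->]].
    by exists (Ordinal km).
  exact: dvd_val_natr.
move=> k l /(congr1 val); rewrite /= !val_mul_natr !modn_small ?ltn_ord // => /eqP.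
by rewrite eqn_pmul2r // => /eqP/val_inj.
Qed.

End Multiples.

Section Regular.
Variables (d n p : nat) (M : smap) (vt : M -> hamming d n).
Hypotheses (dnp : d * n.-1 = p.+2) (lab : labelled vt) (reg : regular M).
Variable x0 : M.
Local Open Scope ring_scope.
Implicit Types (x y z : M) (i j k : 'I_p.+2).
Local Notation adj := (@hamming_adj d n).
Local Notation nb := (nbr (p := p) vt).

Let nbI x : injective (nb x). Proof. exact: (nbr_inj dnp lab). Qed.

Lemma vt_onto v : exists x, vt x = v.
Proof.
have /card_gt0P[w] : (0 < #|[set w | adj v w]|)%N by rewrite card_nbrs dnp.
by rewrite inE => /(vt_surj lab)[x [<- _]]; exists x.
Qed.

Lemma transport x y : exists (a : M -> M) (g : hamming d n -> hamming d n),
  [/\ a x = y,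
      forall z, [/\ a (r2 M z) = r2 M (a z), a (flip M z) = flip M (a z) &
        forall i, a (turn z i) = turn (a z) i],
      forall z, vt (a z) = g (vt z), forall z i, nb (a z) i = g (nb z i) &
      injective g /\ forall u v, adj (g u) (g v) = adj u v].
Proof.
have [a [[ha ax] _]] := reg x y.
have [g [gE gI gA]] := map_aut_induced lab vt_onto ha.
have a0 z : a (r0 M z) = r0 M (a z) by case: (ha z).
have a1 z : a (r1 M z) = r1 M (a z) by case: (ha z).
have a2 z : a (r2 M z) = r2 M (a z) by case: (ha z).
have ak k z : a ((spin M ^+ k)%g z) = (spin M ^+ k)%g (a z).
  elim: (k : nat) z => [|l IH] z; first by rewrite !expg0 !perm1.
  by rewrite !expgS !permM IH !spinE a1 a2.
exists a, g; split=> //; last by move=> z i; rewrite /nbr -gE a0 /turn ak.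
by move=> z; split=> // [|i]; rewrite ?flipE ?a0 ?a2 // /turn ak.
Qed.

(** The numbers are read off at [x0]. An automorphism taking [x0] to another flag induces a graph
    automorphism, which respects [compl], so they are valid there too. *)
Lemma rule_exists : exists rho : 'I_p.+2 -> 'I_p.+2, rule vt rho.
Proof.
have /fin_all_exists[rho rhoE] i : exists k, if i == 0 then k = 0 else
    nb (flip M x0) k = compl (vt x0) (nb x0 0) (nb x0 i).
  case: eqVneq => [_|i0]; first by exists 0.
  have : adj (vt (flip M x0)) (compl (vt x0) (nb x0 0) (nb x0 i)).
    rewrite (vt_flip p lab) compl_adj ?(nbr_adj lab) //.
    by rewrite (inj_eq (@nbI _)).
  by case/(nbrP dnp lab) => k ->; exists k.
exists rho; split=> [|x i i0]; first exact: (rhoE 0).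
have [a [g [<- ha hv hn [gI gA]]]] := transport x0 x.
have := rhoE i; rewrite (negPf i0) => E.
have [_ <- _] := ha x0; rewrite !hn hv E (compl_aut gI gA) ?(nbr_adj lab) //.
by rewrite (inj_eq (@nbI _)).
Qed.

Lemma adj_transport x y i j : adj (nb x i) (nb x j) = adj (nb y i) (nb y j).
Proof. by have [a [g [<- _ _ hn [_ gA]]]] := transport x y; rewrite !hn gA. Qed.

(** By regularity the positions on the line of neighbour 0 form a subgroup. Its order is n - 1, and
    a cyclic group of order d(n - 1) has only one such subgroup, the multiples of d. *)
Lemma adj_nbr x i j : i != j -> adj (nb x i) (nb x j) = (d %| (i - j)%R)%N.
Proof.
pose H := [set k : 'I_p.+2 | (k == 0) || adj (nb x 0) (nb x k)].
have shift k l : adj (nb x k) (nb x l) = adj (nb x 0) (nb x (l - k)).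
  rewrite -(adj_transport (turn x k) x 0) !(nbr_turn dnp lab) addr0.
  by rewrite addrC subrK.
have sub k l : k \in H -> l \in H -> k + l \in H.
  rewrite !inE; case: (eqVneq k 0) => [-> _|k0 /= ak]; first by rewrite add0r.
  case: (eqVneq l 0) => [-> _|l0 /= al]; first by rewrite addr0 ak orbT.
  case: (eqVneq (k + l) 0) => //= kl.
  apply: (@adj_line _ _ (vt x) _ (nb x k)); rewrite ?(nbr_adj lab) //.
    by rewrite shift addrAC subrr add0r.
  by rewrite eq_sym (inj_eq (@nbI _)).
have gH : group_set H.
  by apply/group_setP; split=> [|k l]; [rewrite inE eqxx | apply: sub].
have cardH : #|H| = n.-1.
  rewrite -(card_imset _ (@nbI x)).
  have [a [t [ta E]]] := hamE (nbr_adj lab x (0 : 'I_p.+2)).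
  transitivity #|[set upd (vt x) a s | s in predC1 (vt x a)]|.
    apply: eq_card => w; apply/imsetP/imsetP => [[k]|[s]].
      rewrite inE -(inj_eq (@nbI x)).
      have [b [s [sb ->]]] := hamE (nbr_adj lab x k).
      rewrite E upd_inj // upd_adj2 // [b == a]eq_sym [s == t]eq_sym -andb_orr orbN andbT.
      by move=> /eqP ab ->; subst b; exists s.
    rewrite inE => sa ->; have : adj (vt x) (upd (vt x) a s) by rewrite upd_adj.
    case/(nbrP dnp lab) => k kE; exists k => //.
    rewrite inE -(inj_eq (@nbI x)) -kE E upd_inj // upd_adj2 //.
    by rewrite [s == t]eq_sym eqxx orbN.
  rewrite card_in_imset ?cardC1 ?card_ord // => s s' _ _.
  by move/(congr1 (fun f : {ffun _ -> _} => f a)); rewrite !upd_same.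
have HD : H = [set k : 'I_p.+2 | d %| k]%N.
  apply/eqP; rewrite eqEcard (card_dvd_val dnp) cardH leqnn andbT.
  apply/subsetP => k kH; rewrite inE.
  (* The order n - 1 of the subgroup kills [k], so d(n - 1) divides k(n - 1). *)
  have := expg_cardG (G := Group gH) kH; rewrite /= cardH FinRing.zmodXgE => kn.
  have : (d * n.-1 %| k * n.-1)%N.
    by rewrite dnp /dvdn -[_ == _]/(val (inZp (k * n.-1) : 'I_p.+2) == 0)%N -Zp_nat natrM natr_Zp mulr_natr kn.
  rewrite dvdn_pmul2r //; by case: n dnp => [|[|]]; rewrite ?muln0.
move=> ij; have : (i - j \in H) = (d %| (i - j)%R)%N by rewrite HD inE.
by rewrite inE subr_eq0 (negPf ij) => <- /=; rewrite hamC; exact: shift.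
Qed.

End Regular.

(** * Solving the triangle equations *)

Section Arithmetic.
Variables (d m p : nat).
Hypothesis dmp : d * m = p.+2.
Variables (rho : 'I_p.+2 -> 'I_p.+2) (e : 'I_p.+2 -> bool).
Local Open Scope ring_scope.
Implicit Types i j k : 'I_p.+2.
Let E j := (j != 0) && (d %| j)%N.
Hypothesis rho0 : rho 0 = 0.
Hypotheses (rhoN : forall i, rho (- i) = - rho i) (rhoK : involutive rho).
Hypothesis rho_dvd : forall i j, (d %| (i - j)%R)%N -> (d %| (rho i - rho j)%R)%N.
Hypothesis eN : forall j, E j -> e (- j) = e j.
Hypothesis rho_mult : forall j, E j -> rho j = sg (~~ e j) j.
Hypothesis triangle_eq : forall i j, E j -> i != 0 -> i != j ->
  rho (rho i + sg (e j) j) = sg (e j) (rho (i - j)) - j.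

Lemma dvd_sg b i : (d %| sg b i)%N = (d %| i)%N.
Proof. by case: b => //=; rewrite (dvd_val_opp dmp). Qed.

Lemma rho_sg b i : rho (sg b i) = sg b (rho i).
Proof. by case: b => //=; rewrite rhoN. Qed.

Lemma sgK b : involutive (@sg p b).
Proof. by case: b => i //=; rewrite opprK. Qed.

Lemma sgD b i j : sg b (i + j) = sg b i + sg b j.
Proof. by case: b => //=; rewrite opprD. Qed.

Let dvdD i j : (d %| j)%N -> (d %| (i + j)%R)%N = (d %| i)%N.
Proof. exact: (dvd_val_addr dmp). Qed.

Let dvdN i : (d %| (- i)%R)%N = (d %| i)%N.
Proof. exact: (dvd_val_opp dmp). Qed.

(** Modulo d the terms in [j] drop out of the triangle equation, leaving [i] congruent to the signed
    [rho i]. Two different signs will therefore force 2 = 0 modulo d. *)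
Lemma rho_mod i j : E j -> (d %| (rho i - sg (e j) i)%R)%N.
Proof.
move=> Ej; have [j0 dj] := andP Ej; have rj : (d %| rho j)%N by rewrite rho_mult // dvd_sg.
case di: (d %| i)%N.
  rewrite (dvd_val_addr dmp) ?(dvd_val_opp dmp) ?dvd_sg //.
  rewrite -(dvd_val_addr dmp _ (j := - rho j)) ?(dvd_val_opp dmp) //.
  by apply: rho_dvd; rewrite (dvd_val_addr dmp) // (dvd_val_opp dmp).
have i0 : i != 0 by apply: contraFneq di => ->; rewrite dvdn0.
have ij : i != j by apply: contraFneq di => ->.
have h1 : (d %| (rho (rho i + sg (e j) j) - rho (rho i))%R)%N.
  by apply: rho_dvd; rewrite addrAC subrr add0r dvd_sg.
have h2 : (d %| (rho (i - j) - rho i)%R)%N.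
  by apply: rho_dvd; rewrite addrAC subrr add0r (dvd_val_opp dmp).
have h3 : (d %| sg (e j) (rho (i - j) - rho i)%R)%N by rewrite dvd_sg.
move: h1; rewrite triangle_eq // rhoK => h1.
have -> : rho i - sg (e j) i = sg (e j) (sg (e j) (rho (i - j)) - j - i + j -
    sg (e j) (rho (i - j) - rho i)) by case: (e j) => /=; ring.
by rewrite dvd_sg dvdD ?dvdN // dvdD.
Qed.

Section SameSign.
Variable e0 : bool.
Hypothesis same : forall j, E j -> e j = e0.

(** On multiples of d, with a constant sign, the triangle equation becomes i - j = -i. So [i]
    determines every other nonzero multiple, and there are at most two. *)
Lemma same_sign_double i j : E i -> E j -> i != j -> j = i + i.
Proof.
move=> Ei Ej ij; have [i0 di] := andP Ei; have [j0 dj] := andP Ej.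
have Eij : E (i - j) by rewrite /E subr_eq0 ij dvdD ?dvdN.
have := triangle_eq Ej i0 ij; rewrite (rho_mult Ei) (rho_mult Eij) !same //.
have -> : sg (~~ e0) i + sg e0 j = sg (~~ e0) (i - j) by case: (e0) => /=; ring.
rewrite rho_sg (rho_mult Eij) same // sgK.
have -> : sg e0 (sg (~~ e0) (i - j)) = j - i by case: (e0) => /=; ring.
move=> E1; have {1}-> : j = i - (i - j) by ring.
by rewrite E1; ring.
Qed.

Lemma same_sign_small : (m <= 3)%N.
Proof.
rewrite leqNgt; apply/negP => m3.
have Ek (k : nat) : (0 < k < 4)%N -> E (k * d)%:R.
  move=> k4; rewrite /E (dvd_val_natr dmp) andbT (mul_natr_eq0 dmp).
  by apply/negP => /dvdn_leq; lia.
(* For m > 3 the pair d, 3d would give 3d = 2d. *)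
have := @same_sign_double (1 * d)%:R (3 * d)%:R (Ek 1%N isT) (Ek 3%N isT).
have neq (k l : nat) : (k < l < 4)%N -> ((k * d)%:R : 'I_p.+2) != (l * d)%:R.
  move=> kl; rewrite eq_sym -subr_eq0 -natrB ?leq_mul2r; last by lia.
  rewrite -mulnBl (mul_natr_eq0 dmp); apply/negP => /dvdn_leq; lia.
rewrite -natrD -mulnDl => /(_ (neq 1%N 3%N isT))/esym/eqP.
by rewrite (negPf (neq 2%N 3%N isT)).
Qed.

(** The constant 3d covers both remaining cases: it is d, of order two, for m = 2, and 0 for m = 3.
    With the sign removed, [rho] becomes an involution [r] moving [i] by a multiple of d, and
    [r_step] rules out the other multiples by making some element equal to itself minus d. *)
Lemma same_sign_rho : (1 < m)%N -> forall i,
  rho i = if (d %| i)%N then sg (~~ e0) i else sg e0 i + (3 * d)%:R.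
Proof.
move=> m1 i; set del : 'I_p.+2 := (1 * d)%:R.
have del0 : del != 0 by rewrite (mul_natr_eq0 dmp) dvdn1 neq_ltn m1 orbT.
have ddel : (d %| del)%N by rewrite (dvd_val_natr dmp).
have Edel : E del by rewrite /E del0.
case: ifP => [di|ndi].
  case: (eqVneq i 0) => [->|i0]; last by rewrite rho_mult ?same // /E i0.
  by rewrite rho0; case: (~~ e0); rewrite /= ?oppr0.
have noloop a : a <> a - del.
  by move/eqP; rewrite -subr_eq0 opprB addrCA subrr addr0 (negPf del0).
have d3 : (3 * d)%:R = del + del + del by rewrite -!natrD -!mulnDl.
pose r j := sg e0 (rho j).
have rE j : rho j = sg e0 (r j) by rewrite /r sgK.
have r_step j : (d %| j)%N = false -> r (r j + del) = r (j - del) - del.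
  move=> ndj; have j0 : j != 0 by apply: contraFneq ndj => ->; rewrite dvdn0.
  have jd : j != del by apply: contraFneq ndj => ->.
  have := triangle_eq Edel j0 jd; rewrite same // (rE j) -sgD rho_sg.
  by rewrite -!/(r _).
have r_mod j : (d %| (r j - j)%R)%N.
  have := rho_mod j Edel; rewrite same // -(dvd_sg e0).
  by rewrite (_ : sg e0 (rho j - sg e0 j) = r j - j) // /r; case: (e0) => /=; ring.
have r_inv : involutive r by move=> j; rewrite /r rho_sg sgK rhoK.
have r_inj := inv_inj r_inv.
have three : m = 2 \/ m = 3 by have := same_sign_small; lia.
have drop j k : (d %| j)%N = false -> (d %| k)%N -> (d %| (j + k)%R)%N = false.
  by move=> dj dk; rewrite dvdD.
rewrite rE; suff -> : r i = i + (3 * d)%:R.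
  rewrite sgD; congr (_ + _); case: (e0) => //=.
  case: three => mE; last first.
    by rewrite (_ : (3 * d)%:R = 0) ?oppr0 //; apply/eqP; rewrite (mul_natr_eq0 dmp) mE.
  apply/eqP; rewrite eq_sym -subr_eq0 opprK -natrD -mulnDl.
  by rewrite (mul_natr_eq0 dmp) mE.
have [k km kE] := dvd_valP dmp (r_mod i).
move/eqP: kE; rewrite subr_eq addrC => /eqP kE.
case: three => mE; rewrite mE in km.
  have two : del + del = 0 by apply/eqP; rewrite -natrD -mulnDl (mul_natr_eq0 dmp) mE.
  have -> : (3 * d)%:R = del.
    by rewrite d3 two add0r.
  case: k km kE => [|[|//]] _; last by [].
  rewrite mul0n addr0 => ri; have := r_step i ndi; rewrite ri.
  have -> : i - del = i + del by rewrite -[in RHS](subrK del i) -addrA two addr0.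
  by move/noloop.
have tri : del + del + del = 0.
  by apply/eqP; rewrite -!natrD -!mulnDl (mul_natr_eq0 dmp) mE.
have -> : (3 * d)%:R = 0 :> 'I_p.+2.
  by rewrite d3.
rewrite addr0.
have no j : (d %| j)%N = false -> r j != j + del.
  move=> ndj; apply/eqP => rj; have := r_step j ndj; rewrite rj.
  have -> : j + del + del = j - del.
    by rewrite -[LHS]addr0 -[X in _ + X](subrr del) addrA -(addrA j) -[j + _ + _]addrA tri addr0.
  exact: noloop.
case: k km kE => [|[|[|//]]] _; rewrite ?mul0n ?addr0 // => ri.
  by have := no i ndi; rewrite ri eqxx.
(* A shift of [i] by 2d is, as [r] is an involution and 3d = 0, a shift of [r i] by d, which is
   already excluded. *)
have nd' : (d %| (r i)%R)%N = false.
  by rewrite ri dvdD // (dvd_val_natr dmp).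
have := no _ nd'; rewrite r_inv {1}ri -addrA.
rewrite (_ : (2 * d)%:R = del + del) ?tri ?addr0 ?eqxx //.
by rewrite -natrD -mulnDl.
Qed.

End SameSign.

(** The triangle equations for (i, j) and (j, i) involve only the signs of i, j, i + j and i - j. If
    the last two signs agree, one of the equations reduces to i = 0 or j = 0; otherwise they say j =
    2i and i = -2j, or j = -2i and i = 2j, so that 5i = 0. *)
Lemma mixed_sign_five i j : E i -> E j -> e i != e j -> i *+ 5 = 0.
Proof.
move=> Ei Ej ne; have [i0 di] := andP Ei; have [j0 dj] := andP Ej.
have ij : i != j by apply: contraNneq ne => ->.
have Eij : E (i + j).
  rewrite /E dvdD // di andbT addr_eq0; apply: contraNneq ne => ->.
  by rewrite eN.
have Edf : E (i - j) by rewrite /E subr_eq0 ij dvdD ?dvdN.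
have Efd : E (j - i) by rewrite /E subr_eq0 eq_sym ij dvdD ?dvdN.
have E1 := triangle_eq Ej i0 ij.
have E2 := triangle_eq Ei j0 (introN eqP (fun h => elimN eqP ij (esym h))).
move: E1 E2; rewrite (rho_mult Ei) (rho_mult Ej) (rho_mult Edf) (rho_mult Efd).
have -> : e (j - i) = e (i - j) by rewrite -(eN Edf) opprB.
have -> : e i = ~~ e j by case: (e i) (e j) ne => [] [].
rewrite negbK -sgD [sg (~~ e j) j + _]addrC -sgD !rho_sg (rho_mult Eij).
move: (e j) (e (i + j)) (e (i - j)) => s s1 s2 E1 E2.
have X1 : sg s (sg (~~ s1) (i + j)) - (sg s (sg (~~ s2) (i - j)) - j) = 0.
  by rewrite E1 subrr.
have X2 : sg (~~ s) (sg (~~ s1) (i + j)) - (sg (~~ s) (sg (~~ s2) (j - i)) - i) = 0.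
  by rewrite E2 subrr.
have i_0 : i <> 0 by apply/eqP.
have j_0 : j <> 0 by apply/eqP.
have [s12|s12] := eqVneq s1 s2; last first.
  move: X1 X2; set A := (X in X = 0 -> _); set B := (X in _ -> X = 0 -> _) => A0 B0.
  have -> : i *+ 5 = B - sg (s != s1) (A + A).
    by rewrite /A /B; case: (s) (s1) (s2) s12 => [] [] [] //= _; ring.
  by rewrite A0 B0; case: (s != s1); rewrite /= !(oppr0, addr0).
case: (eqVneq s s1) => [ss|ss].
  case: j_0; rewrite -[RHS]oppr0 -X1 -s12 ss; case: (s1) => /=; ring.
case: i_0; rewrite -[RHS]oppr0 -X2 -s12; case: (s) (s1) ss => [] [] //= _; ring.
Qed.

Hypotheses (d_gt0 : (0 < d)%N) (m_gt1 : (1 < m)%N).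

Lemma rho_cases :
  (m <= 3)%N /\ (exists e0, (forall j, E j -> e j = e0) /\ forall i,
     rho i = if (d %| i)%N then sg (~~ e0) i else sg e0 i + (3 * d)%:R) \/
  [/\ m = 5, (d <= 2)%N & e (1 * d)%:R != e (2 * d)%:R].
Proof.
pose del : 'I_p.+2 := (1 * d)%:R.
have Ek (k : nat) : (0 < k < m)%N -> E (k * d)%:R.
  move=> km; rewrite /E (dvd_val_natr dmp) andbT (mul_natr_eq0 dmp).
  by apply/negP => /dvdn_leq; lia.
have Edel : E del by apply: Ek; rewrite m_gt1.
case: (altP (@forallP _ (fun j => E j ==> (e j == e del)))) => [same|].
  have {}same j : E j -> e j = e del by move=> Ej; apply/eqP/(implyP (same j)).
  left; split; first exact: same_sign_small same.
  by exists (e del); split=> //; apply: same_sign_rho same _.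
rewrite negb_forall => /existsP[j]; rewrite negb_imply => /andP[Ej ne]; right.
(* The sign of [i] differs from that of [j] or from that of [del]. *)
have five i : E i -> i *+ 5 = 0.
  move=> Ei; case: (eqVneq (e i) (e j)) => [ij|/(mixed_sign_five Ei Ej) //].
  by apply: (mixed_sign_five Ei Edel); rewrite ij.
have m5 : m = 5.
  have /eqP := five _ Edel; rewrite -mulrnA mul1n mulnC (mul_natr_eq0 dmp) => m5.
  have := @dvdn_leq m 5%N isT m5; case: (m) m5 m_gt1 => [|[|[|[|[|[|]]]]]] //.
have neg (k : nat) : (0 < k < 5)%N -> e ((5 - k) * d)%:R = e (k * d)%:R.
  move=> k5; rewrite -[RHS]eN ?Ek ?m5 //; congr (e _).
  apply/eqP; rewrite -addr_eq0 -natrD -mulnDl (mul_natr_eq0 dmp) m5.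
  by rewrite subnK //; lia.
split=> //.
(* Modulo d, [rho 1] is both 1 and -1. *)
- have h1 := rho_mod 1 Edel; have h2 := rho_mod 1 Ej.
  have : (d %| (sg (e j) 1 - sg (e del) (1 : 'I_p.+2))%R)%N.
    have -> : sg (e j) 1 - sg (e del) 1 =
      (rho 1 - sg (e del) 1) - (rho 1 - sg (e j) 1) :> 'I_p.+2 by ring.
    by rewrite dvdD ?dvdN.
  have -> : sg (e j) 1 - sg (e del) 1 = sg (e j) (1 + 1) :> 'I_p.+2.
    by case: (e j) (e del) ne => [] [] //= _; ring.
  by rewrite dvd_sg /= !modn_small; move: dmp; rewrite m5 => ?; try lia; move/dvdn_leq; apply.
(* Signs are even in the angle, so 4d and 3d have the signs of d and 2d; the second sign must
   already occur at 2d. *)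
have [k km jE] := dvd_valP dmp (proj2 (andP Ej)); rewrite m5 in km.
move: (ne) (proj1 (andP Ej)); rewrite /del jE eq_sym.
case: k km {jE} => [|[|[|[|[|//]]]]] _ //; rewrite ?mul0n ?eqxx //.
  by rewrite (neg 2%N).
by rewrite (neg 1%N) // eqxx.
Qed.

End Arithmetic.

(** * Signs of triangles and squares in a regular map *)

Section RegularRule.
Variables (d n p : nat) (M : smap) (vt : M -> hamming d n).
Hypotheses (dnp : d * n.-1 = p.+2) (lab : labelled vt) (reg : regular M).
Variables (x0 : M) (rho : 'I_p.+2 -> 'I_p.+2).
Hypothesis ruleP : rule vt rho.
Local Open Scope ring_scope.
Implicit Types (x y z : M) (i j k : 'I_p.+2).
Local Notation adj := (@hamming_adj d n).
Local Notation nb := (nbr (p := p) vt).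

Let nbI x : injective (nb x). Proof. exact: (nbr_inj dnp lab). Qed.
Let rhoI : injective rho. Proof. exact: (rho_inj dnp lab x0 ruleP). Qed.

(** Congruent positions are those on a common line, and transport along an edge preserves lines. *)
Lemma rho_dvd i j : (d %| (i - j)%R)%N -> (d %| (rho i - rho j)%R)%N.
Proof.
have h0 k : (d %| k)%N -> (d %| rho k)%N.
  move=> dk; case: (eqVneq k 0) => [->|k0]; first by rewrite (rho0 ruleP).
  have rk : rho k != 0 by rewrite (rho_eq0 dnp lab x0 ruleP).
  rewrite -[rho k]subr0 -(adj_nbr dnp lab reg (flip M x0)) //.
  rewrite (nbr_flip p lab) ruleP.2 // compl_line ?(nbr_adj lab) //.
    by rewrite hamC (nbr_adj lab).
  by rewrite hamC (adj_nbr dnp lab reg) // subr0.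
case: (eqVneq i j) => [-> _|ij dij]; first by rewrite subrr dvdn0.
case: (eqVneq i 0) dij ij => [->|i0 dij ij].
  by rewrite sub0r (rho0 ruleP) sub0r !(dvd_val_opp dnp) => /h0.
case: (eqVneq j 0) dij ij => [->|j0 dij ij].
  by rewrite !subr0 (rho0 ruleP) subr0 => /h0.
rewrite -(adj_nbr dnp lab reg (flip M x0)) ?(inj_eq rhoI) // !ruleP.2 //.
by rewrite compl_mono ?(nbr_adj lab) ?(inj_eq (@nbI _)) // (adj_nbr dnp lab reg).
Qed.

Lemma triangle_signs : exists e : 'I_p.+2 -> bool, forall j, (j != 0) && (d %| j)%N ->
  [/\ forall x, triangle_walk rho j x = (if e j then r2 M (turn x j) else turn x j),
      e (- j) = e j, rho j = sg (~~ e j) j &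
      forall i, i != 0 -> i != j ->
        rho (rho i + sg (e j) j) = sg (e j) (rho (i - j)) - j].
Proof.
have tw j : (j != 0) && (d %| j)%N -> exists e,
    [/\ triangle_walk rho j x0 = (if e then r2 M (turn x0 j) else turn x0 j),
    rho j = sg (~~ e) j &
    forall i, i != 0 -> i != j -> rho (rho i + sg e j) = sg e (rho (i - j)) - j].
  case/andP => j0 dj; apply: (triangleP dnp lab x0 ruleP) => //.
  by rewrite hamC (adj_nbr dnp lab reg) // subr0.
pose e j := triangle_walk rho j x0 != turn x0 j.
have eE j b : triangle_walk rho j x0 = (if b then r2 M (turn x0 j) else turn x0 j) ->
    e j = b.
  by rewrite /e => ->; case: b; rewrite ?r2_free ?eqxx.
exists e => j Ej; have [b [wE rE fE]] := tw j Ej; rewrite (eE _ _ wE).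
have all_x x : triangle_walk rho j x = (if b then r2 M (turn x j) else turn x j).
  have [a [g [<- ha _ _ _]]] := transport dnp lab reg x0 x.
  have h2 z : a (r2 M z) = r2 M (a z) by case: (ha z).
  have hf z : a (flip M z) = flip M (a z) by case: (ha z).
  have ht z i : a (turn z i) = turn (a z) i by case: (ha z).
  have := congr1 a wE; rewrite /triangle_walk !(hf, ht) => ->.
  by case: (b); rewrite ?h2 ?ht.
(* The walk of angle -j from [x0] is the mirror image of the walk of angle j from [r2 M x0]. *)
split=> //; apply: eE.
have rN := rhoN dnp lab x0 ruleP.
have tr z i : turn (r2 M z) i = r2 M (turn z (- i)).
  by rewrite (r2_turn dnp lab) opprK.
have := all_x (r2 M x0); rewrite /triangle_walk rN opprK flip_r2 !(tr, flip_r2).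
by rewrite opprK; case: (b) => /(inv_inj (@r2K M)).
Qed.

Lemma square_signs j : j != 0 -> ~~ (d %| j)%N -> exists e,
  (forall x, square_walk rho j x = if e then r2 M (turn x j) else turn x j) /\
  (e -> j = - j).
Proof.
move=> j0 dj.
have nadj : ~~ adj (nb x0 0) (nb x0 j).
  by rewrite hamC (adj_nbr dnp lab reg) // subr0.
have [e [wE je]] := squareWP dnp lab x0 ruleP j0 nadj.
exists e; split=> // x.
have [a [g [<- ha _ _ _]]] := transport dnp lab reg x0 x.
have h2 z : a (r2 M z) = r2 M (a z) by case: (ha z).
have hf z : a (flip M z) = flip M (a z) by case: (ha z).
have ht z i : a (turn z i) = turn (a z) i by case: (ha z).
have := congr1 a wE; rewrite /square_walk !(hf, ht) => ->.
by case: (e); rewrite ?h2 ?ht.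
Qed.

End RegularRule.

(** * Criteria for isomorphism and regularity *)

Section Comparison.
Variables (d n p : nat) (M N : smap) (vM : M -> hamming d n) (vN : N -> hamming d n).
Hypotheses (dnp : d * n.-1 = p.+3) (labM : labelled vM) (labN : labelled vN).
Variable rho : 'I_p.+3 -> 'I_p.+3.
Hypotheses (ruleM : rule vM rho) (ruleN : rule vN rho).
Local Open Scope ring_scope.

Definition uniform (L : smap) (vL : L -> hamming d n) (x : L) :=
  forall i j : 'I_p.+3, i != j ->
    hamming_adj (nbr vL x i) (nbr vL x j) = (d %| (i - j)%R)%N.

Lemma map_iso_of_uniform (x0 : M) (y0 : N) : uniform vM x0 -> uniform vN y0 ->
  exists f : M -> N, [/\ bijective f, map_hom f & f x0 = y0].
Proof.
move=> unM unN; have n1 : (1 < n)%N by case: n dnp => [|[|]]; rewrite ?muln0.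
have [|||||th [thE th0 thn]] := @ball_extension d n 'I_p.+3 (vM x0) (vN y0)
  (nbr vM x0) (nbr vN y0) n1.
- exact: (nbr_inj dnp labM).
- exact: (nbr_inj dnp labN).
- exact: (nbrP dnp labM).
- exact: (nbrP dnp labN).
- move=> i j; case: (eqVneq i j) => [->|ij]; last by rewrite unM ?unN.
  by rewrite !hamming_adj_irr.
exact: (map_iso_of_rule dnp labM labN ruleM ruleN thE (esym th0) (fun i => esym (thn i))).
Qed.

End Comparison.

Lemma regularI (M : smap) :
  (forall x y : M, exists f : M -> M, [/\ bijective f, map_hom f & f x = y]) ->
  regular M.
Proof.
move=> tr x y; have [f [/bij_inj fI fh fx]] := tr x y.
exists (perm fI); split=> [|a [ah ax]].
  by split=> [z|]; rewrite ?permE // /map_hom !permE; apply: fh.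
apply/permP => z; rewrite permE.
apply: (@flag_ind M (fun z => f z = a z) _ x); last by rewrite ax.
by move=> {}z E; have [] := fh z; have [] := ah z; rewrite E => -> -> -> -> -> ->.
Qed.

Lemma regular_of_uniform d n p (M : smap) (vt : M -> hamming d n)
    (rho : 'I_p.+3 -> 'I_p.+3) : d * n.-1 = p.+3 -> labelled vt -> rule vt rho ->
  (forall x, uniform p vt x) -> regular M.
Proof.
move=> dnp lab ru un; apply: regularI => x y.
exact: (map_iso_of_uniform dnp lab lab ru ru).
Qed.

Lemma orientable_iso (M N : smap) (f : M -> N) :
  map_hom f -> orientable N -> orientable M.
Proof.
move=> fh [c cP]; exists (fun x => c (f x)) => x.
by have [-> -> ->] := fh x; apply: cP.
Qed.

(** * Cubes *)

Section Coboundary.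
Variable d : nat.
Implicit Types (u : {ffun 'I_d -> 'I_2}) (a b : 'I_d).

Definition bitflip u a := upd u a (rev_ord (u a)).

Lemma rev_ord2_neq (t : 'I_2) : rev_ord t != t.
Proof. by case: t => -[|[|]]. Qed.

Lemma ord2_rev (t s : 'I_2) : t != s -> t = rev_ord s.
Proof. by case: t => -[|[|//]] ?; case: s => -[|[|//]] ? ne; apply/val_inj => //; case/eqP: ne; apply/val_inj. Qed.

Lemma bitflipK u a : bitflip (bitflip u a) a = u.
Proof. by rewrite /bitflip upd_same upd_upd rev_ordK upd_id. Qed.

Lemma bitflip_other u a b : a != b -> bitflip u a b = u b.
Proof. by move=> ab; rewrite ffunE eq_sym (negPf ab). Qed.

Lemma bitflipC u a b : bitflip (bitflip u a) b = bitflip (bitflip u b) a.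
Proof.
case: (eqVneq a b) => [->//|ab].
have h x y t : x != y -> upd u x t y = u y by move=> xy; rewrite ffunE eq_sym (negPf xy).
by rewrite /bitflip h // (h b a) 1?eq_sym // upd_updC.
Qed.

Lemma bitflip_adj u a : hamming_adj u (bitflip u a).
Proof. by rewrite upd_adj rev_ord2_neq. Qed.

Lemma adj_bitflip u v : hamming_adj u v -> exists a, v = bitflip u a.
Proof. by case/hamE => a [t [/ord2_rev -> ->]]; exists a. Qed.

Lemma bitflip_inj u a b : bitflip u a = bitflip u b -> a = b.
Proof.
by move/eqP; rewrite /bitflip upd_inj ?rev_ord2_neq // => /andP[/eqP].
Qed.

(** The first cohomology mod 2 of the cube with its squares filled in vanishes. Directions are added
    one at a time: the error [g] of the potential in the new direction is constant along the new and
    all earlier directions, so it can be corrected on one half of the cube. *)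
Lemma coboundary (S : {ffun 'I_d -> 'I_2} -> 'I_d -> bool) :
  (forall u a, S (bitflip u a) a = S u a) ->
  (forall u a b, a != b ->
     S u a (+) S (bitflip u a) b (+) S (bitflip u b) a (+) S u b = false) ->
  exists o, forall u a, o u (+) o (bitflip u a) = S u a.
Proof.
move=> Ssym Scyc.
suff /(_ d (leqnn d))[o oP] : forall k, k <= d ->
    exists o, forall u a, a < k -> o u (+) o (bitflip u a) = S u a.
  by exists o => u a; apply: oP.
elim=> [|k IHk] kd; first by exists (fun=> false).
have [o oP] := IHk (ltnW kd); pose a := Ordinal kd.
pose g u := S u a (+) o u (+) o (bitflip u a).
have ga u : g (bitflip u a) = g u.
  by rewrite /g Ssym bitflipK -!addbA [o u (+) _]addbC.
have gb u b : b < k -> g (bitflip u b) = g u.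
  move=> bk; have ab : a != b by rewrite -val_eqE /= neq_ltn bk orbT.
  rewrite /g bitflipC; have := oP u b bk; have := oP (bitflip u a) b bk.
  have := Scyc u a b ab.
  case: (S u a) (S u b) (S (bitflip u a) b) (S (bitflip u b) a) (o u)
    (o (bitflip u b)) (o (bitflip u a)) (o (bitflip (bitflip u a) b)) =>
    [] [] [] [] [] [] [] [] //.
pose o' u := o u (+) ((u a == ord0) && g u).
exists o'; move=> u b; rewrite /o' ltnS leq_eqVlt => /orP[/eqP bk|bk].
  have -> : b = a by apply/val_inj.
  rewrite ga; have : (bitflip u a a == ord0) = ~~ (u a == ord0).
    by rewrite /bitflip upd_same; case: (u a) => -[|[|]].
  move->; rewrite /g; case: (u a == ord0) (S u a) (o u) (o (bitflip u a)) => [] [] [] [] //.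
have ab : b != a by rewrite -val_eqE /= neq_ltn bk.
rewrite gb // bitflip_other // -(oP u b bk).
by case: (_ && _); rewrite ?addbT ?addbF // addNb addbN negbK.
Qed.

End Coboundary.

Section Involution.
Variables (p : nat) (rho : 'I_p.+3 -> 'I_p.+3) (c : 'I_p.+3).
Local Open Scope ring_scope.
Hypotheses (rhoN : forall i, rho (- i) = - rho i) (rhoK : involutive rho).
Hypotheses (c2 : c + c = 0) (rhoc : rho c = c) (c0 : c != 0) (c1 : c != 1).
Hypothesis plain : forall j, j != 0 -> j != c -> forall i,
  rho (rho (rho (rho i - rho j) + j) - rho j) = i - j.

(** The plain equations at i = c say that h(j) = rho(c + j) - rho(j) satisfies h(rho j) = rho(h j)
    away from 0 and c. In the twisted equation at 1, as h(c - 1) = h(1), everything cancels except 1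
    + 1 = 0, which is false modulo 3 or more. *)
Lemma twisted_absurd :
  ~ (forall i, rho (rho (rho (rho i - c) + c) - c) = c - i).
Proof.
move=> tw; pose h j := rho (c + j) - rho j.
have cN : - c = c by apply/eqP; rewrite eq_sym -addr_eq0 c2.
have hP j : j != 0 -> j != c -> h (rho j) = rho (h j).
  move=> j0 jc; apply: (inv_inj rhoK); rewrite rhoK.
  have := congr1 rho (plain j0 jc c); rewrite rhoK rhoc => /(canRL (subrK _)).
  have -> : rho (c - rho j) = - rho (c + rho j) by rewrite -[RHS]rhoN opprD cN.
  have -> : rho (c - j) = - rho (c + j) by rewrite -[RHS]rhoN opprD cN.
  move=> E; rewrite /h rhoK; apply: oppr_inj; rewrite -[LHS]rhoN opprB addrC E; ring.
have one0 : (1 : 'I_p.+3) != 0 by [].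
have e0 : c - 1 != 0 by rewrite subr_eq0.
have ec : c - 1 != c by rewrite -subr_eq0 addrAC subrr add0r oppr_eq0.
have hE : h (c - 1) = h 1.
  have -> : c - 1 = - (1 + c) by rewrite opprD cN addrC.
  have -> : h 1 = rho (c + 1) - rho 1 by [].
  rewrite /h opprD cN addrCA c2 addr0 rhoN.
  have -> : - 1 + c = - (c + 1) by rewrite opprD cN addrC.
  by rewrite rhoN; ring.
have one_c : 1 != c by rewrite eq_sym.
have := tw 1; move/(congr1 rho); rewrite rhoK => /(canRL (subrK _))/(congr1 rho).
rewrite rhoK.
have -> : rho (rho 1 - c) = h (rho 1) + 1 by rewrite /h rhoK cN addrC subrK.
have -> : rho (rho (c - 1) + c) = h (rho (c - 1)) + (c - 1).
  by rewrite /h rhoK addrC subrK.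
rewrite !hP // hE => /(congr1 (fun z => z - rho (h 1) - (c - 1))).
have -> : rho (h 1) + 1 + c - rho (h 1) - (c - 1) = 1 + 1 by ring.
have -> : rho (h 1) + (c - 1) - rho (h 1) - (c - 1) = 0 by ring.
by move/(congr1 val); rewrite /= !modn_small.
Qed.

End Involution.

Section CubeMap.
Variables (d p : nat) (M : smap) (vt : M -> hamming d 2).
Hypotheses (dp : d * 2.-1 = p.+2) (lab : labelled vt).
Variable rho : 'I_p.+2 -> 'I_p.+2.
Hypothesis ruleP : rule vt rho.
Local Open Scope ring_scope.
Implicit Types (x y z : M) (i j k : 'I_p.+2).
Local Notation nb := (nbr (p := p) vt).

Let nbI x : injective (nb x). Proof. exact: (nbr_inj dp lab). Qed.
Let rhoI (x0 : M) : injective rho. Proof. exact: (rho_inj dp lab x0 ruleP). Qed.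

Lemma cube_nadj x i j : i != j -> ~~ hamming_adj (nb x i) (nb x j).
Proof.
move=> ij; have [a aE] := adj_bitflip (nbr_adj lab x i).
have [b bE] := adj_bitflip (nbr_adj lab x j).
rewrite aE bE upd_adj2 ?rev_ord2_neq // negb_and; case: eqVneq => //= ab.
by move: ij; rewrite -(inj_eq (@nbI x)) aE bE ab eqxx.
Qed.

(** Directions, unlike neighbours, are carried along an edge even for number 0; so the equation of a
    square will hold for every [i]. *)
Let dir x i := [set c | vt x c != nb x i c].

Let dir_turn x i j : dir (turn x j) i = dir x (j + i).
Proof. by apply/setP => c; rewrite !inE (vt_turn lab) (nbr_turn dp lab). Qed.

Let dir_r2 x i : dir (r2 M x) i = dir x (- i).
Proof. by apply/setP => c; rewrite !inE (vt_r2 lab) (nbr_r2 dp lab). Qed.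

Let dir_flip x i : dir (flip M x) (rho i) = dir x i.
Proof.
case: (eqVneq i 0) => [->|i0]; rewrite /dir (vt_flip p lab).
  by rewrite (rho0 ruleP) (nbr_flip p lab); apply/setP => c; rewrite !inE eq_sym.
rewrite ruleP.2 // diff_compl ?(nbr_adj lab) ?(inj_eq (@nbI x)) //.
by apply: cube_nadj; rewrite eq_sym.
Qed.

Let dir_inj x : injective (dir x).
Proof.
move=> i j; have [a aE] := adj_bitflip (nbr_adj lab x i).
have [b bE] := adj_bitflip (nbr_adj lab x j).
have dE k a' : nb x k = bitflip (vt x) a' -> dir x k = [set a'].
  move=> kE; apply/setP => c; rewrite !inE kE ffunE; case: (eqVneq c a') => [->|_].
    by rewrite eq_sym rev_ord2_neq.
  by rewrite eqxx.
rewrite (dE _ _ aE) (dE _ _ bE) => /set1_inj ab.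
by apply: (@nbI x); rewrite aE bE ab.
Qed.

Lemma square_rho x j (e : bool) :
  square_walk rho j x = (if e then r2 M (turn x j) else turn x j) ->
  forall i, rho (rho (rho (rho i - rho j) + j) - rho j) = sg e (i - j).
Proof.
move=> wE i; have rN := rhoN dp lab x ruleP.
have step z k l : dir (turn (flip M z) l) (rho k - l) = dir z k.
  by rewrite dir_turn addrC subrK dir_flip.
have : dir (square_walk rho j x) (rho (rho (rho (rho i - rho j) + j) - rho j)) = dir x i.
  rewrite dir_flip step -[X in rho _ + X]opprK step step //.
set w := rho _; rewrite wE; case: (e) => /=; rewrite ?dir_r2 dir_turn => /dir_inj <-.
  by rewrite addrAC subrr add0r opprK.
by rewrite addrAC subrr add0r.
Qed.

(** A rotation is chosen at each vertex, and [S] records the edges along which the choices disagree.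
    Orientation-preserving squares make [S] sum to zero around every square, so [S] is the
    coboundary of some [o], and changing the choices by [o] orients the map. *)
Lemma cube_orientable :
  (forall j, j != 0 -> forall x, square_walk rho j x = turn x j) -> orientable M.
Proof.
move=> sq; case: (pickP (@predT M)) => [x0 _|M0]; last by exists xpredT => x; have := M0 x.
have rI := rhoI x0.
have /fin_all_exists[f fE] v : exists x, vt x = v := vt_onto dp lab v.
pose sgn y := y \in porbit (spin M) (f (vt y)).
have sgn_spin y : sgn (spin M y) = sgn y.
  rewrite /sgn spinE (vt_r1 lab) (vt_r2 lab) -spinE.
  by have := porbit_perm (spin M) 1 y; rewrite expg1 -!eq_porbit_mem => ->.
have sgn_turn y i : sgn (turn y i) = sgn y.
  rewrite /turn; elim: (i : nat) => [|k IHk]; first by rewrite expg0 perm1.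
  by rewrite expgSr permM sgn_spin.
have sgn_r2 y : sgn (r2 M y) = ~~ sgn y.
  have [k kE] := vertex_flags lab (fE (vt y)).
  rewrite /sgn (vt_r2 lab); set z := f (vt y) in kE *.
  have no l : r2 M ((spin M ^+ l)%g z) \in porbit (spin M) z = false.
    apply/negP => E; have : r2 M ((spin M ^+ l)%g z) \in porbit (spin M) ((spin M ^+ l)%g z).
      by move: E; rewrite -!eq_porbit_mem => /eqP->; rewrite porbit_perm.
    by case/porbitP => l' /esym/eqP; rewrite (negPf (spin_neq_r2 _ _)).
  by case: kE => ->; rewrite ?r2K no ?mem_porbit.
pose s y := sgn y (+) sgn (flip M y).
have s_flip y : s (flip M y) = s y by rewrite /s flipK addbC.
have s_r2 y : s (r2 M y) = s y by rewrite /s flip_r2 !sgn_r2 addbN addNb negbK.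
have /fin_all_exists[F FE] (ua : {ffun 'I_d -> 'I_2} * 'I_d) :
    exists y, vt y = ua.1 /\ vt (r0 M y) = bitflip ua.1 ua.2.
  exact: (vt_surj lab (bitflip_adj ua.1 ua.2)).
pose S u a := s (F (u, a)).
have SE y u a : vt y = u -> nb y 0 = bitflip u a -> s y = S u a.
  move=> yu ya; have [/= vF nF] := FE (u, a).
  have {}vF : vt (F (u, a)) = vt y by rewrite vF yu.
  have nn : nb (F (u, a)) 0 = nb y 0 by rewrite ya /nbr (turn0 p).
  by case: (eq_dart lab vF nn) => ->; rewrite ?s_r2.
have dartP u a : exists y, vt y = u /\ nb y 0 = bitflip u a.
  by exists (F (u, a)); have [vF nF] := FE (u, a); rewrite /nbr (turn0 p).
have Ssym u a : S (bitflip u a) a = S u a.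
  have [y [yu ya]] := dartP u a; rewrite -(SE _ _ _ yu ya) -s_flip.
  have vf : vt (flip M y) = bitflip u a by rewrite (vt_flip p lab).
  by rewrite (SE _ _ a vf) // (nbr_flip p lab) bitflipK.
have Scyc u a b : a != b ->
  S u a (+) S (bitflip u a) b (+) S (bitflip u b) a (+) S u b = false.
  move=> ab.
  have [y [yu ya]] := dartP u a.
  have /(nbrP dp lab)[j jE] : hamming_adj (vt y) (bitflip u b) by rewrite yu bitflip_adj.
  have j0 : j != 0.
    by apply: contraNneq ab => j0; rewrite (bitflip_inj (u := u) (a := a) (b := b)) // -ya jE j0.
  have := sq j j0 y; rewrite /square_walk.
  set q1 := turn (flip M y) _; set q2 := turn (flip M q1) _; set q3 := turn (flip M q2) _ => w.
  have v1 : vt q1 = bitflip u a by rewrite (vt_turn lab) (vt_flip p lab).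
  have n1 : nb q1 0 = bitflip (bitflip u a) b.
    rewrite (nbr_turn dp lab) addr0 ruleP.2 // ya -jE yu compl_upd ?rev_ord2_neq //.
    by rewrite (negPf ab) -(bitflip_other u ab).
  have v2 : vt q2 = bitflip (bitflip u a) b by rewrite (vt_turn lab) (vt_flip p lab).
  have v3 : vt q3 = bitflip u b.
    by rewrite -(nbr_flip p lab) w (nbr_turn dp lab) addr0 -jE.
  have n2 : nb q2 0 = bitflip u b by rewrite -(vt_flip p lab) -v3 (vt_turn lab).
  have n3 : nb q3 0 = u by rewrite -(vt_flip p lab) w (vt_turn lab).
  have e0 : s y = S u a by apply: SE.
  have e1 : s q1 = S (bitflip u a) b by apply: SE.
  have e2 : s q2 = S (bitflip u b) a.
    rewrite -Ssym -bitflipC; apply: SE => //.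
    by rewrite n2 bitflipC bitflipK.
  have e3 : s q3 = S u b by rewrite -Ssym; apply: SE; rewrite // n3 bitflipK.
  (* The walk ends at a turn of [y], so the values of [sgn] cancel in pairs. *)
  rewrite -e0 -e1 -e2 -e3 /s w !sgn_turn.
  by case: (sgn y) (sgn (flip M y)) (sgn (flip M q1)) (sgn (flip M q2)) => [] [] [] [].
have [o oE] := coboundary Ssym Scyc.
pose c y := sgn y (+) o (vt y).
have c_r2 y : c (r2 M y) = ~~ c y by rewrite /c sgn_r2 (vt_r2 lab) addNb.
have c_spin y : c (spin M y) = c y.
  by rewrite /c sgn_spin spinE (vt_r1 lab) (vt_r2 lab).
have c_flip y : c (flip M y) = c y.
  have [a ya] := adj_bitflip (nbr_adj lab y (0 : 'I_p.+2)).
  rewrite /c (vt_flip p lab) ya; have := SE _ _ _ erefl ya; rewrite -oE /s.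
  by case: (sgn y) (sgn (flip M y)) (o (vt y)) (o (bitflip (vt y) a)) => [] [] [] [].
by exists c => y; rewrite r0E r1E c_flip c_spin c_r2.
Qed.

End CubeMap.

(** The graph is a single edge, so [r1] equals [r2] and the four flags around that edge are all
    there are. *)
Lemma dihedron_orientable (M : smap) (vt : M -> hamming 1 2) :
  labelled vt -> orientable M.
Proof.
move=> lab; have two (u v w : hamming 1 2) : u != w -> v != w -> u = v.
  have ne (x y : hamming 1 2) : x != y -> x ord0 = rev_ord (y ord0).
    move=> xy; apply: ord2_rev; apply: contra xy => /eqP xy.
    by apply/eqP/ffunP => a; rewrite ord1.
  by move=> /ne uw /ne vw; apply/ffunP => a; rewrite ord1 uw vw.
have far x y : vt y != vt x -> vt y = vt (r0 M x).
  by move=> yx; apply: (two _ _ (vt x)) => //; rewrite eq_sym; apply: (vt_neq lab).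
have r12 x : r1 M x = r2 M x.
  have v1 : vt x = vt (r1 M x) by rewrite (vt_r1 lab).
  have [|/eqP|//] := vt_dart lab v1; last by rewrite (negPf (r1_free x)).
  by apply/esym/far; rewrite eq_sym -{1}(vt_r1 lab x); apply: (vt_neq lab).
case: (pickP (@predT M)) => [x0 _|M0]; last by exists xpredT => x; have := M0 x.
pose c y := (y == x0) || (y == r0 M (r2 M x0)).
have all4 y : y \in [:: x0; r0 M x0; r2 M x0; r2 M (r0 M x0)].
  apply: (@flag_ind M (fun y => y \in [:: x0; r0 M x0; r2 M x0; r2 M (r0 M x0)]) _ x0);
    last by rewrite !inE eqxx.
  by move=> z; rewrite r12 !inE => /or4P[] /eqP->; rewrite ?r02C ?r0K ?r2K !eqxx ?orbT.
have n0 := r0_free x0; have n2 := r2_free x0; have n02 := r02_free x0.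
have m0 : r0 M x0 != r0 M (r2 M x0) by rewrite (inj_eq perm_inj) eq_sym.
have m2 : r2 M x0 != r0 M (r2 M x0) by rewrite eq_sym r0_free.
have [cx c0 c2 c02] : [/\ c x0, c (r0 M x0) = false, c (r2 M x0) = false &
    c (r0 M (r2 M x0))].
  by rewrite /c !eqxx orbT (negPf n0) (negPf n2) (negPf m0) (negPf m2).
exists c => y; rewrite r12; have := all4 y; rewrite !inE => /or4P[] /eqP->;
  by rewrite ?r02C ?r0K ?r2K -?r02C ?cx ?c0 ?c2 ?c02.
Qed.

Lemma cube_nonorientable d (hd : 0 < d) (M : embedding (hamming d 2)) :
  nonor_reg_embedding M -> d = 2.
Proof.
case=> nor reg; have [vt lab] := embedding_labelled M.
case: d hd M nor reg vt lab => [//|[|[//|d]]] _ M nor reg vt lab.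
  exfalso; apply: nor; exact: dihedron_orientable lab.
exfalso; apply: nor; have dp : d.+3 * 2.-1 = d.+3 by rewrite muln1.
case: (pickP (@predT M)) => [x0 _|M0]; last by exists xpredT => x; have := M0 x.
have [rho ruleP] := rule_exists dp lab reg x0.
have rN := rhoN dp lab x0 ruleP; have rK := rhoK dp lab x0 ruleP.
have r0 i := rho_eq0 dp lab x0 ruleP i.
(* The degree equals the dimension, so every nonzero angle belongs to a square. *)
have ndvd (j : 'I_d.+3) : j != 0%R -> ~~ (d.+3 %| j).
  move=> j0; apply: contra j0 => dj; apply/eqP/val_inj.
  by have := modn_small (ltn_ord j); rewrite (eqP dj).
have signs j j0 := square_signs dp lab reg x0 ruleP j0 (ndvd j j0).
case: (boolP [forall j, (j != 0%R) ==> (square_walk rho j x0 == turn x0 j)]) => [/forallP flat|].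
  apply: (cube_orientable dp lab ruleP) => j j0 x.
  have [e [wE _]] := signs j j0; have := flat j; rewrite j0 wE /=.
  by move: wE; case: e => [_|-> //]; rewrite (negPf (r2_free _)).
rewrite negb_forall => /existsP[c]; rewrite negb_imply => /andP[c0 cE].
have [e [wE ce]] := signs c c0.
have et : e = true by move: cE; rewrite wE; case: (e); rewrite ?eqxx.
subst e; have cc : c = (- c)%R := ce isT.
(* A cyclic group has at most one element of order two. Hence [rho], being odd, fixes [c], and no
   other angle is twisted. *)
have two (a b : 'I_d.+3) : a != 0%R -> b != 0%R -> a = (- a)%R -> b = (- b)%R -> a = b.
  rewrite -!val_eqE /= => a0 b0 /(congr1 val) /= ha /(congr1 val) /= hb; apply/ord_inj.
  move: ha hb; rewrite !modn_small; have := ltn_ord a; have := ltn_ord b; lia.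
have rc : rho c = c by apply: two; rewrite ?r0 // -rN -cc.
exfalso; apply: (@twisted_absurd d rho c rN rK _ rc).
- by rewrite {2}cc subrr.
- by apply/eqP => c1; move/(congr1 val): cc; rewrite c1 /= !modn_small.
- move=> j j0 jc i; have [e [wE' je]] := signs j j0.
  have ef : e = false by apply: contraNF jc => /je jj; apply/eqP/two.
  by rewrite (square_rho dp lab ruleP (wE' x0)) ef.
by move=> i; have := square_rho dp lab ruleP (e := true) (wE x0) i; rewrite rc /= opprB.
Qed.

(** * Maps from rotation systems *)

Section RotationSystem.
Variables d n p : nat.
Local Notation V := {ffun 'I_d -> 'I_n}.
Local Open Scope ring_scope.

(* Around vertex x the neighbours are nb x 0, nb x 1, ...; the edge to nb x i
   has number bk x i at its other end, and tw x i tells whether the rotations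
   at the two ends disagree along this edge. *)
Variables (nb : V -> 'I_p.+2 -> V) (bk : V -> 'I_p.+2 -> 'I_p.+2)
  (tw : V -> 'I_p.+2 -> bool).
Hypotheses (dnp : (d * n.-1 = p.+2)%N)
  (nb_adj : forall x i, hamming_adj x (nb x i)) (nb_inj : forall x, injective (nb x))
  (nb_bk : forall x i, nb (nb x i) (bk x i) = x)
  (tw_bk : forall x i, tw (nb x i) (bk x i) = tw x i).
Local Notation F := (V * 'I_p.+2 * bool)%type.
Implicit Types (x : V) (i j k : 'I_p.+2) (z : F).

Lemma bk_bk x i : bk (nb x i) (bk x i) = i.
Proof. by apply: (@nb_inj x); rewrite -{1}(nb_bk x i) nb_bk. Qed.

(** The boolean of a flag is its local orientation relative to the rotation at its vertex.
    Reflections reverse it, but across a twisted edge it is measured against the opposite rotation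
    and so stays unchanged. *)
Definition rs0 z : F :=
  (nb z.1.1 z.1.2, bk z.1.1 z.1.2, z.2 (+) ~~ tw z.1.1 z.1.2).
Definition rs1 z : F := (z.1.1, z.1.2 + sg (~~ z.2) 1, ~~ z.2).
Definition rs2 z : F := (z.1, ~~ z.2).

Lemma rs0K : involutive rs0.
Proof.
case=> [[x i] s]; rewrite /rs0 /= nb_bk bk_bk tw_bk.
by case: s (tw x i) => [] [].
Qed.

Lemma rs1K : involutive rs1.
Proof.
by case=> [[x i] s]; rewrite /rs1 /=; case: s; rewrite /= ?subrK ?addrK.
Qed.

Lemma rs2K : involutive rs2.
Proof. by case=> [xi s]; rewrite /rs2 /= negbK. Qed.

Let p0 := perm (inv_inj rs0K).
Let p1 := perm (inv_inj rs1K).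
Let p2 := perm (inv_inj rs2K).

Let p0K : involutive p0. Proof. by move=> z; rewrite !permE rs0K. Qed.
Let p1K : involutive p1. Proof. by move=> z; rewrite !permE rs1K. Qed.
Let p2K : involutive p2. Proof. by move=> z; rewrite !permE rs2K. Qed.

Let nb_neq x i : nb x i != x.
Proof. by rewrite eq_sym ham_neq. Qed.

Let p0_free z : p0 z != z.
Proof. by rewrite permE; case: z => [[x i] s]; rewrite !xpair_eqE (negPf (nb_neq _ _)). Qed.
Let p1_free z : p1 z != z.
Proof. by rewrite permE; case: z => [[x i] []]; rewrite !xpair_eqE andbF. Qed.
Let p2_free z : p2 z != z.
Proof. by rewrite permE; case: z => [[x i] []]; rewrite !xpair_eqE andbF. Qed.
Let p02C z : p0 (p2 z) = p2 (p0 z).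
Proof. by rewrite !permE; case: z => [[x i] s]; rewrite /rs0 /rs2 /= addNb. Qed.
Let p02_free z : p0 (p2 z) != z.
Proof. by rewrite !permE; case: z => [[x i] s]; rewrite !xpair_eqE (negPf (nb_neq _ _)). Qed.

Lemma nb_onto x y : hamming_adj x y -> exists i, y = nb x i.
Proof.
move=> xy; have : y \in [set nb x i | i : 'I_p.+2].
  suff -> : [set nb x i | i : 'I_p.+2] = [set y | hamming_adj x y] by rewrite inE.
  apply/eqP; rewrite eqEcard card_nbrs dnp card_imset ?card_ord ?leqnn ?andbT //.
  by apply/subsetP => _ /imsetP[i _ ->]; rewrite inE.
by case/imsetP => i _ ->; exists i.
Qed.

Let fibre (S : F -> Prop) x i j s t :
  (forall z, S z -> S (p1 z) /\ S (p2 z)) -> S (x, i, s) -> S (x, j, t).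
Proof.
move=> cl; have flipS k u : S (x, k, u) -> S (x, k, ~~ u).
  by case/cl => _; rewrite permE.
have anyS k u v : S (x, k, u) -> S (x, k, v).
  by case: (eqVneq u v) => [-> //|]; case: u v => [] [] //= _; apply: flipS.
have nextS k u : S (x, k, u) -> S (x, k + 1, u).
  move=> /(anyS _ _ true)/cl[+ _]; rewrite permE; exact: (anyS _ false).
move=> iS; apply: (anyS _ s).
have : forall k : nat, S (x, i + k%:R, s).
  elim=> [|k IHk]; first by rewrite addr0.
  by rewrite -natr1 addrA; apply: nextS.
by move=> /(_ (nat_of_ord (j - i))); rewrite natr_Zp addrC subrK.
Qed.

Let p_trans : [transitive <<[set p0; p1; p2]>>%g, on [set: F] | 'P].
Proof.
have /card_gt0P[z0 _] : (0 < #|{: F}|)%N.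
  rewrite !card_prod card_ffun !card_ord card_bool !muln_gt0 expn_gt0 andbT.
  by case: n dnp => [|k]; rewrite ?muln0.
apply/imsetP; exists z0; rewrite ?inE //; apply/esym/setP => z; rewrite inE.
pose S z := z \in orbit 'P <<[set p0; p1; p2]>>%g z0.
have clS a y : a \in [set p0; p1; p2] -> S y -> S (a y).
  by move=> aA yS; apply: orbit_gen_step.
have S12 y : S y -> S (p1 y) /\ S (p2 y).
  by move=> yS; split; apply: clS; rewrite // !inE eqxx ?orbT.
pose T x := forall i s, S (x, i, s).
case: z z0 @S clS S12 @T => [[x i] s] [[x0 i0] s0] S clS S12 T.
have T0 : T x0 by move=> j t; apply: (fibre _ _ S12) (orbit_refl _ _ _).
suff : T x by apply.
apply: (@hamming_ind d n T _ x0) => // u v /nb_onto[j ->] Tu k t.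
have : S (p0 (u, j, true)) by apply: clS (Tu _ _); rewrite !inE eqxx.
by rewrite permE; apply: (fibre _ _ S12).
Qed.

Definition rotation_map : smap :=
  SMap p0K p1K p2K p0_free p1_free p2_free p02C p02_free p_trans.

Local Notation M := rotation_map.
Let vt (z : M) : hamming d n := z.1.1.

Lemma rotation_r0 (z : M) : r0 M z = rs0 z. Proof. exact: permE. Qed.
Lemma rotation_r1 (z : M) : r1 M z = rs1 z. Proof. exact: permE. Qed.
Lemma rotation_r2 (z : M) : r2 M z = rs2 z. Proof. exact: permE. Qed.

Lemma rotation_labelled : labelled vt.
Proof.
split.
- by move=> z; rewrite rotation_r1.
- by move=> z; rewrite rotation_r2.
- by move=> z; rewrite rotation_r0; apply: nb_adj.
- case=> [[x i] s] [[y j] t]; rewrite /vt /= => xy; subst y.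
  pose S z := z \in orbit 'P <<[set p1; p2]>>%g ((x, i, s) : F).
  apply: (@fibre S x i j s t); last exact: orbit_refl.
  by move=> z zS; split; apply: orbit_gen_step; rewrite // !inE eqxx ?orbT.
- case=> [[x i] s] [[y j] t]; rewrite !rotation_r0 /vt /= => xy; subst y.
  move/nb_inj => ->; rewrite rotation_r2 /rs2 /=.
  by case: s t => [] []; [left | right | right | left].
move=> u v /nb_onto[i ->]; exists ((u, i, true) : F).
by rewrite rotation_r0.
Qed.

Lemma rotation_turn x i s k : turn ((x, i, s) : M) k = (x, i + sg s k, s).
Proof.
have h (l : nat) : (spin M ^+ l)%g (x, i, s) = (x, i + sg s l%:R, s).
  elim: l => [|l IHl]; first by rewrite expg0 perm1; case: s; rewrite /= ?subr0 ?addr0.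
  rewrite expgSr permM IHl spinE rotation_r1 rotation_r2 /rs1 /rs2 /= negbK.
  by rewrite -addrA; case: s {IHl} => /=; rewrite -natr1 ?opprD.
by rewrite /turn h natr_Zp.
Qed.

Lemma rotation_flip x i s :
  flip M ((x, i, s) : M) = (nb x i, bk x i, s (+) tw x i).
Proof.
by rewrite flipE rotation_r0 rotation_r2 /rs0 /rs2 /= addNb addbN negbK.
Qed.

Lemma rotation_nbr x i s k : nbr vt ((x, i, s) : M) k = nb x (i + sg s k).
Proof. by rewrite /nbr rotation_turn rotation_r0. Qed.

Lemma rotation_rule (rho : 'I_p.+2 -> 'I_p.+2) :
  rho 0 = 0 -> (forall i, rho (- i) = - rho i) ->
  (forall x i k, k != 0 -> nb (nb x i) (bk x i + sg (tw x i) (rho k)) =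
     compl x (nb x i) (nb x (i + k))) -> rule vt rho.
Proof.
move=> rho0 rhoN ru; split=> // -[[x i] s] k k0.
rewrite rotation_flip !rotation_nbr.
have -> : sg s (0 : 'I_p.+2) = 0 by case: s; rewrite /= ?oppr0.
have s0 : sg s k != 0 by case: s; rewrite /= ?oppr_eq0.
rewrite addr0 -ru //; congr (nb _ (_ + _)).
by case: s {s0}; case: (tw x i); rewrite /= ?rhoN ?opprK.
Qed.

Lemma rotation_uniform :
  (forall x i j, i != j -> hamming_adj (nb x i) (nb x j) = (d %| (i - j)%R)%N) ->
  forall (z : M) i j, i != j ->
    hamming_adj (nbr vt z i) (nbr vt z j) = (d %| (i - j)%R)%N.
Proof.
move=> un [[x i] s] j k jk; rewrite !rotation_nbr un; last first.
  by rewrite (inj_eq (addrI _)); case: s => //=; rewrite (inj_eq oppr_inj).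
have -> : i + sg s j - (i + sg s k) = sg s (j - k) by case: s; rewrite /sg; ring.
by case: s => //; apply: (dvd_val_opp dnp).
Qed.

End RotationSystem.

(** * Models for n = 3 and n = 4 *)

Lemma orientation_moves (M : smap) (c : M -> bool) p :
  (forall x, [/\ c (r0 M x) = ~~ c x, c (r1 M x) = ~~ c x & c (r2 M x) = ~~ c x]) ->
  [/\ forall x, c (r2 M x) = ~~ c x, forall x, c (flip M x) = c x &
      forall x (i : 'I_p.+2), c (turn x i) = c x].
Proof.
move=> cP; have c0 x : c (r0 M x) = ~~ c x by case: (cP x).
have c1 x : c (r1 M x) = ~~ c x by case: (cP x).
have c2 x : c (r2 M x) = ~~ c x by case: (cP x).
split=> // [x|x i]; first by rewrite flipE c0 c2 negbK.
rewrite /turn; elim: (nat_of_ord i) => [|k IHk]; first by rewrite expg0 perm1.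
by rewrite expgSr permM spinE c1 c2 negbK.
Qed.

Section LineModel.
Variables d n p : nat.
Local Notation m := n.-1.
Hypothesis dnp : d * m = p.+2.
(* g 0 v, g 1 v, ... are the other points of a line, in the cyclic order in
   which the rotation about v visits them. *)
Variable g : nat -> 'I_n -> 'I_n.
Hypotheses (m6 : m %| 6) (m1 : 1 < m).
Hypothesis g_neq : forall b v, b < m -> g b v != v.
Hypothesis g_inj : forall b b' v, b < m -> b' < m -> g b v = g b' v -> b = b'.
Hypothesis g_back : forall b v, b < m -> g ((b + 3) %% m) (g b v) = v.
Hypothesis g_line : forall b t v, b < m -> 0 < t < m ->
  g ((b + 3 + (m - t)) %% m) (g b v) = g ((b + t) %% m) v.
Variable e : bool.
Local Open Scope ring_scope.
Local Notation V := {ffun 'I_d -> 'I_n}.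
Implicit Types (x : V) (i j k : 'I_p.+2).

Let d_gt0 : (0 < d)%N. Proof. by case: d dnp. Qed.
(** The rotation runs cyclically through the d directions and advances by one point on each line per
    round. *)
Let dir i : 'I_d := Ordinal (ltn_pmod i d_gt0).
Let lvl i : nat := (i %/ d)%N.
(** The shift between the numbers of an edge at its two ends; c + c = 0 because m divides 6. *)
Let c : 'I_p.+2 := (3 * d)%:R.

Let lvl_lt i : (lvl i < m)%N.
Proof. by rewrite ltn_divLR // mulnC dnp. Qed.

Let valD i (k : nat) : (i + (k * d)%:R)%R = ((i + k %% m * d) %% (m * d))%N :> nat.
Proof. by rewrite -(val_mul_natr dnp) [(m * d)%N]mulnC dnp. Qed.

Let dirD i (k : nat) : dir (i + (k * d)%:R) = dir i.
Proof.
apply/ord_inj; change (((i + (k * d)%:R)%R %% d)%N = (i %% d)%N).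
by rewrite valD modn_dvdm ?dvdn_mull // addnC modnMDl.
Qed.

Let lvlD i (k : nat) : lvl (i + (k * d)%:R) = ((lvl i + k) %% m)%N.
Proof.
by rewrite /lvl valD -modn_divl addnC divnMDl // addnC modnDmr.
Qed.

Lemma line_index i j : dir i = dir j -> lvl i = lvl j -> i = j.
Proof.
move=> /(congr1 val) /= dij lij; apply/ord_inj.
by rewrite (divn_eq i d) (divn_eq j d) dij -/(lvl i) lij.
Qed.

Lemma dir_eq i j : (dir i == dir j) = (d %| (i - j)%R)%N.
Proof.
apply/eqP/idP => [ij|/(dvd_valP dnp)[k _ /eqP]]; last first.
  by rewrite subr_eq addrC => /eqP->; rewrite dirD.
have [k kE] : exists k : nat, lvl i = ((lvl j + k) %% m)%N.
  exists (lvl i + (m - lvl j))%N; rewrite addnCA subnKC; last exact: ltnW.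
  by rewrite modnDr modn_small.
have -> : i = j + (k * d)%:R by apply: line_index; rewrite ?dirD ?lvlD.
by rewrite addrAC subrr add0r (dvd_val_natr dnp).
Qed.

Definition line_nb x i := upd x (dir i) (g (lvl i) (x (dir i))).
Definition line_bk x i := i + c.
Definition line_tw x i := e.

Lemma line_nb_adj x i : hamming_adj x (line_nb x i).
Proof. by rewrite upd_adj g_neq. Qed.

Lemma line_nb_inj x : injective (line_nb x).
Proof.
move=> i j /eqP; rewrite /line_nb upd_inj ?g_neq // => /andP[/eqP ij].
rewrite ij => /eqP /g_inj E; apply: line_index => //.
exact: E.
Qed.

Lemma line_nb_bk x i : line_nb (line_nb x i) (line_bk x i) = x.
Proof.
by rewrite /line_nb /line_bk dirD lvlD upd_same upd_upd g_back // upd_id.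
Qed.

Lemma line_tw_bk x i : line_tw (line_nb x i) (line_bk x i) = line_tw x i.
Proof. by []. Qed.

Definition line_map : smap :=
  rotation_map dnp line_nb_adj line_nb_inj line_nb_bk line_tw_bk.

Definition line_vt (z : line_map) : hamming d n := z.1.1.

Lemma line_labelled : labelled line_vt.
Proof. exact: rotation_labelled. Qed.

Definition line_rho i := if (d %| i)%N then sg (~~ e) i else sg e i + c.

Let c2 : c + c = 0.
Proof.
by apply/eqP; rewrite -natrD -mulnDl (mul_natr_eq0 dnp).
Qed.

Let cN : - c = c. Proof. by apply/eqP; rewrite eq_sym -addr_eq0 c2. Qed.

Lemma line_rule : rule line_vt line_rho.
Proof.
apply: rotation_rule => [|i|x i k k0]; rewrite /line_rho.
- by rewrite dvdn0; case: (~~ e); rewrite /= ?oppr0.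
- rewrite (dvd_val_opp dnp); case: ifP => _; first by case: (e).
  by rewrite opprD cN; case: (e).
rewrite /line_tw /line_bk; have [dk|dk] := boolP (d %| k)%N.
  have -> : i + c + sg e (sg (~~ e) k) = i + c - k by case: (e); rewrite /= ?opprK.
  have [t tm kE] := dvd_valP dnp dk.
  have t0 : (0 < t)%N by apply: contraNltn k0; rewrite leqn0 kE => /eqP->; rewrite mul0n.
  have md : (m * d)%:R = 0 :> 'I_p.+2 by apply/eqP; rewrite (mul_natr_eq0 dnp) dvdnn.
  have -> : i + c - k = i + ((3 + (m - t)) * d)%:R.
    rewrite -addrA; congr (i + _); apply/eqP; rewrite subr_eq kE -natrD -mulnDl.
    by rewrite -addnA (subnK (ltnW tm)) mulnDl natrD md addr0.
  rewrite {1}/line_nb kE /line_nb !dirD !lvlD upd_same upd_upd compl_upd ?g_neq //;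
    last by rewrite ltn_pmod //; lia.
  by rewrite eqxx addnA g_line ?t0.
have -> : i + c + sg e (sg e k + c) = i + k.
  have -> : sg e (sg e k + c) = k + c.
    by case: (e) => //=; rewrite opprD opprK cN.
  by rewrite addrACA c2 addr0.
have ik : dir i != dir (i + k).
  by rewrite eq_sym dir_eq addrAC subrr add0r.
rewrite [RHS]compl_upd ?g_neq // (negPf ik) /line_nb; congr (upd _ _ (g _ _)).
by rewrite ffunE eq_sym (negPf ik).
Qed.

Lemma line_uniform (z : line_map) i j : i != j ->
  hamming_adj (nbr line_vt z i) (nbr line_vt z j) = (d %| (i - j)%R)%N.
Proof.
apply: rotation_uniform => x {}i {}j ij; rewrite upd_adj2 ?g_neq // dir_eq.
case dij: (d %| _)%N => //=; apply: contraNneq ij.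
have /eqP E : dir i == dir j by rewrite dir_eq.
by rewrite E => /g_inj E'; apply/eqP/line_index => //; apply: E'.
Qed.

Lemma line_orientable : ~~ e -> orientable line_map.
Proof.
move=> ne; exists (fun z : line_map => z.2) => z.
rewrite /line_map rotation_r0 rotation_r1 rotation_r2 /rs0 /rs1 /rs2 /line_tw /=.
by rewrite ne addbT.
Qed.

(** Each of the three flips adds [e] to the side and turns keep it, so the walk changes the side
    exactly when [e] holds. *)
Lemma line_triangle (z : line_map) :
  triangle_walk line_rho (1 * d)%:R z =
  if e then r2 line_map (turn z ((1 * d)%:R : 'I_p.+2)) else turn z ((1 * d)%:R : 'I_p.+2).
Proof.
set D : 'I_p.+2 := (1 * d)%:R.
have D0 : D != 0 by rewrite (mul_natr_eq0 dnp) dvdn1 neq_ltn m1 orbT.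
have aD : hamming_adj (nbr line_vt z (0 : 'I_p.+2)) (nbr line_vt z D).
  by rewrite line_uniform 1?eq_sym // sub0r (dvd_val_opp dnp) (dvd_val_natr dnp).
have [w [wE _ _]] := triangleP dnp line_labelled z line_rule D0 aD.
have f2 (f : line_map) : (flip line_map f).2 = f.2 (+) e.
  by case: f => [[y i] s]; rewrite rotation_flip.
have t2 (f : line_map) i : (turn f i).2 = f.2.
  by case: f => [[y j] s]; rewrite rotation_turn.
have := congr1 (fun f : line_map => f.2) wE.
rewrite [in X in X = _ -> _]/triangle_walk !(f2, t2) wE; case: w {wE}.
  by rewrite rotation_r2 /= t2; case: (z.2) (e) => [] [].
by rewrite t2; case: (z.2) (e) => [] [].
Qed.

End LineModel.

Lemma line_model d n p (e : bool) : n = 3 \/ n = 4 -> d * n.-1 = p.+2 ->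
  exists (M : smap) (vt : M -> hamming d n),
  [/\ labelled vt, rule vt (fun i : 'I_p.+2 =>
        if (d %| i)%N then sg (~~ e) i else (sg e i + (3 * d)%:R)%R),
      forall (z : M) (i j : 'I_p.+2), i != j ->
        hamming_adj (nbr vt z i) (nbr vt z j) = (d %| (i - j)%R)%N,
      ~~ e -> orientable M &
      forall z : M, let D : 'I_p.+2 := ((1 * d)%:R)%R in triangle_walk (fun i =>
          if (d %| i)%N then sg (~~ e) i else (sg e i + (3 * d)%:R)%R) D z =
        if e then r2 M (turn z D) else turn z D].
Proof.
move=> n34 dnp.
suff [g [m6 m1 gP]] : exists g : nat -> 'I_n -> 'I_n, [/\ n.-1 %| 6, 1 < n.-1 &
    [/\ forall b v, b < n.-1 -> g b v != v,
      forall b b' v, b < n.-1 -> b' < n.-1 -> g b v = g b' v -> b = b',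
      forall b v, b < n.-1 -> g ((b + 3) %% n.-1) (g b v) = v &
      forall b t v, b < n.-1 -> 0 < t < n.-1 ->
        g ((b + 3 + (n.-1 - t)) %% n.-1) (g b v) = g ((b + t) %% n.-1) v]].
  have [g1 g2 g3 g4] := gP.
  exists (line_map dnp g1 g2 g3 e), (line_vt (e := e)); split.
  - exact: line_labelled.
  - exact: line_rule.
  - exact: line_uniform.
  - exact: line_orientable.
  - exact: line_triangle.
case: n34 => nE; subst n.
  (* The line as the group Z/3: point [b] is reached by adding b + 1. *)
  exists (fun b (v : 'I_3) => inZp (v + b.+1)); split=> //; split.
  - by case=> [|[|]] // [[|[|[|]]] //].
  - by case=> [|[|]] // [|[|]] // [[|[|[|]]] //].
  - by case=> [|[|]] // [[|[|[|]]] //] ? _; apply/val_inj.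
  - by case=> [|[|]] // [|[|]] // [[|[|[|]]] //] ? _ _; apply/val_inj.
(* The line as Klein's four-group, whose nonzero elements are involutions with sum zero. *)
exists (fun b (v : 'I_4) => inZp (Nat.lxor v b.+1)); split=> //; split.
- by case=> [|[|[|]]] // [[|[|[|[|]]]] //].
- by case=> [|[|[|]]] // [|[|[|]]] // [[|[|[|[|]]]] //].
- by case=> [|[|[|]]] // [[|[|[|[|]]]] //] ? _; apply/val_inj.
- by case=> [|[|[|]]] // [|[|[|]]] // [[|[|[|[|]]]] //] ? _ _; apply/val_inj.
Qed.

(** * Models for n = 6 *)

(** An orientation would be preserved by the triangle walk, which excludes the mirror image and
    forces [rho j = - j]. *)
Lemma nonorientable_of_rule d n p (M : smap) (vt : M -> hamming d n)
    (rho : 'I_p.+2 -> 'I_p.+2) (x0 : M) (j : 'I_p.+2) :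
  d * n.-1 = p.+2 -> labelled vt -> rule vt rho ->
  j != 0%R -> hamming_adj (nbr vt x0 (0 : 'I_p.+2)%R) (nbr vt x0 j) ->
  rho j = j -> j != (- j)%R -> nonorientable M.
Proof.
move=> dnp lab ru j0 aj rj jN [o /(@orientation_moves _ _ p)[o2 oF ot]].
have [[] [wE rE _]] := triangleP dnp lab x0 ru j0 aj.
  by have := congr1 o wE; rewrite /triangle_walk !(oF, ot, o2); case: (o x0).
by move: jN; rewrite -{1}rj rE eqxx.
Qed.

(* For n = 6 the triangle equations determine rho up to sign: this is the
   solution with rho d = - d, and srho d true below is its negative. *)
Definition sextic_table d := if d == 1 then [:: 0; 4; 2; 3; 1]
  else [:: 0; 3; 8; 1; 4; 5; 6; 9; 2; 7].

Section SexticCodes.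
Variables (d : nat) (eps : bool).
Let m := d * 5.

Definition srho i := let r := nth 0 (sextic_table d) i %% m in
  if eps then (m - r) %% m else r.

Definition scompl (v w y : seq nat) := mkseq (fun c =>
  if nth 0 y c != nth 0 v c then nth 0 y c else nth 0 w c) d.

Definition sadj (u v : seq nat) :=
  count (fun c => nth 0 u c != nth 0 v c) (iota 0 d) == 1.

(* A frame lists the neighbours of a vertex in their cyclic order; it is carried
   along its edge number i by the rule for srho. *)
Definition scarry (v : seq nat) (f : seq (seq nat)) i :=
  mkseq (fun k => if k == 0 then v
    else scompl v (nth [::] f i) (nth [::] f ((i + srho k) %% m))) m.

(** A standard frame at the origin is carried to [x] along the path that adjusts the coordinates one
    after another. *)
Definition sframe (x : seq nat) := (foldl (fun vf c =>
    let v := set_nth 0 vf.1 c (nth 0 x c) in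
    if v == vf.1 then vf else (v, scarry vf.1 vf.2 (index v vf.2)))
  (nseq d 0, mkseq (fun i => set_nth 0 (nseq d 0) (i %% d) (i %/ d).+1) m)
  (iota 0 d)).2.

Definition snb x i := nth [::] (sframe x) i.
Definition sbk x i := index x (sframe (snb x i)).
(** The frame carried over the edge is compared with the one chosen at the neighbour; anything but a
    rotation of it counts as a twist. *)
Definition stw x i := ~~ all (fun k => nth [::] (scarry x (sframe x) i) k ==
  snb (snb x i) ((sbk x i + k) %% m)) (iota 0 m).

Fixpoint scodes k := if k is k'.+1 then [seq a :: c | a <- iota 0 6, c <- scodes k']
  else [:: [::]].

Definition sneg b r := if b then (m - r) %% m else r.

Definition scheck :=
  [&& all (fun x => [&& size (sframe x) == m, uniq (sframe x) &
        all (fun i => let y := snb x i in let b := sbk x i in let t := stw x i in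
          [&& y \in scodes d, sadj x y, b < m, snb y b == x, stw y b == t,
            all (fun k => (k == 0) || (snb y ((b + sneg t (srho k)) %% m) ==
               scompl x y (snb x ((i + k) %% m)))) (iota 0 m) &
            all (fun j => (i == j) || (sadj y (snb x j) ==
               (d %| (i + (m - j) %% m) %% m))) (iota 0 m)])
          (iota 0 m)]) (scodes d),
      srho 0 == 0,
      all (fun i => srho ((m - i) %% m) == (m - srho i) %% m) (iota 0 m) &
      has (fun k => [&& k != 0, d %| k, srho k == k & k != (m - k) %% m]) (iota 0 m)].

End SexticCodes.

Section SexticModel.
Variables (d p : nat) (eps : bool).
Hypotheses (dp : d * 6.-1 = p.+2) (ok : scheck d eps).
Local Notation V := {ffun 'I_d -> 'I_6}.
Implicit Types (x y : V) (i j k : 'I_p.+2).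

Definition code x : seq nat := [seq nat_of_ord (x a) | a <- enum 'I_d].
Definition decode (c : seq nat) : V := [ffun a : 'I_d => inZp (nth 0 c a)].

Lemma nth_code x (a : 'I_d) : nth 0 (code x) a = x a.
Proof. by rewrite (nth_map a) ?size_enum_ord // nth_ord_enum. Qed.

Lemma codeK : cancel code decode.
Proof. by move=> x; apply/ffunP => a; rewrite ffunE nth_code valZpK. Qed.

Lemma scodesP (k : nat) c : reflect (size c = k /\ all (fun r => r < 6) c) (c \in scodes k).
Proof.
elim: k c => [|k IHk] c.
  by rewrite inE; case: c => [|r c]; apply: (iffP eqP) => // -[].
apply: (iffP allpairsP) => [[[r c'] [/= r6 /IHk[<- c6] ->]]|[]].
  by rewrite -[[:: 0; 1; 2; 3; 4; 5]]/(iota 0 6) mem_iota in r6; rewrite /= c6 andbT.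
case: c => // r c [sc] /andP[r6 c6]; exists (r, c); split=> //=.
  by rewrite -[[:: 0; 1; 2; 3; 4; 5]]/(iota 0 6) mem_iota.
by apply/IHk; split=> //; case: sc.
Qed.

Lemma code_scodes x : code x \in scodes d.
Proof.
apply/scodesP; split; first by rewrite size_map size_enum_ord.
by apply/allP => r /mapP[a _ ->].
Qed.

Lemma decodeK c : c \in scodes d -> code (decode c) = c.
Proof.
case/scodesP => sc c6; apply: (@eq_from_nth _ 0) => [|k].
  by rewrite size_map size_enum_ord.
rewrite size_map size_enum_ord => kd; rewrite (nth_code _ (Ordinal kd)) ffunE /=.
by rewrite modn_small //; apply: (all_nthP 0 c6); rewrite sc.
Qed.

Lemma code_compl x y z : code (compl x y z) = scompl d (code x) (code y) (code z).
Proof.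
apply: (@eq_from_nth _ 0) => [|k]; first by rewrite size_map size_enum_ord size_mkseq.
rewrite size_map size_enum_ord => kd; rewrite nth_mkseq //.
rewrite !(nth_code _ (Ordinal kd)) ffunE -val_eqE /=.
by case: ifP.
Qed.

Lemma code_adj x y : sadj d (code x) (code y) = hamming_adj x y.
Proof.
rewrite /sadj /hamming_adj cardsE cardE size_filter; congr (_ == _).
rewrite -val_enum_ord count_map enumT; apply: eq_count => a.
by rewrite /= !nth_code.
Qed.

Let m : d * 5 = p.+2 := dp.

Definition xnb x i := decode (snb d eps (code x) i).
Definition xbk x i : 'I_p.+2 := inZp (sbk d eps (code x) i).
Definition xtw x i := stw d eps (code x) i.
Definition xrho i : 'I_p.+2 := inZp (srho d eps i).

Let framed x : [/\ size (sframe d eps (code x)) = p.+2 & uniq (sframe d eps (code x))].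
Proof.
have /and4P[/allP h _ _ _] := ok; have /and3P[/eqP sz un _] := h _ (code_scodes x).
by rewrite -m.
Qed.

Let checked x i : let c := code x in let y := snb d eps c i in
  let b := sbk d eps c i in let t := stw d eps c i in
  [/\ [&& y \in scodes d, sadj d c y, b < p.+2, snb d eps y b == c & stw d eps y b == t],
    forall k : nat, 0 < k < p.+2 -> snb d eps y ((b + sneg d t (srho d eps k)) %% p.+2) =
               scompl d c y (snb d eps c ((i + k) %% p.+2)) &
    forall j, i != j -> sadj d y (snb d eps c j) =
               (d %| (i + (p.+2 - j) %% p.+2) %% p.+2)].
Proof.
have /and4P[/allP h0 _ _ _] := ok; have /and3P[_ _ /allP h] := h0 _ (code_scodes x).
have /h : (i : nat) \in iota 0 (d * 5) by rewrite mem_iota m /= add0n.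
rewrite m; cbv beta zeta => /and5P[h1 h2 h3 h4 /and3P[h5 /allP h6 /allP h7]].
split=> [|k /andP[k0 km]|j ij]; first exact/and5P.
  have /h6 : k \in iota 0 p.+2 by rewrite mem_iota /= add0n.
  by rewrite eqn0Ngt k0 => /eqP.
have /h7 : (j : nat) \in iota 0 p.+2 by rewrite mem_iota /= add0n.
by rewrite val_eqE (negPf ij) => /eqP.
Qed.

Let code_nb x i : code (xnb x i) = snb d eps (code x) i.
Proof. by have [/and5P[yd _ _ _ _] _ _] := checked x i; rewrite decodeK. Qed.

Let val_bk x i : xbk x i = sbk d eps (code x) i :> nat.
Proof. by have [/and5P[_ _ b _ _] _ _] := checked x i; rewrite /= modn_small. Qed.

Let xnb_adj x i : hamming_adj x (xnb x i).
Proof. by rewrite -code_adj code_nb; have [/and5P[]] := checked x i. Qed.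

Let xnb_inj x : injective (xnb x).
Proof.
move=> i j /(congr1 code); rewrite !code_nb /snb => /eqP.
have [sz un] := framed x; rewrite nth_uniq ?sz // => /eqP; exact: ord_inj.
Qed.

Let xnb_bk x i : xnb (xnb x i) (xbk x i) = x.
Proof.
apply: (can_inj codeK); rewrite code_nb val_bk code_nb.
by have [/and5P[_ _ _ /eqP]] := checked x i.
Qed.

Let xtw_bk x i : xtw (xnb x i) (xbk x i) = xtw x i.
Proof.
rewrite /xtw val_bk code_nb.
by have [/and5P[_ _ _ _ /eqP]] := checked x i.
Qed.

Lemma srho_lt i : srho d eps i < p.+2.
Proof.
by rewrite /srho m; case: eps; rewrite ltn_pmod.
Qed.

Let xrho0 : xrho 0%R = 0%R.
Proof.
have /and4P[_ /eqP r0 _ _] := ok; by apply/val_inj; rewrite /= r0.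
Qed.

Let xrhoN i : xrho (- i)%R = (- xrho i)%R.
Proof.
have /and4P[_ _ /allP h _] := ok.
have /h : (i : nat) \in iota 0 (d * 5) by rewrite mem_iota m /= add0n.
rewrite m => /eqP E; apply/ord_inj; rewrite /= E.
by rewrite modn_mod (modn_small (srho_lt i)).
Qed.

Definition sextic_map : smap := rotation_map dp xnb_adj xnb_inj xnb_bk xtw_bk.
Definition sextic_vt (z : sextic_map) : hamming d 6 := z.1.1.

Lemma sextic_labelled : labelled sextic_vt.
Proof. exact: rotation_labelled. Qed.

Lemma sextic_rule : rule sextic_vt xrho.
Proof.
apply: rotation_rule => [||x i k k0]; [exact: xrho0 | exact: xrhoN |].
apply: (can_inj codeK); have [_ /(_ k) h _] := checked x i.
rewrite code_nb code_compl !code_nb -h; last by rewrite ltn_ord andbT lt0n.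
congr (snb _ _ _ _); rewrite -val_bk /xtw /sneg.
case: (stw _ _ _ _); rewrite /= ?m; last by rewrite modnDmr.
by rewrite !modnDmr (modn_small (srho_lt k)).
Qed.

Lemma sextic_uniform (z : sextic_map) i j : i != j ->
  hamming_adj (nbr sextic_vt z i) (nbr sextic_vt z j) = (d %| (i - j)%R)%N.
Proof.
apply: rotation_uniform => x {}i {}j ij; rewrite -code_adj !code_nb.
by have [_ _ /(_ j ij) ->] := checked x i.
Qed.

Lemma sextic_nonorientable : nonorientable sextic_map.
Proof.
have /and4P[_ _ _ /hasP[k]] := ok; rewrite m mem_iota /= add0n => km.
case/and4P => k0 dk /eqP rk kN; pose j : 'I_p.+2 := Ordinal km.
have j0 : j != 0%R by [].
pose z : sextic_map := (decode (nseq d 0), 0%R, false).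
apply: (nonorientable_of_rule (x0 := z) (j := j) dp sextic_labelled sextic_rule) => //.
- by rewrite sextic_uniform 1?eq_sym // sub0r (dvd_val_opp dp).
- by apply/ord_inj; rewrite /= rk modn_small.
Qed.

End SexticModel.

Lemma sextic_model d p (eps : bool) : d = 1 \/ d = 2 -> d * 6.-1 = p.+2 ->
  exists (M : smap) (vt : M -> hamming d 6),
  [/\ labelled vt, rule vt (fun i : 'I_p.+2 => inZp (srho d eps i)),
      forall (z : M) (i j : 'I_p.+2), i != j ->
        hamming_adj (nbr vt z i) (nbr vt z j) = (d %| (i - j)%R)%N &
      nonorientable M].
Proof.
move=> d12 dp; have ok : scheck d eps.
  by case: d12 eps => -> []; vm_compute.
exists (sextic_map dp ok), (@sextic_vt d p eps dp ok); split.
- exact: sextic_labelled.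
- exact: sextic_rule.
- exact: sextic_uniform.
- exact: sextic_nonorientable.
Qed.

(** * Cycles *)

Lemma card_flags d n p (M : smap) (vt : M -> hamming d n) :
  d * n.-1 = p.+2 -> labelled vt -> #|M| = #|hamming d n| * (2 * p.+2).
Proof.
move=> dnp lab; rewrite -sum1_card (partition_big vt xpredT) //=.
rewrite -sum_nat_const; apply: eq_bigr => v _.
have [x <-] := vt_onto dnp lab v.
pose f (u : 'I_p.+2 * bool) := if u.2 then r2 M (turn x u.1) else turn x u.1.
have f_inj : injective f.
  have tI (i j : 'I_p.+2) : turn x i = turn x j -> i = j.
    by move=> E; apply: (@nbr_inj _ _ _ _ _ dnp lab x); rewrite /nbr E.
  have tN (i j : 'I_p.+2) : turn x i <> r2 M (turn x j).
    move=> E; have := spin_neq_r2 (i - j)%R (turn x j).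
    by rewrite -[_ _ (turn x j)]/(turn _ (i - j)%R) (turnD dnp lab) addrC subrK E eqxx.
  case=> i [] [j []]; rewrite /f /=.
  - by move/perm_inj/tI->.
  - by move/esym/tN.
  - by move/tN.
  - by move/tI->.
rewrite sum1_card -[RHS](_ : #|{: 'I_p.+2 * bool}| = _); last first.
  by rewrite card_prod card_ord card_bool mulnC.
rewrite -(card_codom f_inj); apply: eq_card => y; rewrite -[y \in _]/(true && (vt y == vt x)) andTb.
apply/eqP/codomP => [/esym/(vertex_flags lab)[k kE]|[[i s] ->]]; last first.
  by rewrite /f; case: s; rewrite /= ?(vt_r2 lab) (vt_turn lab).
have kI : (spin M ^+ k)%g x = turn x (inZp k : 'I_p.+2).
  by rewrite /turn /= (expg_mod k (spin_order dnp lab)).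
by case: kE => ->; [exists (inZp k, false) | exists (inZp k, true)]; rewrite /f -kI.
Qed.

(** One step along a cycle: turn to the other edge at the vertex and cross it. In degree 2 this is a
    product of two involutions. *)
Definition step (M : smap) (x : M) := flip M (spin M x).

Section Dihedral.
Variables (M : smap) (q : nat).
Hypotheses (spinK : forall x, spin M (spin M x) = x)
  (stepK : forall x, iter q.+2 (@step M) x = x).
Local Open Scope ring_scope.

Definition walk (z : M) (a : 'I_q.+2) (b : bool) :=
  iter a (@step M) (if b then spin M z else z).

Lemma iter_step_mod k (x : M) : iter (k %% q.+2) (@step M) x = iter k (@step M) x.
Proof.
have per (l : nat) y : iter (l * q.+2) (@step M) y = y.
  by elim: l => // l IHl; rewrite mulSn iterD IHl stepK.
by rewrite [in RHS](divn_eq k q.+2) addnC iterD per.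
Qed.

Lemma walk_add z a b k :
  iter k (@step M) (walk z a b) = walk z (a + k%:R) b.
Proof.
rewrite /walk -iterD -iter_step_mod; congr (iter _ _ _).
by rewrite Zp_nat /= modnDmr addnC.
Qed.

Lemma walk_spin z a b : spin M (walk z a b) = walk z (- a) (~~ b).
Proof.
have conj k x : iter k (@step M) (spin M (iter k (@step M) x)) = spin M x.
  have h u : step (spin M (step u)) = spin M u by rewrite /step spinK flipK.
  by elim: k => // k IHk; rewrite iterSr iterS h.
rewrite /walk iter_step_mod; set u := spin M _.
have -> : u = iter (q.+2 - a) (@step M) (iter a (@step M) u).
  by rewrite -iterD subnK ?stepK // ltnW.
by rewrite conj; case: b {u}; rewrite /= ?spinK.
Qed.

Lemma walk_flip z a b : flip M (walk z a b) = walk z (1 - a) (~~ b).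
Proof.
have -> : flip M (walk z a b) = iter 1 (@step M) (spin M (walk z a b)).
  by rewrite /= /step spinK.
by rewrite walk_spin walk_add addrC.
Qed.

End Dihedral.

Section Cycle.
Variables d n : nat.
Hypothesis dn2 : d * n.-1 = 2.
Local Notation order := #|hamming d n|.

Lemma onto_bij (aT rT : finType) (f : aT -> rT) :
  (forall y, exists x, y = f x) -> #|rT| = #|aT| -> bijective f.
Proof.
move=> onto card; apply: inj_card_bij; last by rewrite card.
have : #|codom f| == #|aT|.
  by rewrite -card; apply/eqP/eq_card => y; apply/codomP; have [x ->] := onto y; exists x.
by move/image_injP => fI x y; apply: fI.
Qed.

Lemma order_gt1 : 1 < order.
Proof.
rewrite card_ffun !card_ord; case: d n dn2 => [|k] [|[|m]] //; rewrite ?muln0 // => _.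
by rewrite expnS (leq_trans _ (leq_pmulr _ _)) // expn_gt0.
Qed.

Lemma cycle_spinK (M : smap) (vt : M -> hamming d n) (x : M) : labelled vt ->
  spin M (spin M x) = x.
Proof.
by move=> lab; rewrite -permM -(expgS _ 1) (spin_order dn2 lab) perm1.
Qed.

Lemma step_r2 (M : smap) (vt : M -> hamming d n) k (x : M) : labelled vt ->
  iter k (@step M) (r2 M x) = r2 M (iter k (@step M) x).
Proof.
move=> lab; elim: k => //= k ->; rewrite /step -flip_r2; congr (flip M _).
have := r2_spin 1 (iter k (@step M) x); rewrite expg1 => ->.
by apply: (canRL (permK _)); rewrite (cycle_spinK _ lab).
Qed.

(** Since [r2] is a power of [step], the involutions [spin] and [flip] already act transitively on
    flags. The dihedral group they generate has as many elements as there are flags, so the map is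
    that group acting on itself. *)
Lemma twisted_cycle_param (M : smap) (vt : M -> hamming d n) q (x0 : M) :
  order.*2 = q.+2 -> labelled vt -> (forall x, iter order (@step M) x = r2 M x) ->
  bijective (fun u : 'I_q.+2 * bool => walk x0 u.1 u.2) /\
  forall (a : 'I_q.+2) b, [/\ r2 M (walk x0 a b) = walk x0 (a + order%:R)%R b,
    flip M (walk x0 a b) = walk x0 (1 - a)%R (~~ b) &
    spin M (walk x0 a b) = walk x0 (- a)%R (~~ b)].
Proof.
move=> oq lab tw.
have sK x : spin M (spin M x) = x by apply: cycle_spinK lab.
have stK x : iter q.+2 (@step M) x = x by rewrite -oq -addnn iterD !tw r2K.
have mv (a : 'I_q.+2) b : [/\ r2 M (walk x0 a b) = walk x0 (a + order%:R)%R b,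
    flip M (walk x0 a b) = walk x0 (1 - a)%R (~~ b) &
    spin M (walk x0 a b) = walk x0 (- a)%R (~~ b)].
  by rewrite -tw walk_add // walk_flip // walk_spin.
split=> //; apply: onto_bij => [y|]; last first.
  by rewrite (card_flags dn2 lab) card_prod card_ord card_bool -oq -!muln2 mulnA.
apply: (@flag_ind M (fun y => exists u : 'I_q.+2 * bool, y = walk x0 u.1 u.2) _ x0).
  move=> z [[a b] ->] /=; rewrite r0E r1E.
  have [-> _ _] := mv a b; have [_ -> ->] := mv (a + order%:R)%R b.
  by split; [exists (1 - (a + order%:R), ~~ b)%R | exists (- (a + order%:R), ~~ b)%R
    | exists (a + order%:R, b)%R].
by exists (0%R, false).
Qed.

Lemma twisted_cycle_iso (M N : smap) (vM : M -> hamming d n) (vN : N -> hamming d n)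
    (x0 : M) (y0 : N) : labelled vM -> labelled vN ->
  (forall x, iter order (@step M) x = r2 M x) ->
  (forall x, iter order (@step N) x = r2 N x) ->
  exists f : M -> N, [/\ bijective f, map_hom f & f x0 = y0].
Proof.
move=> labM labN twM twN.
have [q oq] : exists q, order.*2 = q.+2.
  by case: order order_gt1 => // k _; exists k.*2.
have [bM mM] := twisted_cycle_param x0 oq labM twM.
have [bN mN] := twisted_cycle_param y0 oq labN twN.
have [g gK Kg] := bM.
pose f x := walk y0 (g x).1 (g x).2.
have fE (a : 'I_q.+2) b : f (walk x0 a b) = walk y0 a b.
  by rewrite /f (gK (a, b)).
exists f; split.
- by apply: (bij_comp bN); exists (fun u : 'I_q.+2 * bool => walk x0 u.1 u.2).
- move=> x; rewrite -(Kg x); case: (g x) => a b /=; rewrite !r0E !r1E.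
  have [-> _ _] := mM a b; have [_ -> ->] := mM (a + order%:R)%R b.
  rewrite !fE; have [-> _ _] := mN a b; have [_ -> ->] := mN (a + order%:R)%R b.
  by [].
by rewrite -[x0]/(walk x0 (0 : 'I_q.+2)%R false) fE.
Qed.

(** Now [r2] is independent of the dihedral group, which has two orbits on flags, exchanged by [r2];
    they are the two orientations. *)
Lemma untwisted_cycle_orientable (M : smap) (vt : M -> hamming d n) :
  labelled vt -> (forall x, iter order (@step M) x = x) -> orientable M.
Proof.
move=> lab utw.
case: (pickP (@predT M)) => [x0 _|M0]; last by exists xpredT => x; have := M0 x.
have [q oq] : exists q, order = q.+2 by case: order order_gt1 => [|[|k]] // _; exists k.
rewrite oq in utw; have sK x : spin M (spin M x) = x by apply: cycle_spinK lab.
pose F (u : 'I_q.+2 * bool * bool) := walk (if u.2 then r2 M x0 else x0) u.1.1 u.1.2.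
have mv a b t : [/\ r2 M (F (a, b, t)) = F (a, b, ~~ t),
    flip M (F (a, b, t)) = F ((1 - a)%R, ~~ b, t) & spin M (F (a, b, t)) = F ((- a)%R, ~~ b, t)].
  rewrite /F /= walk_flip // walk_spin //; split=> //.
  have r2s z : r2 M (spin M z) = spin M (r2 M z).
    have := r2_spin 1 z; rewrite expg1 => ->.
    by apply: (canLR (permK _)); rewrite sK.
  by rewrite /walk -(step_r2 _ _ lab); case: b t => [] []; rewrite /= -?r2s ?r2K.
have [g gK Kg] : bijective F.
  apply: onto_bij => [y|]; last first.
    by rewrite (card_flags dn2 lab) !card_prod card_ord card_bool oq -mulnA.
  apply: (@flag_ind M (fun y => exists u, y = F u) _ x0); last by exists (0%R, false, false).
  move=> z [[[a b] t] ->]; rewrite r0E r1E.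
  have [-> _ _] := mv a b t; have [_ -> ->] := mv a b (~~ t).
  by split; eexists.
exists (fun y => (g y).2) => x; rewrite -(Kg x); case: (g x) => [[a b] t].
rewrite r0E r1E; have [-> _ _] := mv a b t; have [_ -> ->] := mv a b (~~ t).
by rewrite !gK.
Qed.

End Cycle.

(** * Classification *)

Section Cases.
Variables (d n p : nat) (M : smap) (vt : M -> hamming d n).
Hypotheses (dnp : d * n.-1 = p.+2) (n3 : 2 < n) (lab : labelled vt) (reg : regular M).
Variable x0 : M.

(** The signs at d and 2d fix [rho] on the multiples of d, by oddness. This is everything for d = 1;
    for d = 2 the odd positions modulo 10 remain. *)
Lemma sextic_rho (rho : 'I_p.+2 -> 'I_p.+2) (e : 'I_p.+2 -> bool) :
  n = 6 -> 0 < d <= 2 -> rule vt rho ->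
  (forall j : 'I_p.+2, (j != 0%R) && (d %| j) -> rho j = sg (~~ e j) j /\
     forall i, i != 0%R -> i != j ->
       (rho (rho i + sg (e j) j) = sg (e j) (rho (i - j)) - j)%R) ->
  e (1 * d)%:R%R != e (2 * d)%:R%R ->
  forall i, rho i = inZp (srho d (e (1 * d)%:R%R) i).
Proof.
move=> n6 d12 ru eP ne; subst n.
have e2 : e (2 * d)%:R%R = ~~ e (1 * d)%:R%R by case: (e _) (e _) ne => [] [].
have rN := rhoN dnp lab x0 ru; have rK := rhoK dnp lab x0 ru.
have r0 i := rho_eq0 dnp lab x0 ru i; have rz := rho0 ru.
have rdvd i j := rho_dvd dnp lab reg x0 ru (i := i) (j := j).
suff vals : forall k : nat, k < p.+2 -> rho (inZp k) = inZp (srho d (e (1 * d)%:R%R) k).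
  by move=> i; rewrite -{1}(valZpK i); apply: vals.
have go eps (k : nat) (a b : 'I_p.+2) : rho a = b -> a = inZp k ->
    b = inZp (srho d eps k) -> rho (inZp k) = inZp (srho d eps k) by move=> <- <-.
have [d1|d2] : d = 1 \/ d = 2 by lia.
  subst d; have p3 : p = 3 by lia.
  subst p.
  have [h1 _] := eP (inZp 1) isT; have [h2 _] := eP (inZp 2) isT.
  move: e2 h1 h2; rewrite !Zp_nat => ->; move: (e _) => eps h1 h2.
  have h3 := rN (inZp 2); have h4 := rN (inZp 1); rewrite h2 in h3; rewrite h1 in h4.
  case=> [|[|[|[|[|//]]]]] _.
  - by apply: (go _ _ _ _ rz); [|case: (eps)]; apply/val_inj.
  - by apply: (go _ _ _ _ h1); [|case: (eps)]; apply/val_inj.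
  - by apply: (go _ _ _ _ h2); [|case: (eps)]; apply/val_inj.
  - by apply: (go _ _ _ _ h3); [|case: (eps)]; apply/val_inj.
  - by apply: (go _ _ _ _ h4); [|case: (eps)]; apply/val_inj.
subst d; have p8 : p = 8 by lia.
subst p; pose o k : 'I_10 := inZp k.
have [h2 f2] := eP (o 2) isT; have [h4 _] := eP (o 4) isT.
move: e2 h2 h4 f2; rewrite !Zp_nat => ->; move: (e _) => eps h2 h4 f2.
(* 5 is the only nonzero element equal to its negative modulo 10. *)
have h5 : rho (o 5) = o 5.
  have : rho (o 5) = (- rho (o 5))%R by rewrite -rN; congr rho; apply/val_inj.
  have := r0 (o 5); case: (rho _) => -[|[|[|[|[|[|[|[|[|[|//]]]]]]]]]] lt // _;
    by move/(congr1 val) => // _; apply/val_inj.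
(* The triangle of angle 2 at position 5 determines twice [rho 3]; the parity of [rho 3] then
   decides between the two halves. *)
have h3 : rho (o 3) = if eps then o 9 else o 1.
  have := f2 (o 5) isT isT; rewrite h5.
  have -> : (o 5 - inZp 2)%R = o 3 by apply/val_inj.
  have -> : (o 5 + sg eps (inZp 2))%R = sg (~~ eps) (o 3) by case: (eps); apply/val_inj.
  have := rdvd (o 3) (o 5) isT; rewrite h5.
  have -> : rho (sg (~~ eps) (o 3)) = sg (~~ eps) (rho (o 3)) by case: (eps); rewrite //= rN.
  case: (rho _) => -[|[|[|[|[|[|[|[|[|[|//]]]]]]]]]] lt // _;
    by case: (eps) => /(congr1 val) // _; apply/val_inj.
have h1 : rho (o 1) = if eps then o 7 else o 3.
  have := rK (o 3); rewrite h3; case: (eps) => // h9.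
  have -> : o 1 = (- o 9)%R by apply/val_inj.
  by rewrite rN h9; apply/val_inj.
have h6 := rN (o 4); have h7 := rN (o 3); have h8 := rN (o 2); have h9 := rN (o 1).
rewrite h4 in h6; rewrite h3 in h7; rewrite h2 in h8; rewrite h1 in h9.
case=> [|[|[|[|[|[|[|[|[|[|//]]]]]]]]]] _.
- by apply: (go _ _ _ _ rz); [|case: (eps)]; apply/val_inj.
- by apply: (go _ _ _ _ h1); [|case: (eps)]; apply/val_inj.
- by apply: (go _ _ _ _ h2); [|case: (eps)]; apply/val_inj.
- by apply: (go _ _ _ _ h3); [|case: (eps)]; apply/val_inj.
- by apply: (go _ _ _ _ h4); [|case: (eps)]; apply/val_inj.
- by apply: (go _ _ _ _ h5); [|case: (eps)]; apply/val_inj.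
- by apply: (go _ _ _ _ h6); [|case: (eps)]; apply/val_inj.
- by apply: (go _ _ _ _ h7); [|case: (eps)]; apply/val_inj.
- by apply: (go _ _ _ _ h8); [|case: (eps)]; apply/val_inj.
- by apply: (go _ _ _ _ h9); [|case: (eps)]; apply/val_inj.
Qed.

Lemma regular_cases : exists2 rho : 'I_p.+2 -> 'I_p.+2, rule vt rho &
  (n = 3 \/ n = 4) /\ (exists e, forall i, rho i =
      if (d %| i)%N then sg (~~ e) i else (sg e i + (3 * d)%:R)%R) \/
  [/\ n = 6, d = 1 \/ d = 2 & exists eps, forall i, rho i = inZp (srho d eps i)].
Proof.
have [rho ru] := rule_exists dnp lab reg x0; exists rho => //.
have [e eP] := triangle_signs dnp lab reg x0 ru.
have d0 : 0 < d by case: d dnp.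
have m1 : 1 < n.-1 by lia.
have [[m3 [e0 [_ rE]]]|[m5 d2 ne]] := @rho_cases d n.-1 p dnp rho e (rho0 ru)
    (rhoN dnp lab x0 ru) (rhoK dnp lab x0 ru) (@rho_dvd _ _ _ _ _ dnp lab reg x0 _ ru)
    (fun j Ej => let: And4 _ h _ _ := eP j Ej in h)
    (fun j Ej => let: And4 _ _ h _ := eP j Ej in h)
    (fun i j Ej => let: And4 _ _ _ h := eP j Ej in h i) d0 m1.
  left; split; first by lia.
  by exists e0.
right; have n6 : n = 6 by lia.
split=> //; first by lia.
exists (e (1 * d)%:R%R); apply: sextic_rho => //; first by rewrite d0.
by move=> j Ej; have [] := eP j Ej.
Qed.

End Cases.

Lemma rule_ext d n p (M : smap) (vt : M -> hamming d n) (rho rho' : 'I_p.+2 -> 'I_p.+2) :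
  rho =1 rho' -> rule vt rho -> rule vt rho'.
Proof.
move=> E [r0 r]; split=> [|x i i0]; first by rewrite -E.
by rewrite -E r.
Qed.

Lemma nonorientable_flag (M : smap) : nonorientable M -> exists x : M, True.
Proof.
move=> nor; case: (pickP (@predT M)) => [x _|M0]; first by exists x.
by case: nor; exists xpredT => x; have := M0 x.
Qed.

Lemma labelled_flag d n p (M : smap) (vt : M -> hamming d n) :
  d * n.-1 = p.+2 -> labelled vt -> exists x : M, True.
Proof.
move=> dnp lab; have /card_gt0P[v _] : 0 < #|hamming d n|.
  by rewrite card_ffun !card_ord expn_gt0; case: (n) dnp => [|k]; rewrite ?muln0.
by have [x _] := vt_onto dnp lab v; exists x.
Qed.

(** The image of a closed triangle walk of M returns to its starting vertex in N, but in N the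
    number of that vertex before the last flip is governed by [rho']. So the two permutations agree
    on multiples of d. *)
Lemma rule_hom d n p (M N : smap) (vM : M -> hamming d n) (vN : N -> hamming d n)
    (f : M -> N) (x : M) (rho rho' : 'I_p.+2 -> 'I_p.+2) (j : 'I_p.+2) :
  d * n.-1 = p.+2 -> labelled vM -> labelled vN -> rule vM rho -> rule vN rho' ->
  (forall (z : N) (i k : 'I_p.+2), i != k ->
     hamming_adj (nbr vN z i) (nbr vN z k) = (d %| (i - k)%R)%N) ->
  hamming_adj (nbr vM x (0 : 'I_p.+2)%R) (nbr vM x j) ->
  map_hom f -> j != 0%R -> d %| j -> rho' j = rho j.
Proof.
move=> dnp labM labN ruM ruN un aj fh j0 dj.
have [e [wE rE _]] := triangleP dnp labM x ruM j0 aj.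
have dk : d %| rho j by rewrite rE; case: (~~ e) => //=; rewrite (dvd_val_opp dnp).
have k0 : rho j != 0%R by rewrite (rho_eq0 dnp labM x ruM).
move: dk k0 wE; rewrite /triangle_walk; set k := rho j => dk k0 wE.
have f0 z : f (r0 M z) = r0 N (f z) by case: (fh z).
have f1 z : f (r1 M z) = r1 N (f z) by case: (fh z).
have f2 z : f (r2 M z) = r2 N (f z) by case: (fh z).
have ff z : f (flip M z) = flip N (f z) by rewrite !flipE f0 f2.
have ft z (i : 'I_p.+2) : f (turn z i) = turn (f z) i.
  rewrite /turn; elim: (nat_of_ord i) => [|l IHl]; first by rewrite !expg0 !perm1.
  by rewrite !expgSr !permM !spinE f1 f2 IHl.
have := congr1 (vN \o f) wE; rewrite /= !(ff, ft).
set y := f x; set q := turn (flip N y) k.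
have -> : vN (f (if e then r2 M (turn x j) else turn x j)) = vN y.
  by case: (e); rewrite ?f2 ft ?(vt_r2 labN) (vt_turn labN).
rewrite (vt_flip p labN) (nbr_turn dnp labN) addr0 => E.
have qk : nbr vN q (- k)%R = vN y by rewrite (nbr_turn dnp labN) subrr (nbr_flip p labN).
have rN := rhoN dnp labN y ruN; have rK := rhoK dnp labN y ruN.
have : nbr vN (flip N q) (rho' (- k)%R) = nbr vN q (- k)%R.
  rewrite ruN.2 ?oppr_eq0 // compl_line ?(nbr_adj labN) //.
  by rewrite un 1?eq_sym ?oppr_eq0 // sub0r opprK.
rewrite qk -E => /(nbr_inj dnp labN); rewrite rN => /oppr_inj <-.
exact: rK.
Qed.

Lemma count_one (K : sgraph) (M : smap) (vt : M -> K) :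
  labelled vt -> (forall v, exists x, vt x = v) -> nonorientable M -> regular M ->
  (forall L : embedding K, nonor_reg_embedding L ->
     exists2 f : L -> M, bijective f & map_hom f) ->
  nonor_reg_count K 1.
Proof.
move=> lab onto nor reg uniq.
exists (fun=> embedding_of lab onto); split=> [i|i j _|L nL]; first by split.
  by rewrite (ord1 i) (ord1 j).
by exists ord0; apply: uniq.
Qed.

Lemma count_line d n p :
  n = 3 \/ n = 4 -> d * n.-1 = p.+3 -> nonor_reg_count (hamming d n) 1.
Proof.
move=> n34 dnp; have [M [vM [labM ruM unM _ triM]]] := line_model true n34 dnp.
have regM : regular M by apply: (regular_of_uniform dnp labM ruM); exact: unM.
have norM : nonorientable M.
  (* The triangle walk preserves an orientation, yet in this model it ends at a mirror image. *)
  move=> [o /(@orientation_moves _ _ p.+1)[o2 oF ot]].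
  have [x _] := labelled_flag dnp labM.
  by have := congr1 o (triM x); rewrite /triangle_walk !(oF, ot, o2); case: (o x).
apply: (count_one labM (vt_onto dnp labM) norM regM) => L [norL regL].
have [vL labL] := embedding_labelled L; have [x _] := nonorientable_flag norL.
have n3 : 2 < n by lia.
have [rho ru [[_ [e rE]]|[]]] := regular_cases dnp n3 labL regL x; last by lia.
have ruE := rule_ext rE ru.
(* For the other sign the map would be isomorphic to the orientable model. *)
case: e rE ruE => _ ruE; last first.
  have [N [vN [labN ruN unN orN _]]] := line_model false n34 dnp.
  have [y _] := vt_onto dnp labN (vL x).
  have [f [_ fh _]] := map_iso_of_uniform dnp labL labN ruE ruN (adj_nbr dnp labL regL x) (unN y).
  by case: norL; apply: orientable_iso fh (orN isT).
have [y _] := vt_onto dnp labM (vL x).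
have [f [fb fh _]] := map_iso_of_uniform dnp labL labM ruE ruM (adj_nbr dnp labL regL x) (unM y).
by exists f.
Qed.

Lemma count_sextic d : d = 1 \/ d = 2 -> nonor_reg_count (hamming d 6) 2.
Proof.
move=> d12; have [p dnp] : exists p, d * 6.-1 = p.+3 by exists (d * 5 - 3); lia.
have [M1 [v1 [lab1 ru1 un1 nor1]]] := sextic_model false d12 dnp.
have [M2 [v2 [lab2 ru2 un2 nor2]]] := sextic_model true d12 dnp.
have reg1 : regular M1 by apply: (regular_of_uniform dnp lab1 ru1); exact: un1.
have reg2 : regular M2 by apply: (regular_of_uniform dnp lab2 ru2); exact: un2.
pose E1 := embedding_of lab1 (vt_onto dnp lab1).
pose E2 := embedding_of lab2 (vt_onto dnp lab2).
have D0 : ((1 * d)%:R : 'I_p.+3)%R != 0%R by rewrite (mul_natr_eq0 dnp).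
have dD : d %| ((1 * d)%:R : 'I_p.+3)%R by apply: (dvd_val_natr dnp).
have diff : (inZp (srho d false ((1 * d)%:R : 'I_p.+3)%R) : 'I_p.+3) <>
    inZp (srho d true ((1 * d)%:R : 'I_p.+3)%R).
  rewrite (val_mul_natr dnp) => /(congr1 val) /=; rewrite -dnp.
  by case: d12 => ->.
have hom12 (f : M1 -> M2) : ~ map_hom f.
  move=> fh; have [x _] := nonorientable_flag nor1; apply: diff.
  apply/esym/(rule_hom dnp lab1 lab2 ru1 ru2 un2 _ fh D0 dD (x := x)).
  by rewrite un1 1?eq_sym // sub0r (dvd_val_opp dnp).
have hom21 (f : M2 -> M1) : ~ map_hom f.
  move=> fh; have [x _] := nonorientable_flag nor2; apply: diff.
  apply: (rule_hom dnp lab2 lab1 ru2 ru1 un1 _ fh D0 dD (x := x)).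
  by rewrite un2 1?eq_sym // sub0r (dvd_val_opp dnp).
exists (fun i : 'I_2 => if i == ord0 then E1 else E2); split.
- by move=> i; case: ifP.
- move=> i j; case: (eqVneq i ord0) => [->|i0]; case: (eqVneq j ord0) => [->|j0] //.
  + by case=> f _ /hom12.
  + by case=> f _ /hom21.
  by move=> _; apply/val_inj; case: i i0 => -[|[|//]] // ?; case: j j0 => -[|[|//]].
move=> L [norL regL].
have [vL labL] := embedding_labelled L; have [x _] := nonorientable_flag norL.
have [rho ru [[]|[_ _ [e rE]]]] := regular_cases dnp isT labL regL x; first by lia.
have ruE := rule_ext rE ru.
case: e rE ruE => _ ruE.
  have [y _] := nonorientable_flag nor2.
  have [f [fb fh _]] := map_iso_of_uniform dnp labL lab2 ruE ru2 (adj_nbr dnp labL regL x) (un2 y).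
  by exists ord_max; exists f.
have [y _] := nonorientable_flag nor1.
have [f [fb fh _]] := map_iso_of_uniform dnp labL lab1 ruE ru1 (adj_nbr dnp labL regL x) (un1 y).
by exists ord0; exists f.
Qed.

Lemma turn1 (M : smap) (x : M) (i : 'I_2) : i != 0%R -> turn x i = spin M x.
Proof. by case: i => -[|[|//]] // ? _; rewrite /turn /= expg1. Qed.

Lemma twisted_nonorientable (M : smap) (x : M) k :
  iter k (@step M) x = r2 M x -> nonorientable M.
Proof.
move=> tw [o oP]; have [o2 oF _] := @orientation_moves M o 0 oP.
have os y : o (step y) = o y.
  by rewrite /step oF spinE; have [_ -> _] := oP (r2 M y); rewrite o2 negbK.
have := o2 x; rewrite -tw; have -> : o (iter k (@step M) x) = o x.
  by elim: k {tw} => //= k <-.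
by case: (o x).
Qed.

Lemma count_cycle d n (M : smap) (vt : M -> hamming d n) : d * n.-1 = 2 ->
  labelled vt -> (forall x, iter #|hamming d n| (@step M) x = r2 M x) ->
  (forall (L : smap) (vL : L -> hamming d n), labelled vL -> regular L -> nonorientable L ->
     exists e : bool, forall x,
       iter #|hamming d n| (@step L) x = if e then r2 L x else x) ->
  nonor_reg_count (hamming d n) 1.
Proof.
move=> dn2 lab tw all_tw; have [x0 _] := labelled_flag dn2 lab.
apply: (count_one lab (vt_onto dn2 lab) (twisted_nonorientable (tw x0))).
  by apply: regularI => x y; apply: (twisted_cycle_iso dn2 x y lab lab tw tw).
move=> L [norL regL]; have [vL labL] := embedding_labelled L.
have [y _] := nonorientable_flag norL.
have [[] twL] := all_tw L vL labL regL norL.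
  have [f [fb fh _]] := twisted_cycle_iso dn2 y x0 labL lab twL tw.
  by exists f.
by case: norL; apply: (untwisted_cycle_orientable dn2 labL).
Qed.

Lemma rho2 (rho : 'I_2 -> 'I_2) (i : 'I_2) : (rho i == 0%R) = (i == 0%R) -> rho i = i.
Proof.
by move: (rho i) => r; case: i r => -[|[|//]] ? [[|[|//]] ?] // _; apply/val_inj.
Qed.

Lemma count_triangle : nonor_reg_count (hamming 1 3) 1.
Proof.
have card3 : #|hamming 1 3| = 3 by rewrite card_ffun !card_ord.
have [M [vt [lab ru _ _ triM]]] := @line_model 1 3 0 true (or_introl erefl) erefl.
(* In Z/2 every turn of the triangle walk is by 1 = -1, so the walk started at [spin L x] is a tour
   of the cycle. *)
have i1 (L : smap) (vL : L -> hamming 1 3) rho (x : L) : labelled vL -> rule vL rho ->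
    iter 3 (@step L) x = triangle_walk rho (1%R : 'I_2) (spin L x).
  move=> labL ruL; have r1 : rho (1%R : 'I_2) = 1%R.
    by apply: rho2; rewrite (rho_eq0 (erefl : 1 * 3.-1 = 0.+2) labL x ruL).
  by rewrite /triangle_walk r1 !turn1 // /step; do !rewrite (cycle_spinK _ labL).
have dn2 : 1 * 3.-1 = 2 by [].
apply: (count_cycle dn2 lab) => [x|L vL labL regL norL]; rewrite card3.
  rewrite (i1 _ _ _ _ lab ru); have := triM (spin M x); rewrite /=.
  have -> : ((1 * 1)%:R = 1 :> 'I_2)%R by apply/val_inj.
  by move=> ->; rewrite turn1 // (cycle_spinK dn2 _ lab).
have [x0 _] := nonorientable_flag norL.
have [rho ruL] := rule_exists dn2 labL regL x0.
have [e eP] := triangle_signs dn2 labL regL x0 ruL.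
have [wE _ _ _] := eP 1%R isT; exists (e 1%R) => x.
by rewrite (i1 _ _ _ _ labL ruL) wE turn1 // (cycle_spinK dn2 _ labL).
Qed.

Section Square.
Local Notation V := {ffun 'I_2 -> 'I_2}.
Implicit Types (x : V) (i : 'I_2).

Definition square_nb x i : V := bitflip x i.
Definition square_bk x i : 'I_2 := i.
(* One of the four edges is twisted. *)
Definition square_tw x i := (i == ord0) && (x ord_max == ord0).

Lemma square_nb_adj x i : hamming_adj x (square_nb x i).
Proof. exact: bitflip_adj. Qed.

Lemma square_nb_inj x : injective (square_nb x).
Proof. by move=> i j; apply: bitflip_inj. Qed.

Lemma square_nb_bk x i : square_nb (square_nb x i) (square_bk x i) = x.
Proof. exact: bitflipK. Qed.

Lemma square_tw_bk x i : square_tw (square_nb x i) (square_bk x i) = square_tw x i.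
Proof.
rewrite /square_tw /square_bk; case: eqVneq => //= ->.
by rewrite /square_nb bitflip_other.
Qed.

Lemma square_dn : 2 * 2.-1 = 0.+2. Proof. by []. Qed.

Definition square_map : smap :=
  rotation_map square_dn square_nb_adj square_nb_inj square_nb_bk square_tw_bk.

Lemma square_step x i s : step ((x, i, s) : square_map) =
  (bitflip x (rev_ord i), rev_ord i, s (+) square_tw x (rev_ord i)).
Proof.
rewrite /step -(turn1 _ (i := 1%R)) // rotation_turn rotation_flip.
rewrite (_ : (i + sg s 1)%R = rev_ord i) //.
by apply/val_inj; case: s; case: i => -[|[|//]].
Qed.

(** A tour crosses each edge once, among them the single twisted one. *)
Lemma square_twisted (z : square_map) : iter 4 (@step square_map) z = r2 square_map z.
Proof.
case: z => [[x i] s]; rewrite rotation_r2 /rs2 /iter !square_step !rev_ordK.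
congr (_, _, _).
  by rewrite (bitflipC (bitflip x _) i) !bitflipK.
have flip_eq (t : 'I_2) : (rev_ord t == ord0) = (t != ord0) by case: t => -[|[|]].
have [->|->] : i = ord0 \/ i = ord_max.
  by case: i => -[|[|//]] ?; [left | right]; apply/val_inj.
- have -> : rev_ord (ord0 : 'I_2) = ord_max by apply/val_inj.
  rewrite /square_tw /= !addbF !ffunE /=.
  by rewrite !flip_eq negbK; case: s (x _ == _) => [] [].
have -> : rev_ord (ord_max : 'I_2) = ord0 by apply/val_inj.
rewrite /square_tw /= !addbF !ffunE /=.
by rewrite !flip_eq; case: s (x _ == _) => [] [].
Qed.

Lemma count_square : nonor_reg_count (hamming 2 2) 1.
Proof.
have card4 : #|hamming 2 2| = 4 by rewrite card_ffun !card_ord.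
have lab := rotation_labelled square_dn square_nb_adj square_nb_inj square_nb_bk square_tw_bk.
have dn2 : 2 * 2.-1 = 2 by [].
apply: (count_cycle dn2 lab) => [x|L vL labL regL norL]; rewrite card4.
  exact: square_twisted.
have [x0 _] := nonorientable_flag norL.
have [rho ruL] := rule_exists dn2 labL regL x0.
have r1 : rho (1%R : 'I_2) = 1%R.
  by apply: rho2; rewrite (rho_eq0 dn2 labL x0 ruL).
have [e [wE _]] := square_signs dn2 labL regL x0 ruL (isT : (1%R : 'I_2) != 0%R) isT.
exists e => x; have := wE (spin L x); rewrite /square_walk r1 !turn1 //.
by rewrite (cycle_spinK dn2 _ labL).
Qed.

End Square.

Unset Implicit Arguments.

Theorem theorem1p1 (d n : nat) (hd : 1 <= d) (hn : 2 <= n) :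
  ((exists M : embedding (hamming d n), nonor_reg_embedding M) <->
   [\/ n = 2 /\ d = 2, n = 3 \/ n = 4 | n = 6 /\ (d = 1 \/ d = 2)]) /\
  (((n = 2 /\ d = 2) \/ (n = 3 \/ n = 4)) ->
     nonor_reg_count (hamming d n) 1) /\
  (n = 6 /\ (d = 1 \/ d = 2) -> nonor_reg_count (hamming d n) 2).
Proof.
have one : (n = 2 /\ d = 2) \/ (n = 3 \/ n = 4) -> nonor_reg_count (hamming d n) 1.
  case=> [[-> ->]|n34]; first exact: count_square.
  (* Degree 2 occurs here only for the triangle; in all other cases the degree is at least 3 and
     [rho] determines the map. *)
  case: (eqVneq (d * n.-1) 2) => [dn2|dn2].
    have [-> ->] : d = 1 /\ n = 3 by case: n34 dn2 => -> /=; lia.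
    exact: count_triangle.
  by apply: (count_line (p := d * n.-1 - 3) n34); case: n34 dn2 => -> /=; lia.
have two : n = 6 /\ (d = 1 \/ d = 2) -> nonor_reg_count (hamming d n) 2.
  by case=> -> d12; apply: count_sextic.
split=> //; split=> [[M nrM]|cases].
  case: (eqVneq n 2) => [n2|n2].
    by subst n; constructor 1; split=> //; apply: (cube_nonorientable hd nrM).
  have n3 : 2 < n by lia.
  have [p dnp] : exists p, d * n.-1 = p.+2.
    by exists (d * n.-1 - 2); have := leq_pmull n.-1 hd; lia.
  case: nrM => nor reg; have [vt lab] := embedding_labelled M.
  have [x _] := nonorientable_flag nor.
  have [rho _ [[n34 _]|[n6 d12 _]]] := regular_cases dnp n3 lab reg x.
    by constructor 2.
  by constructor 3.
have first k : nonor_reg_count (hamming d n) k.+1 ->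
    exists M : embedding (hamming d n), nonor_reg_embedding M.
  by case=> s [sP _ _]; exists (s ord0).
case: cases => h; [apply: (first 0); apply: one | apply: (first 0); apply: one | apply: (first 1); apply: two];
  by auto.
Qed.
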